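(* Let $L$ be an algebraically closed field with $\mathrm{char}(L)\neq 2$. Let $F\in L[X,Y]$ be an irreducible polynomial defining an irreducible plane algebraic curve $C$ with an ordinary double point at $(0,0)$. Let $l_{\gamma_1}$ and $l_{\gamma_2}$ be the tangent lines to the two branches $\gamma_1,\gamma_2$ of $C$ centred at $(0,0)$, given in affine coordinates by $aX+bY=0$ and $cX+dY=0$. Let $(u,v)\in L^2$ be any non-zero vector such that the line $vX-uY=0$ is distinct from $l_{\gamma_1}$ and $l_{\gamma_2}$. Let $\{C_t\}_{t\in A^1}$ be the family of irreducible curves defined by $$F_t(X,Y)=F(X-tu,Y-tv)=0\qquad (t\in A^1).$$ Then, for generic $t\in A^1\cap\mathcal{V}_0$, there exist exactly two points $\{q_1,q_2\}=C\cap C_t\cap\mathcal{V}_{(0,0)}$. Moreover, $q_1$ lies on the branch $\gamma_1$ of $C$ and $q_2$ lies on the branch $\gamma_2$ of $C$ (after suitably labelling the two points). Finally, $C$ and $C_t$ intersect transversely at $q_1$ and at $q_2$.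
   Context: Ordinary double point: for a nonzero $F\in L[X,Y]$ of degree $n$ with $F(0,0)=0$, the point $(0,0)$ is an ordinary double point of $F$ if $F=F_2+\dots+F_n$ with each $F_j$ homogeneous of degree $j$, $F_2\neq 0$, and the two linear factors of $F_2$ are distinct (non-proportional). Infinitesimal neighbourhoods: fix an algebraically closed extension $K\supset L$ of infinite transcendence degree with a valuation ring $\mathcal{O}\supset L$ of $K$ with fraction field $K$ and maximal ideal $\mathfrak{m}\neq 0$ such that $L\to\mathcal{O}/\mathfrak{m}$ is an isomorphism. Reduction modulo $\mathfrak{m}$ gives specialisation maps $P^n(K)\to P^n(L)$. For a point $p$ over $L$, $\mathcal{V}_p$ denotes the set of $K$-points specialising to $p$. Thus $A^1\cap\mathcal{V}_0=\mathfrak{m}$, and $\mathcal{V}_{(0,0)}=\mathfrak{m}\times\mathfrak{m}$ in the affine plane. Generic means generic over $L$ (for $t\in A^1$: transcendental over $L$). The intersection $C\cap C_t$ is taken over $K$. Branches: let $\Phi:C^{ns}\to \overline{C}$ be the normalisation (nonsingular model) of the projective closure $\overline{C}\subset P^2$ of $C$. The branches of $C$ centred at a point $p$ are in bijection with the points of $\Phi^{-1}(p)$; a point $q$ lies on the branch $\gamma_j$ corresponding to $p_j\in \Phi^{-1}(p)$ if $q=\Phi(x)$ for some $x\in C^{ns}(K)\cap\mathcal{V}_{p_j}$. For an ordinary double point of an irreducible curve there are exactly two branches. Branched intersection multiplicity: let $H$ be a plane curve of degree $e$ not containing $C$ as a component, and let $\gamma$ be the branch of $C$ corresponding to $p_\gamma\in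 C^{ns}$. Let $\Sigma$ be a linear system of plane curves $\{H_{\bar v}:\bar v\in Par_\Sigma\}$ of degree $e$ (with $Par_\Sigma$ a projective space), maximal among linear systems all of whose members have finite intersection with $C$, and containing $H=H_{\bar v_0}$. Let $\overline{H_{\bar v}}=\Phi^{-1}(H_{\bar v})$. Then $I_\gamma(C,H)=\mathrm{Card}\left(C^{ns}(K)\cap\overline{H_{\bar v'}}\cap\mathcal{V}_{p_\gamma}\right)$ for $\bar v'\in\mathcal{V}_{\bar v_0}$ generic in $Par_\Sigma$. Tangent line of a branch: for a branch $\gamma_j$ at an ordinary double point, $l_{\gamma_j}$ is the unique line through the point with $I_{\gamma_j}(C,l_{\gamma_j})\geq 2$. Transverse: $C$ and $C_t$ intersect transversely at $q$ if $q$ is a nonsingular point of both and their tangent lines at $q$ are distinct. *)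

(* Defs.v *)
From HB Require Import structures.
From mathcomp Require Import all_boot all_order all_algebra.
From mathcomp Require Import mpoly.
Set Implicit Arguments.
Unset Strict Implicit.
Unset Printing Implicit Defensive.
Import GRing.Theory.
Local Open Scope ring_scope.

(* A point of P^(n-1)(R) is a nonzero row vector of length n, up to [peq].
   Lines of P^2 are points of the dual plane, so [peq] also compares lines. *)
Definition peq (R : fieldType) (n : nat) (x y : 'rV[R]_n) : Prop :=
  exists2 c : R, c != 0 & y = c *: x.

(* S, a [peq]-invariant set of nonzero vectors, represents exactly k points. *)
Definition proj_card (R : fieldType) (n : nat) (S : 'rV[R]_n -> Prop)
    (k : nat) : Prop :=
  exists x : 'I_k -> 'rV[R]_n,
    [/\ forall i, S (x i),
        forall i j, peq (x i) (x j) -> i = j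
      & forall y, S y -> exists i, peq (x i) y].

Definition eval_row (R : fieldType) (n p : nat) (P : 'I_p -> {mpoly R[n]})
    (x : 'rV[R]_n) : 'rV[R]_p := \row_j (P j).@[x 0].

Definition form_family (R : fieldType) (n p : nat)
    (P : 'I_p -> {mpoly R[n]}) (d : nat) : Prop :=
  forall j, P j \is d.-homog.

Definition affine_pt (R : fieldType) (n : nat) (q : 'rV[R]_n) : 'rV[R]_(n + 1) :=
  row_mx q (const_mx 1).

Definition row3 (R : fieldType) (a b c : R) : 'rV[R]_3 :=
  \row_(i < 3) [:: a; b; c]`_i.

Definition infinite_trdeg (L K : fieldType) (iota : {rmorphism L -> K}) : Prop :=
  forall n : nat, exists x : 'I_n -> K,
    forall P : {mpoly L[n]}, P != 0 -> (map_mpoly iota P).@[x] != 0.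

Definition max_ideal (K : fieldType) (O : {pred K}) : {pred K} :=
  [pred x in O | (x == 0) || (x^-1 \notin O)].

(* [vr_total] makes O a valuation ring with fraction field K; [vr_residue]
   says that L -> O/m is bijective. *)
Record specialisation_ring (L K : fieldType) (iota : {rmorphism L -> K})
    (O : {pred K}) : Prop := SpecialisationRing {
  vr_subring : subring_closed O;
  vr_total : forall x : K, x \in O \/ x^-1 \in O;
  vr_nontrivial : exists2 x : K, x \in max_ideal O & x != 0;
  vr_base : forall a : L, iota a \in O;
  vr_residue : forall x : K, x \in O -> exists! a : L, x - iota a \in max_ideal O
}.

(* x lies in V_p. Some rescaling of x has all coordinates in O, not all of
   them in m, and reduces to p; since L maps onto O/m the rescaling can be
   chosen to reduce to the given representative of p. *)
Definition specialises (L K : fieldType) (iota : {rmorphism L -> K})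
    (O : {pred K}) (n : nat) (x : 'rV[K]_n) (p : 'rV[L]_n) : Prop :=
  exists2 c : K, c != 0 & forall i, c * x 0 i - iota (p 0 i) \in max_ideal O.

Definition generic_pt (L K : fieldType) (iota : {rmorphism L -> K}) (n : nat)
    (x : 'rV[K]_n) : Prop :=
  x != 0 /\
  forall (d : nat) (P : {mpoly L[n]}),
    P \is d.-homog -> P != 0 -> (map_mpoly iota P).@[x 0] != 0.

Definition irreducible_mpoly (R : fieldType) (n : nat) (F : {mpoly R[n]}) : Prop :=
  F \isn't a GRing.unit /\
  forall G H : {mpoly R[n]}, F = G * H ->
    G \is a GRing.unit \/ H \is a GRing.unit.

Definition ordinary_double_point (L : fieldType) (F : {mpoly L[2]}) : Prop :=
  [/\ F != 0,
      pihomog mdeg 0 F = 0 /\ pihomog mdeg 1 F = 0,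
      pihomog mdeg 2 F != 0
    & exists a b c d : L,
        pihomog mdeg 2 F = (a *: 'X_0 + b *: 'X_1) * (c *: 'X_0 + d *: 'X_1)
        /\ ~ peq (row3 a b 0) (row3 c d 0)].

(* The homogenising variable is the last one. *)
Definition homogenise (R : fieldType) (n : nat) (F : {mpoly R[n]}) :
    {mpoly R[n.+1]} :=
  \sum_(m <- msupp F) F@_m *:
    ((\prod_(i < n) 'X_(widen_ord (leqnSn n) i) ^+ m i)
     * 'X_ord_max ^+ ((msize F).-1 - mdeg m)).

Definition proj_closure (R : fieldType) (n : nat) (F : {mpoly R[n]})
    (p : 'rV[R]_n.+1) : Prop :=
  p != 0 /\ (homogenise F).@[p 0] = 0.

Definition grad (R : fieldType) (n : nat) (F : {mpoly R[n]}) (q : 'rV[R]_n) :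
    'rV[R]_n := \row_i (F^`M(i)).@[q 0].

(* Coefficients of the line F_X(q)(X - q_X) + F_Y(q)(Y - q_Y) = 0. *)
Definition tangent_at (R : fieldType) (F : {mpoly R[2]}) (q : 'rV[R]_2) :
    'rV[R]_3 :=
  row_mx (grad F q) (- (grad F q *m q^T)).

Definition transverse_at (R : fieldType) (F G : {mpoly R[2]}) (q : 'rV[R]_2) :
    Prop :=
  [/\ F.@[q 0] = 0 /\ G.@[q 0] = 0,
      grad F q != 0, grad G q != 0
    & ~ peq (tangent_at F q) (tangent_at G q)].

Definition translate (R : fieldType) (F : {mpoly R[2]}) (x y : R) :
    {mpoly R[2]} :=
  F \mPo [tuple 'X_0 - x%:MP; 'X_1 - y%:MP].

(* Data for a closed subset Z of P^amb, cut out by [eqns], and a morphism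
   from Z to P^2 given by finitely many triples of forms. *)
Record model (R : fieldType) := Model {
  amb : nat;
  eqns : seq {mpoly R[amb.+1]};
  npatch : nat;
  patch : 'I_npatch -> 'I_3 -> {mpoly R[amb.+1]}
}.

Definition base_change (L K : fieldType) (iota : {rmorphism L -> K})
    (M : model L) : model K :=
  {| amb := amb M;
     eqns := [seq map_mpoly iota g | g <- eqns M];
     npatch := npatch M;
     patch := fun i j => map_mpoly iota (patch (m := M) i j) |}.

Definition mpoint (R : fieldType) (M : model R) (x : 'rV[R]_(amb M).+1) : Prop :=
  x != 0 /\ forall g, g \in eqns M -> g.@[x 0] = 0.

(* Phi(x) = p, read off on any triple of forms that is defined at x. *)
Definition mmap_to (R : fieldType) (M : model R) (x : 'rV[R]_(amb M).+1)
    (p : 'rV[R]_3) : Prop :=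
  exists i : 'I_(npatch M),
    eval_row (patch (m := M) i) x != 0 /\ peq (eval_row (patch (m := M) i) x) p.

Definition mvanish (R : fieldType) (M : model R) (P : {mpoly R[(amb M).+1]}) :
    Prop :=
  forall x, mpoint x -> P.@[x 0] = 0.

(* Jacobian criterion: N - 1 elements of the ideal of the curve Z in P^N have
   independent gradients at x (the rank cannot be larger, as dim Z = 1). *)
Definition mnonsingular_at (R : fieldType) (M : model R)
    (x : 'rV[R]_(amb M).+1) : Prop :=
  exists f : 'I_(amb M).-1 -> {mpoly R[(amb M).+1]},
    (forall i, mvanish (f i)) /\
    \rank (\matrix_i grad (f i) x) = (amb M).-1.

(* Over an algebraically closed L: Z is a nonsingular irreducible projective
   variety and Phi is a birational morphism from Z to the projective closure
   of the curve F = 0, with rational inverse psi. In particular dim Z = 1, and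
   (Z, Phi) is the normalisation of the closure, unique up to isomorphism. *)
Record nonsingular_model (L : fieldType) (F : {mpoly L[2]}) (M : model L) :
    Prop := NonsingularModel {
  nm_eqns : forall g, g \in eqns M -> exists d : nat, g \is d.-homog;
  nm_nonempty : exists x, mpoint (M := M) x;
  nm_irreducible : forall P Q : {mpoly L[(amb M).+1]},
    mvanish (P * Q) -> mvanish P \/ mvanish Q;
  nm_nonsingular : forall x, mpoint (M := M) x -> mnonsingular_at x;
  nm_forms : forall i, exists d : nat, form_family (patch (m := M) i) d;
  nm_defined : forall x, mpoint (M := M) x -> exists p, mmap_to x p;
  nm_welldef : forall x p p', mpoint (M := M) x ->
    mmap_to x p -> mmap_to x p' -> peq p p';
  nm_image : forall x p, mpoint (M := M) x -> mmap_to x p -> proj_closure F p;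
  nm_birational : exists psi : 'I_(amb M).+1 -> {mpoly L[3]},
    [/\ exists d : nat, form_family psi d,
        exists2 p, proj_closure F p & eval_row psi p != 0,
        forall p, proj_closure F p -> eval_row psi p != 0 ->
          mpoint (eval_row psi p) /\ mmap_to (eval_row psi p) p
      & forall x p, mpoint (M := M) x -> mmap_to x p -> eval_row psi p != 0 ->
          peq (eval_row psi p) x]
}.

(* The branches centred at p are the points z of Phi^-1(p), up to [peq]. *)
Definition branch_at (L : fieldType) (M : model L) (p : 'rV[L]_3)
    (z : 'rV[L]_(amb M).+1) : Prop :=
  mpoint z /\ mmap_to z p.

Definition lies_on_branch (L K : fieldType) (iota : {rmorphism L -> K})
    (O : {pred K}) (M : model L) (z : 'rV[L]_(amb M).+1) (q : 'rV[K]_3) : Prop :=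
  exists x : 'rV[K]_(amb M).+1,
    [/\ mpoint (M := base_change iota M) x,
        specialises iota O x z
      & mmap_to (M := base_change iota M) x q].

Definition member (R : fieldType) (s : nat) (B : 'I_s.+1 -> {mpoly R[3]})
    (v : 'rV[R]_s.+1) : {mpoly R[3]} := \sum_i v 0 i *: B i.

(* [fs_indep] makes the parameter space a P^s. *)
Record finite_system (L : fieldType) (F : {mpoly L[2]}) (e s : nat)
    (B : 'I_s.+1 -> {mpoly L[3]}) : Prop := FiniteSystem {
  fs_degree : form_family B e;
  fs_indep : forall v, v != 0 -> member B v != 0;
  fs_finite : forall v, v != 0 -> exists k,
    proj_card (fun p => proj_closure F p /\ (member B v).@[p 0] = 0) k
}.

Definition maximal_system (L : fieldType) (F : {mpoly L[2]}) (e s : nat)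
    (B : 'I_s.+1 -> {mpoly L[3]}) : Prop :=
  finite_system F e B /\
  forall (s' : nat) (B' : 'I_s'.+1 -> {mpoly L[3]}), finite_system F e B' ->
    (forall v, exists v', member B' v' = member B v) ->
    (forall v', exists v, member B v = member B' v').

(* I_gamma(C, H) = k, for the branch gamma of C given by z and the plane curve
   H of degree e. The value does not depend on the system B containing H nor on
   the generic parameter v' infinitely near to the parameter v0 of H. *)
Definition branch_mult (L K : fieldType) (iota : {rmorphism L -> K})
    (O : {pred K}) (F : {mpoly L[2]}) (M : model L) (z : 'rV[L]_(amb M).+1)
    (e : nat) (H : {mpoly L[3]}) (k : nat) : Prop :=
  exists (s : nat) (B : 'I_s.+1 -> {mpoly L[3]}) (v0 : 'rV[L]_s.+1),
    let near_generic v' := specialises iota O v' v0 /\ generic_pt iota v' in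
    let H' v' := member (fun i => map_mpoly iota (B i)) v' in
    [/\ maximal_system F e B,
        v0 != 0 /\ H = member B v0,
        exists v' : 'rV[K]_s.+1, near_generic v'
      & forall v' : 'rV[K]_s.+1, near_generic v' ->
          proj_card (fun x : 'rV[K]_(amb M).+1 =>
            [/\ mpoint (M := base_change iota M) x,
                specialises iota O x z
              & exists2 p, mmap_to (M := base_change iota M) x p
                         & (H' v').@[p 0] = 0]) k].

Definition line_form (R : fieldType) (l : 'rV[R]_3) : {mpoly R[3]} :=
  \sum_i l 0 i *: 'X_i.

Definition touches (L K : fieldType) (iota : {rmorphism L -> K})
    (O : {pred K}) (F : {mpoly L[2]}) (M : model L) (p : 'rV[L]_3)
    (z : 'rV[L]_(amb M).+1) (l : 'rV[L]_3) : Prop :=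
  [/\ l != 0, (line_form l).@[p 0] = 0
    & exists2 k, (2 <= k)%N & branch_mult iota O F z 1 (line_form l) k].

Definition branch_tangent (L K : fieldType) (iota : {rmorphism L -> K})
    (O : {pred K}) (F : {mpoly L[2]}) (M : model L) (p : 'rV[L]_3)
    (z : 'rV[L]_(amb M).+1) (l : 'rV[L]_3) : Prop :=
  touches iota O F p z l /\
  forall l', touches iota O F p z l' -> peq l l'.

(* Main.v *)
Require Import Defs.
From HB Require Import structures.
From mathcomp Require Import all_boot all_order all_algebra.
From mathcomp Require Import mpoly.
From mathcomp Require Import ring.
From Stdlib Require Import Classical.
Set Implicit Arguments.
Unset Strict Implicit.
Unset Printing Implicit Defensive.
Import GRing.Theory.
Local Open Scope ring_scope.

(* Write F(x e1 + y e2) = xy + (terms of degree at least 3) in a basis e1, e2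
   of directions of the two tangents.  As K is algebraically closed, one-variable
   polynomials over O satisfy Hensel's lemma, so the points of C infinitely near
   the origin form two branches y = x s(x) and x = y r(y) with s, r infinitesimal,
   and chords of a branch have infinitesimal slope (relative to its tangent).
   Since neither coordinate of w = (u, v) in the basis e1, e2 vanishes, q and
   q - t w cannot lie on the same branch, and there is at most one q on either
   branch with q - t w on the other.

   Existence: in the coordinate x = t (u + xi) the condition that q - t w lies
   on C reads f(xi) = 0 for an isometry f of the maximal ideal.  Newton steps
   make f arbitrarily small, but O is not complete; instead, eliminating y
   shows that f(xi) divides P(xi) for a nonzero polynomial P, and if f had no
   zero its values at the roots of P would bound the valuation of f.

   The rational inverse of the normalisation, restricted to the power series
   x -> (x, x s(x)), has a limit, so each branch lies over one point of the
   model.  A generic line near a tangent line of the branch at z meets the curve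
   in two points different from the origin which lift near z; this identifies
   z with one of the two limits and the line with the corresponding tangent.
   Facts about L-points of the model are transferred to K-points by a
   specialisation form of the Nullstellensatz. *)

(** * Specialisation of K-points *)


(** The model is described through its [L]-points, while branches and multiplicities live over [K];
    hence a specialisation is needed that keeps every polynomial relation of a [K]-point together
    with one chosen inequality. No power series is evaluated in [K]: a branch is the solution set of
    a fixed-point equation, solved at each infinitesimal separately, and its series occurs only
    through polynomial truncations over [L]. The valuation enters as divisibility in [O]. The
    equation of the node is one identity valid in every commutative [L]-algebra: in [K] it describes
    points, in [K[X]] it yields derivatives. The elimination has an obstacle: at t = 0 the
    polynomial F(q - t w) is F itself, so a fibre not divisible by F appears only after subtracting
    F(q) and dividing by t. That the two limits on the model differ is not read off the node. Each
    of the two given points of the model has a touching line, so each is one of the limits; as they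
    are distinct, so are the limits. *)

Lemma ex_minimal (T : Type) (m : T -> nat) (P : T -> Prop) :
  (exists x, P x) -> exists2 x, P x & forall y, P y -> (m x <= m y)%N.
Proof.
case=> x Px; have [n] := ubnP (m x); elim: n x Px => // n IH x Px ltn.
case: (classic (exists2 y, P y & (m y < m x)%N)) => [[y Py lt_yx]|nex].
  exact: (IH y Py (leq_trans lt_yx ltn)).
exists x => // y Py; rewrite leqNgt; apply/negP => lt_yx.
by apply: nex; exists y.
Qed.

Section Specialisation.
Variables (L : closedFieldType) (K : fieldType) (iota : {rmorphism L -> K}).

(** [A] with [f] presents the subalgebra [f(A)] of [K]; using the kernel of [f] instead of a
    quotient keeps the induction on generators inside polynomial rings. The inequality on [w]
    belongs to the induction: the next generator needs leading coefficients that survive. *)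
Definition specialisable (A : comNzRingType) (j : {rmorphism L -> A})
    (f : {rmorphism A -> K}) : Prop :=
  forall w, f w != 0 -> exists h : {rmorphism A -> L},
    [/\ forall c, h (j c) = c, h w != 0 & forall g, f g = 0 -> h g = 0].

(** If [xi] satisfies a nontrivial relation over [f(A)], it is sent to a root of a specialised
    relation of least degree; otherwise the kernel consists of the polynomials with coefficients in
    the kernel of [f], and any value off finitely many roots will do. *)
Lemma specialisable_poly (A : comNzRingType) (j : {rmorphism L -> A})
    (f : {rmorphism A -> K}) (xi : K) :
  specialisable j f ->
  specialisable (polyC \o j : {rmorphism L -> {poly A}})
    (horner_eval xi \o map_poly f : {rmorphism {poly A} -> K}).
Proof.
move=> SA.
pose f' := horner_eval xi \o map_poly f : {rmorphism {poly A} -> K}.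
pose ext (h : {rmorphism A -> L}) al :=
  horner_eval al \o map_poly h : {rmorphism {poly A} -> L}.
rewrite -/f' => w fw.
have f'C c : f' c%:P = f c by rewrite /f' /= /horner_eval map_polyC hornerC.
have hC h al c : ext h al c%:P = h c.
  by rewrite /ext /= /horner_eval map_polyC hornerC.
have kill (h : {rmorphism A -> L}) g : (forall a, f a = 0 -> h a = 0) ->
    map_poly f g = 0 -> map_poly h g = 0.
  move=> hf fg0; apply/polyP=> i; rewrite coef_map coef0; apply: hf.
  by rewrite -coef_map fg0 coef0.
case: (classic (exists p, f' p = 0 /\ map_poly f p <> 0)) => [exp|nexp].
- have [p1 [p1_0 p1_n0] p1_min] := ex_minimal (fun p => size (map_poly f p)) exp.
  (* [f] may kill the top coefficients of [p1]; after truncation the leading coefficient of [p]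
     survives under [f]. *)
  pose mu := size (map_poly f p1); pose p := take_poly mu p1.
  have fp : map_poly f p = map_poly f p1.
    apply/polyP=> i; rewrite !coef_map coef_take_poly; case: ltnP => // le_mu.
    by move: le_mu => le_mu; rewrite raddf0 -coef_map nth_default.
  have p0 : f' p = 0 by rewrite -[RHS]p1_0 /f' /= fp.
  have p_min g : f' g = 0 -> (size (map_poly f g) < mu)%N -> map_poly f g = 0.
    move=> g0 ltg; apply: NNPP => gn0; have := p1_min g (conj g0 gn0).
    by rewrite leqNgt ltg.
  have mu_gt0 : (0 < mu)%N by rewrite size_poly_gt0; apply/eqP.
  have flp : f p`_mu.-1 != 0.
    by rewrite -coef_map fp -lead_coefE lead_coef_eq0; apply/eqP.
  have sp : size p = mu.
    apply/eqP; rewrite eqn_leq size_take_poly /= -(prednK mu_gt0).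
    rewrite ltnNge; apply/negP => le_s; move/negP: flp; apply.
    by rewrite nth_default ?raddf0.
  have lp : lead_coef p = p`_mu.-1 by rewrite lead_coefE sp.
  have p_n0 : p != 0 by rewrite -size_poly_gt0 sp.
  have small (g : {poly A}) : (size g < mu)%N -> f' g = 0 -> map_poly f g = 0.
    move=> ltg g0; apply: p_min => //.
    by apply: leq_ltn_trans ltg; apply: size_poly.
  have divE (a b : {poly A}) : exists k d r,
      a * (lead_coef b ^+ k)%:P = d * b + r /\
      (b != 0 -> (size r < size b)%N).
    exists (Pdiv.Ring.rscalp a b), (Pdiv.Ring.rdivp a b), (Pdiv.Ring.rmodp a b).
    split; last by move=> b_n0; rewrite Pdiv.Ring.ltn_rmodp.
    by rewrite mulrC mul_polyC Pdiv.ComRing.rdivp_eq.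
  (* [J] holds for elements outside the kernel that vanish wherever [w] and the kernel do. A
     constant in [J] acts as a norm of [w]: keeping it nonzero keeps [w] nonzero. *)
  pose J q := f' q <> 0 /\ forall h' : {rmorphism {poly A} -> L},
     (forall g, f' g = 0 -> h' g = 0) -> h' w = 0 -> h' q = 0.
  have [|q [fq hq] q_min] := ex_minimal (fun q : {poly A} => size q) (P := J).
    by exists w; split => //; apply/eqP.
  have Jmin r : f' r <> 0 -> (forall h' : {rmorphism {poly A} -> L},
     (forall g, f' g = 0 -> h' g = 0) -> h' w = 0 -> h' r = 0) ->
     (size r < size q)%N -> False.
    by move=> fr hr; rewrite ltnNge q_min.
  have q_n0 : q != 0 by apply: contra_not_neq fq => ->; rewrite raddf0.
  have flq : f (lead_coef q) != 0.
    apply/eqP => flq0; pose m := lead_coef q *: 'X^((size q).-1).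
    have fm : f' m = 0.
      by rewrite /m -mul_polyC rmorphM f'C flq0 mul0r.
    apply: (Jmin (q - m)).
    - by rewrite rmorphB fm subr0.
    - by move=> h' h'f h'w; rewrite rmorphB (hq h') // (h'f _ fm) subr0.
    - have sq : (0 < size q)%N by rewrite size_poly_gt0.
      rewrite -[X in (_ < X)%N](prednK sq) ltnS; apply/leq_sizeP => i le_i.
      rewrite coefB coefZ coefXn; case: eqP => [->|/eqP ne_i].
        by rewrite mulr1 subrr.
      rewrite mulr0 subr0 nth_default // -(prednK sq) ltn_neqAle eq_sym ne_i.
      by [].
  have sq_lt : (size q < mu)%N.
    rewrite -sp ltnNge; apply/negP => le_pq.
    have [k [d [r [E ltr]]]] := divE q p.
    have rE : r = q * (lead_coef p ^+ k)%:P - d * p by rewrite E addrC addKr.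
    apply: (Jmin r).
    - rewrite rE rmorphB !rmorphM p0 mulr0 subr0 f'C rmorphXn.
      by apply/eqP; rewrite mulf_neq0 ?expf_neq0 // ?lp //; apply/eqP.
    - move=> h' h'f h'w; rewrite rE rmorphB !rmorphM (hq h') // (h'f _ p0).
      by rewrite mul0r mulr0 subr0.
    - by apply: leq_trans le_pq; rewrite ltr.
  (* Pseudo-division of [p] by a nonconstant [q] leaves a smaller member of [J], unless the
     remainder is in the kernel; in that case the cofactor [d] is a nontrivial relation of smaller
     degree than [p]. *)
  have sq1 : (size q <= 1)%N.
    rewrite leqNgt; apply/negP => sq_gt1.
    have [k [d [r [E ltr]]]] := divE p q.
    have rE : r = p * (lead_coef q ^+ k)%:P - d * q by rewrite E addrC addKr.
    have sr : (size r < size q)%N by rewrite ltr.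
    have f'r : f' r = - (f' d * f' q).
      by rewrite rE rmorphB !rmorphM p0 mul0r sub0r.
    case: (classic (f' r = 0)) => [fr0|frn0]; last first.
      apply: (Jmin r) => // h' h'f h'w.
      by rewrite rE rmorphB !rmorphM (h'f _ p0) (hq h') // mul0r mulr0 subr0.
    have mr : map_poly f r = 0 by apply: small => //; apply: ltn_trans sr _.
    have fd : f' d = 0.
      apply/eqP; move/eqP: fr0; rewrite f'r oppr_eq0 mulf_eq0.
      by case/orP=> // /eqP /fq.
    have mE : map_poly f p * (f (lead_coef q) ^+ k)%:P
              = map_poly f d * map_poly f q.
      have := congr1 (map_poly f) E.
      by rewrite rmorphD !rmorphM /= mr addr0 map_polyC /= rmorphXn.
    have mp_n0 : map_poly f p * (f (lead_coef q) ^+ k)%:P != 0.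
      by rewrite mulf_neq0 ?polyC_eq0 ?expf_neq0 // fp; apply/eqP.
    have smq : size (map_poly f q) = size q by rewrite size_map_poly_id0.
    have md_n0 : map_poly f d != 0.
      by move: mp_n0; rewrite mE mulf_eq0 negb_or => /andP[].
    case/eqP: md_n0; apply: p_min => //.
    have md0 : map_poly f d != 0.
      by move: mp_n0; rewrite mE mulf_eq0 negb_or => /andP[].
    have mq0 : map_poly f q != 0 by rewrite -size_poly_gt0 smq size_poly_gt0.
    have : size (map_poly f d * map_poly f q) = mu.
      by rewrite -mE mulrC size_Cmul ?fp // expf_neq0.
    rewrite size_mul // smq => <-.
    by case: (size q) sq_gt1 => [|[|n]] // _; rewrite !addnS /= ltnS leq_addr.
  have [c qE] : exists c, q = c%:P by exists q`_0; apply: size1_polyC.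
  have fc : f c != 0 by rewrite -f'C -qE; apply/eqP.
  have [|h [hj hcl hf]] := SA (c * lead_coef p).
    by rewrite rmorphM mulf_neq0 // lp.
  move: hcl; rewrite rmorphM mulf_eq0 negb_or => /andP[hc hl].
  have smp : size (map_poly h p) = size p by rewrite size_map_poly_id0.
  have sp1 : size p != 1%N.
    apply/negP => sp1; move: flp; rewrite -lp.
    have [e pE] : exists e, p = e%:P.
      by exists p`_0; apply: size1_polyC; rewrite (eqP sp1).
    by rewrite pE lead_coefC -f'C -pE p0 eqxx.
  have [al /rootP al0] : exists al, root (map_poly h p) al.
    by apply/closed_rootP; rewrite smp.
  have h'p : ext h al p = 0 by [].
  have h'f g : f' g = 0 -> ext h al g = 0.
    move=> g0; have [k [d [r [E ltr]]]] := divE g p.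
    have rE : r = g * (lead_coef p ^+ k)%:P - d * p by rewrite E addrC addKr.
    have mr : map_poly f r = 0.
      apply: small; first by rewrite -sp ltr.
      by rewrite rE rmorphB !rmorphM g0 p0 mul0r mulr0 subr0.
    have hr0 : ext h al r = 0.
      by rewrite /ext /= (kill h r) // /horner_eval horner0.
    have := congr1 (ext h al) E; rewrite rmorphD !rmorphM h'p mulr0 add0r hr0.
    rewrite hC rmorphXn => /eqP; rewrite mulf_eq0 expf_eq0 (negbTE hl) andbF orbF.
    by move/eqP.
  exists (ext h al); split => [e| |//]; first exact: etrans (hC _ _ _) (hj _).
  apply/eqP => h'w; have := hq _ h'f h'w.
  by rewrite qE hC => /eqP; rewrite (negbTE hc).
- have mf g : f' g = 0 -> map_poly f g = 0.
    by move=> g0; apply: NNPP => gn0; apply: nexp; exists g.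
  have mw : map_poly f w != 0.
    by apply: contra_neq fw => mw; rewrite /f' /= mw /horner_eval horner0.
  have [|h [hj hc hf]] := SA (lead_coef (take_poly (size (map_poly f w)) w)).
    set mu := size _.
    have e : map_poly f (take_poly mu w) = map_poly f w.
      apply/polyP=> i; rewrite !coef_map coef_take_poly; case: ltnP => // le_mu.
      by rewrite raddf0 -coef_map nth_default.
    have le : (size (take_poly mu w) <= mu)%N by rewrite size_take_poly.
    have ge : (mu <= size (take_poly mu w))%N by rewrite {1}/mu -e size_poly.
    have se : size (take_poly mu w) = mu by apply/eqP; rewrite eqn_leq le.
    by rewrite lead_coefE se -coef_map e -lead_coefE lead_coef_eq0.
  have hw : map_poly h w != 0.
    apply: contra_neq hc => hw0; rewrite lead_coefE coef_take_poly.
    by case: ifP; rewrite ?raddf0 // -coef_map hw0 coef0.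
  have [al nr] : exists al, ~~ root (map_poly h w) al.
    by apply/closed_nonrootP.
  exists (ext h al); split => [e||g g0]; first exact: etrans (hC _ _ _) (hj _).
    by [].
  by rewrite /ext /= (kill h g) ?mf // /horner_eval horner0.
Qed.

Lemma mmap_comp (n : nat) (R S S' : comNzRingType) (f : {rmorphism R -> S})
    (g : {rmorphism S -> S'}) (v : 'I_n -> S) (P : {mpoly R[n]}) :
  g (mmap f v P) = mmap (g \o f) (g \o v) P.
Proof.
rewrite /mmap rmorph_sum; apply: eq_bigr => m _; rewrite rmorphM; congr (_ * _).
by rewrite /mmap1 rmorph_prod; apply: eq_bigr => i _; rewrite rmorphXn.
Qed.

Lemma mmap_eq (n : nat) (R S : comNzRingType) (f g : R -> S)
    (v w : 'I_n -> S) (P : {mpoly R[n]}) :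
  f =1 g -> v =1 w -> mmap f v P = mmap g w P.
Proof.
by move=> fg vw; rewrite /mmap; apply: eq_bigr => m _; rewrite fg (mmap1_eq _ vw).
Qed.

Lemma specialisation_nat (n : nat) (x : nat -> K) :
  exists (A : comNzRingType) (j : {rmorphism L -> A}) (f : {rmorphism A -> K})
    (X : nat -> A),
    [/\ f \o j =1 iota, forall i, (i < n)%N -> f (X i) = x i
      & specialisable j f].
Proof.
elim: n => [|n [A [j [f [X [fj fX SA]]]]]].
  exists L, idfun, iota, (fun _ => 0); split=> // w w0.
  exists idfun; split=> // [|g /eqP].
    by apply: contra_neq w0 => /= ->; rewrite raddf0.
  by rewrite fmorph_eq0 => /eqP.
have := @specialisable_poly A j f (x n) SA.
set j' := (_ \o _ : {rmorphism _ -> _}) => SA'; exists {poly A}, j'.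
eexists; exists (fun i => if (i < n)%N then (X i)%:P else 'X).
split; last exact: SA'.
  by move=> c; rewrite /= /horner_eval map_polyC hornerC -fj.
move=> i; rewrite ltnS leq_eqVlt => /predU1P[->|lt_in].
  by rewrite ltnn /= /horner_eval map_polyX hornerX.
rewrite lt_in /= /horner_eval map_polyC hornerC. exact: fX.
Qed.

(* This is how facts about the L-points of C and of its model pass to K-points. *)
Lemma specialise_point (n : nat) (x : 'I_n -> K) (w : {mpoly L[n]}) :
  mmap iota x w != 0 ->
  exists a : 'I_n -> L, w.@[a] != 0 /\
    forall g : {mpoly L[n]}, mmap iota x g = 0 -> g.@[a] = 0.
Proof.
pose x' k := if insub k is Some i then x i else 0.
have [A [j [f [X [fj fX SA]]]]] := specialisation_nat n x'.
have fE (g : {mpoly L[n]}) : f (mmap j (X \o val) g) = mmap iota x g.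
  rewrite mmap_comp; apply: mmap_eq => // i /=.
  by rewrite fX ?ltn_ord // /x' valK.
rewrite -fE => /SA[h [hj hw hf]]; exists (h \o X \o val).
have hE (g : {mpoly L[n]}) : h (mmap j (X \o val) g) = g.@[h \o X \o val].
  by rewrite mmap_comp; apply: mmap_eq.
split=> [|g]; first by rewrite -hE.
by rewrite -fE -hE; apply: hf.
Qed.
End Specialisation.


(** * Elimination on an irreducible curve *)

(** The linear factor is in the inner variable: a fibre vanishes when every coefficient is divisible
    by ['X - a%:P]. Over a domain this makes such a factor prime, which is the base of Gauss's lemma
    below. *)
Lemma map_horner0_factor (R : comNzRingType) (a : R) (p : {poly {poly R}}) :
  map_poly (horner_eval a) p = 0 -> exists q, p = ('X - a%:P)%:P * q.
Proof.
elim/poly_ind: p => [|p c IH]; first by exists 0; rewrite mulr0.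
rewrite rmorphD rmorphM /= map_polyX map_polyC /= => e.
have c0 : c.[a] = 0.
  by move/(congr1 (fun q : {poly R} => q`_0)): e; rewrite coefD coefMX coefC coef0 add0r.
have p0 : map_poly (horner_eval a) p = 0.
  move: e; rewrite /horner_eval c0 polyC0 addr0 => /polyP e.
  by apply/polyP=> i; have := e i.+1; rewrite coefMX !coef0.
have [q ->] := IH p0; have /factor_theorem[d ->] : root c a by apply/rootP.
exists (q * 'X + d%:P).
rewrite [RHS]mulrDr mulrA; congr (_ + _).
by rewrite -polyCM mulrC.
Qed.

Section Bivariate.
Variable L : closedFieldType.
Implicit Types (c d r : {poly L}) (F G H : {poly {poly L}}).

Lemma polyXsub_neq0 (R : nzRingType) (a : R) : ('X - a%:P)%:P != 0 :> {poly {poly R}}.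
Proof. by rewrite polyC_eq0 polyXsubC_eq0. Qed.

(** Gauss's lemma without contents: [c] splits into linear factors over [L], and each of them, being
    prime, cancels from [G] or from [H]. *)
Lemma gauss_split c F G H : c != 0 -> c%:P * F = G * H ->
  exists c1 c2 G' H', [/\ c1 != 0, c2 != 0, G = c1%:P * G', H = c2%:P * H'
                        & F = G' * H'].
Proof.
have [n] := ubnP (size c); elim: n c G H => // n IH c G H ltn c0 E.
have [s1|s1] := eqVneq (size c) 1%N.
  have [e cE] : exists e, c = e%:P by exists c`_0; apply: size1_polyC; rewrite s1.
  have e0 : e != 0 by move: c0; rewrite cE polyC_eq0.
  exists c, 1, (e^-1%:P%:P * G), H; rewrite c0 oner_eq0 !mul1r; split=> //.
    by rewrite cE mulrA -!polyCM mulfV // !polyC1 mul1r.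
  by rewrite -mulrA -E cE mulrA -!polyCM mulVf // !polyC1 mul1r.
have [a /factor_theorem[d cE]] : exists a, root c a by apply/closed_rootP.
have d0 : d != 0 by apply: contra_neq c0 => d0; rewrite cE d0 mul0r.
have sd : (size d < n)%N.
  by move: ltn; rewrite cE size_Mmonic ?monicXsubC // size_XsubC addn2 ltnS.
have : map_poly (horner_eval a) G * map_poly (horner_eval a) H = 0.
  rewrite -rmorphM -E rmorphM /= map_polyC /= /horner_eval cE.
  by rewrite hornerM hornerXsubC subrr mulr0 polyC0 mul0r.
move/eqP; rewrite mulf_eq0 => /orP[/eqP|/eqP] /map_horner0_factor[q qE].
- have [//|//||c1 [c2 [G' [H' [c10 c20 eq1 eq2 eq3]]]]] := IH d q H.
    apply: (mulfI (polyXsub_neq0 a)); rewrite mulrA -polyCM [X in X%:P]mulrC -cE.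
    by rewrite E qE mulrA.
  exists (('X - a%:P) * c1), c2, G', H'; split=> //.
    by rewrite mulf_neq0 ?polyXsubC_eq0.
  by rewrite qE eq1 polyCM mulrA.
- have [//|//||c1 [c2 [G' [H' [c10 c20 eq1 eq2 eq3]]]]] := IH d G q.
    apply: (mulfI (polyXsub_neq0 a)); rewrite mulrA -polyCM [X in X%:P]mulrC -cE.
    by rewrite E qE mulrCA.
  exists c1, (('X - a%:P) * c2), G', H'; split=> //.
    by rewrite mulf_neq0 ?polyXsubC_eq0.
  by rewrite qE eq2 polyCM mulrA.
Qed.

Definition irreducible_poly2 F : Prop :=
  F \isn't a GRing.unit /\
  forall G H, F = G * H -> G \is a GRing.unit \/ H \is a GRing.unit.

Lemma unit_poly2 F : F \is a GRing.unit -> exists2 e : L, e != 0 & F = e%:P%:P.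
Proof.
rewrite poly_unitE => /andP[/eqP s1].
rewrite poly_unitE => /andP[/eqP s2 u]; exists (F`_0)`_0.
  by move: u; rewrite unitfE.
by rewrite -size1_polyC ?s2 // -size1_polyC ?s1.
Qed.

Section Irreducible.
Variables (F : {poly {poly L}}) (Firr : irreducible_poly2 F).
Hypothesis F_gt1 : (1 < size F)%N.

Lemma irr_fibre_neq0 a : map_poly (horner_eval a) F != 0.
Proof.
apply/eqP => /map_horner0_factor[q qE]; case: (Firr.2 _ _ qE) => /unit_poly2[e e0 eE].
  have := congr1 (fun p : {poly {poly L}} => size p`_0) eE.
  by rewrite !coefC /= size_XsubC size_polyC e0.
by move: F_gt1; rewrite qE eE -polyCM ltnNge size_polyC leq_b1.
Qed.

(** No fibre of [F] vanishes identically, so every linear factor of [c] has to divide [H]. *)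
Lemma irr_strip c G H : c != 0 -> c%:P * G = F * H -> exists H', G = F * H'.
Proof.
have [n] := ubnP (size c); elim: n c H => // n IH c H ltn c0 E.
have [s1|s1] := eqVneq (size c) 1%N.
  have [e cE] : exists e, c = e%:P by exists c`_0; apply: size1_polyC; rewrite s1.
  have e0 : e != 0 by move: c0; rewrite cE polyC_eq0.
  exists (e^-1%:P%:P * H).
  by rewrite mulrCA -E cE mulrA -!polyCM mulVf // !polyC1 mul1r.
have [a /factor_theorem[d cE]] : exists a, root c a by apply/closed_rootP.
have d0 : d != 0 by apply: contra_neq c0 => d0; rewrite cE d0 mul0r.
have sd : (size d < n)%N.
  by move: ltn; rewrite cE size_Mmonic ?monicXsubC // size_XsubC addn2 ltnS.
have : map_poly (horner_eval a) F * map_poly (horner_eval a) H = 0.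
  rewrite -rmorphM -E rmorphM /= map_polyC /= /horner_eval cE.
  by rewrite hornerM hornerXsubC subrr mulr0 polyC0 mul0r.
move/eqP; rewrite mulf_eq0 (negbTE (irr_fibre_neq0 a)) /= => /eqP.
case/map_horner0_factor => q qE; apply: (IH d q) => //.
apply: (mulfI (polyXsub_neq0 a)); rewrite mulrA -polyCM [X in X%:P]mulrC -cE.
by rewrite E qE mulrCA.
Qed.

(** [r] is the resultant in the outer variable. Were it zero, the gcd would have positive degree; by
    Gauss's lemma and irreducibility it would be [F] up to a factor from [{poly L}], and [F] would
    divide [G]. *)
Lemma irr_eliminate G : (forall H, G <> F * H) ->
  exists r u v, r != 0 /\ r%:P = u * F + v * G.
Proof.
move=> ndvd; have G0 : G != 0 by apply/eqP => G0; apply: (ndvd 0); rewrite mulr0.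
have [G1|G_gt1] := leqP (size G) 1%N.
  have [d GE] : exists d, G = d%:P by exists G`_0; apply: size1_polyC.
  exists d, 0, 1; rewrite mul0r add0r mul1r; split=> //.
  by move: G0; rewrite GE polyC_eq0.
have [[u v] _ E] := resultant_in_ideal F_gt1 G_gt1.
exists (resultant F G), u, v; split=> //; rewrite resultant_eq0; apply/negP => g1.
have /Pdiv.Idomain.dvdpP[[c q] /= c0 cE] := dvdp_gcdl F G.
have /Pdiv.Idomain.dvdpP[[d q2] /= d0 dE] := dvdp_gcdr F G.
rewrite -!mul_polyC in cE dE.
have [c1 [c2 [q' [g' [c10 c20 qE gE FE]]]]] := gauss_split c0 cE.
case: (Firr.2 _ _ FE) => /unit_poly2[e e0 eE]; last first.
  by move: g1; rewrite gE eE -polyCM ltnNge size_polyC leq_b1.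
have gF : g' = F * e^-1%:P%:P.
  by rewrite FE eE mulrC mulrA -!polyCM mulVf // !polyC1 mul1r.
have [H GE] : exists H, G = F * H.
  apply: (irr_strip (H := q2 * (c2%:P * e^-1%:P%:P)) d0).
  by rewrite dE gE gF; ring.
exact: ndvd GE.
Qed.

(** Multiplication by the eliminant [r] turns the relation into divisibility of [r%:P * B] by [F],
    hence of [B] by [F], against the degrees. *)
Lemma irr_prime (A B G : {poly {poly L}}) : (forall H, G <> F * H) ->
  (size B < size F)%N -> A * F = B * G -> B = 0.
Proof.
move=> ndvd ltB E; have [r [u [v [r0 rE]]]] := irr_eliminate ndvd.
have [|H BE] := irr_strip (G := B) (H := u * B + v * A) r0.
  transitivity (u * F * B + v * (B * G)); first by rewrite rE; ring.
  by rewrite -E; ring.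
have [//|B0] := eqVneq B 0; move: ltB; rewrite BE.
have /andP[F0 H0] : (F != 0) && (H != 0).
  by move: B0; rewrite BE mulf_eq0 negb_or.
rewrite size_mul // ltnNge; case: (size H) (size_poly_gt0 H) => [|n _].
  by rewrite H0.
by rewrite addnS leq_addr.
Qed.

(* The coefficient ring {poly {poly L}} has its outer variable as a deformation
   parameter; [G] deforms its fibre at 0. *)
Lemma irr_eliminate_deform (G : {poly {poly {poly L}}}) :
  (forall H, map_poly (horner_eval 0) G <> F * H) ->
  exists (r : {poly {poly L}}) u v,
    r != 0 /\ r%:P = u * map_poly polyC F + v * G.
Proof.
set G0 := map_poly _ G => ndvd.
set F' := map_poly polyC F.
have sF' : size F' = size F by rewrite size_map_polyC.
have F'0 : map_poly (horner_eval 0) F' = F.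
  by apply/polyP=> i; rewrite !coef_map /= /horner_eval hornerC.
have F'_n0 : F' != 0 by rewrite -size_poly_gt0 sF' ltnW.
have norel (A B : {poly {poly {poly L}}}) : (size B < size F)%N ->
    A * F' = B * G -> B = 0.
  (* Descent: at parameter 0 the relation forces first [B] and then [A] to vanish, so the parameter
     divides both; dividing it out lowers the degree of the leading coefficient of [B]. *)
  have [n] := ubnP (size (lead_coef B)); elim: n A B => // n IH A B ltn ltB E.
  have E0 : map_poly (horner_eval 0) A * F = map_poly (horner_eval 0) B * G0.
    by rewrite -F'0 -!rmorphM E.
  have B00 : map_poly (horner_eval 0) B = 0.
    by apply: irr_prime ndvd _ E0; apply: leq_ltn_trans ltB; apply: size_poly.
  have A00 : map_poly (horner_eval 0) A = 0.
    apply/eqP; move/eqP: E0; rewrite B00 mul0r mulf_eq0 => /orP[//|/eqP F0].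
    by move: F_gt1; rewrite F0 size_poly0.
  have [A1 A1E] := map_horner0_factor A00.
  have [B1 B1E] := map_horner0_factor B00.
  have [//|B_n0] := eqVneq B 0.
  rewrite B1E (IH A1 B1) ?mulr0 //.
  - move: ltn; rewrite ltnS; apply: leq_trans.
    rewrite B1E lead_coefM lead_coefC polyC0 subr0 mulrC size_mulX //.
    rewrite lead_coef_eq0; apply: contra_neq B_n0 => B10.
    by rewrite B1E B10 mulr0.
  - by move: ltB; rewrite B1E polyC0 subr0 size_Cmul // polyX_eq0.
  - by apply: (mulfI (polyXsub_neq0 0)); rewrite !mulrA -A1E -B1E.
have [sG|sG] := leqP (size G) 1%N.
  have [g GE] : exists g, G = g%:P by exists G`_0; apply: size1_polyC.
  exists g, 0, 1; rewrite mul0r add0r mul1r; split=> //.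
  apply/eqP => g0; apply: (ndvd 0).
  by rewrite /G0 GE g0 polyC0 raddf0 mulr0.
have sF1 : (1 < size F')%N by rewrite sF'.
have [[u v] _ E] := resultant_in_ideal sF1 sG.
exists (resultant F' G), u, v; split=> //; rewrite resultant_eq0; apply/negP => g1.
have /Pdiv.Idomain.dvdpP[[c q] /= c0 cE] := dvdp_gcdl F' G.
have /Pdiv.Idomain.dvdpP[[d q2] /= d0 dE] := dvdp_gcdr F' G.
rewrite -!mul_polyC in cE dE.
have cF0 : c%:P * F' != 0 by rewrite mulf_neq0 ?polyC_eq0.
have q0 : q != 0 by apply: contra_neq cF0 => q0; rewrite cE q0 mul0r.
(* [q] is the cofactor of the gcd in [F']. As the gcd is not constant, [q] has smaller degree than
   [F], and combining the two divisibilities gives a relation of the kind excluded by [norel]. *)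
suff: d%:P * q = 0 by apply/eqP; rewrite mulf_neq0 ?polyC_eq0.
apply: (norel (c%:P * q2)).
  rewrite size_Cmul // -sF' -(size_Cmul F' c0) cE size_mul //.
    by case: (size (gcdp F' G)) g1 => [|[|m]] // _; rewrite !addnS /= ltnS leq_addr.
  by rewrite -size_poly_gt0 ltnW.
transitivity (q2 * (c%:P * F')); first by ring.
rewrite cE; transitivity (q * (q2 * gcdp F' G)); first by ring.
by rewrite -dE; ring.
Qed.
End Irreducible.
End Bivariate.

(** * Linear changes of coordinates on bivariate polynomials *)

Section Frame.
Variables (L : closedFieldType) (e1 e2 : 'I_2 -> L).

Definition lin (S : comNzRingType) (j : L -> S) (x y : S) : 'I_2 -> S :=
  fun i => j (e1 i) * x + j (e2 i) * y.

Definition to_poly2 : {mpoly L[2]} -> {poly {poly L}} :=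
  mmap (polyC \o polyC) (lin (polyC \o polyC) 'X%:P 'X).

HB.instance Definition _ := GRing.RMorphism.on to_poly2.

Arguments to_poly2 : simpl never.

Definition ev2 (S : comNzRingType) (j : {rmorphism L -> S}) (x y : S) :
    {poly {poly L}} -> S :=
  horner_eval y \o map_poly (horner_eval x \o map_poly j).

HB.instance Definition _ S j x y := GRing.RMorphism.on (@ev2 S j x y).

Arguments ev2 : simpl never.

Lemma ev2C (S : comNzRingType) (j : {rmorphism L -> S}) x y c :
  ev2 j x y c%:P = (map_poly j c).[x].
Proof. by rewrite /ev2 /= map_polyC /horner_eval hornerC. Qed.

Lemma ev2X (S : comNzRingType) (j : {rmorphism L -> S}) x y : ev2 j x y 'X = y.
Proof. by rewrite /ev2 /= map_polyX /horner_eval hornerX. Qed.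

Lemma ev2_to_poly2 (S : comNzRingType) (j : {rmorphism L -> S}) x y F :
  ev2 j x y (to_poly2 F) = mmap j (lin j x y) F.
Proof.
rewrite /to_poly2 mmap_comp; apply: mmap_eq => [c|i].
  by rewrite -[LHS]/(ev2 j x y c%:P%:P) ev2C map_polyC hornerC.
rewrite -[LHS]/(ev2 j x y ((e1 i)%:P%:P * 'X%:P + (e2 i)%:P%:P * 'X)).
by rewrite [LHS]rmorphD !rmorphM /= !ev2C ev2X map_polyX hornerX !map_polyC !hornerC.
Qed.

Lemma ev2_id (P : {poly {poly L}}) : ev2 (polyC \o polyC) 'X%:P 'X P = P.
Proof.
rewrite /ev2 /horner_eval /=.
have -> : map_poly (horner_eval 'X%:P \o map_poly (polyC \o polyC)) P = map_poly polyC P.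
  apply: eq_map_poly => c /=; rewrite /horner_eval.
  rewrite map_poly_comp /= horner_map /=.
  by rewrite -[in RHS](comp_polyXr c) /comp_poly.
by rewrite -[RHS]comp_polyXr /comp_poly.
Qed.

Lemma ev2_comp (S S' : comNzRingType) (j : {rmorphism L -> S})
    (f : {rmorphism S -> S'}) x y P :
  f (ev2 j x y P) = ev2 (f \o j) (f x) (f y) P.
Proof.
rewrite /ev2 /= /horner_eval -[LHS]horner_map -map_poly_comp; congr (_.[_]).
apply: eq_map_poly => c /=; rewrite /horner_eval -[LHS]horner_map.
by rewrite -map_poly_comp.
Qed.

(** For a basis [e1], [e2] the map [to_poly2] is a ring isomorphism; its inverse [psi] substitutes
    the coordinate forms given by Cramer's rule. *)
Lemma to_poly2_irr F : e1 0 * e2 1 - e1 1 * e2 0 != 0 ->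
  irreducible_mpoly F -> irreducible_poly2 (to_poly2 F).
Proof.
set D := _ - _ => D0.
pose jm := @mpolyC 2 L : {rmorphism L -> {mpoly L[2]}}.
pose px : {mpoly L[2]} := D^-1%:MP * ((e2 1)%:MP * 'X_0 - (e2 0)%:MP * 'X_1).
pose py : {mpoly L[2]} := D^-1%:MP * ((e1 0)%:MP * 'X_1 - (e1 1)%:MP * 'X_0).
have DV : D^-1%:MP * ((e1 0)%:MP * (e2 1)%:MP - (e1 1)%:MP * (e2 0)%:MP) = 1
    :> {mpoly L[2]}.
  by rewrite -!mpolyCM -mpolyCB -mpolyCM mulVf // mpolyC1.
pose psi : {rmorphism {poly {poly L}} -> {mpoly L[2]}} := ev2 jm px py.
have psiK G : psi (to_poly2 G) = G.
  rewrite /psi /= ev2_to_poly2 -[RHS]comp_mpoly_id /comp_mpoly.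
  apply: mmap_eq => // i; rewrite tnth_mktuple /lin /px /py.
  have [->|->] : i = 0 \/ i = 1 by case: i => [[|[|//]] ?]; [left|right]; apply/val_inj.
  - by rewrite -[RHS]mul1r -DV /=; ring.
  - by rewrite -[RHS]mul1r -DV /=; ring.
have toK P : to_poly2 (psi P) = P.
  transitivity (ev2 (to_poly2 \o jm) (to_poly2 px) (to_poly2 py) P).
    exact: (ev2_comp jm (to_poly2 : {rmorphism _ -> _})).
  rewrite -[RHS]ev2_id.
  have toX i : to_poly2 'X_i = (e1 i)%:P%:P * 'X%:P + (e2 i)%:P%:P * 'X.
    by rewrite /to_poly2 mmapX mmap1U.
  have toC c : to_poly2 c%:MP = c%:P%:P by rewrite /to_poly2 mmapC.
  have DV2 : D^-1%:P%:P * ((e1 0)%:P%:P * (e2 1)%:P%:P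
      - (e1 1)%:P%:P * (e2 0)%:P%:P) = 1 :> {poly {poly L}}.
    by rewrite -!polyCM -!polyCB -!polyCM mulVf.
  have -> : to_poly2 px = 'X%:P.
    rewrite /px rmorphM rmorphB !rmorphM /= !toC !toX -[RHS]mul1r -DV2.
    by ring.
  have -> : to_poly2 py = 'X.
    rewrite /py rmorphM rmorphB !rmorphM /= !toC !toX -[RHS]mul1r -DV2.
    by ring.
  rewrite /ev2 /=; congr (horner_eval _ _); apply: eq_map_poly => c /=.
  by congr (horner_eval _ _); apply: eq_map_poly => d /=; rewrite toC.
case=> Fnu Firr; split.
  by apply: contra Fnu => u; rewrite -(psiK F); apply: rmorph_unit.
move=> G H E.
have : F = psi G * psi H by rewrite -rmorphM -E psiK.
case/Firr => u; [left; rewrite -(toK G)|right; rewrite -(toK H)]; exact: rmorph_unit.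
Qed.
End Frame.


(** * Valuation rings of algebraically closed fields *)

Lemma mpoly_gen_ind (n : nat) (R : comNzRingType) (Q : {mpoly R[n]} -> Prop) :
  (forall c, Q c%:MP) -> (forall i, Q 'X_i) ->
  (forall p q, Q p -> Q q -> Q (p + q)) ->
  (forall p q, Q p -> Q q -> Q (p * q)) -> forall p, Q p.
Proof.
move=> QC QX QD QM p; rewrite [p]mpolyE.
have Q0 : Q 0 by rewrite -(mpolyC0 n R).
have Q1 : Q 1 by rewrite -(mpolyC1 n R).
apply: (big_ind Q Q0 QD) => m _; rewrite -mul_mpolyC; apply: (QM) => //.
rewrite mpolyXE_id; apply: (big_ind Q Q1 QM) => i _.
by elim: (m i) => [|k IH]; rewrite ?expr0 // exprS; apply: (QM).
Qed.

Lemma mmap_rpred (n : nat) (R : nzRingType) (S : comNzRingType)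
    (A : subringClosed S) (f : R -> S) (v : 'I_n -> S) (P : {mpoly R[n]}) :
  (forall c, f c \in A) -> (forall i, v i \in A) -> mmap f v P \in A.
Proof.
move=> fA vA; apply: rpred_sum => m _; apply: rpredM => //.
by apply: rpred_prod => i _; apply: rpredX.
Qed.

(** First-order Taylor expansion along [w]. In this form derivatives pass through linear changes of
    variables, translations and the node identity by mere substitution. *)
Lemma mmap_coef1 (n : nat) (R S : comNzRingType) (f : {rmorphism R -> S})
    (v w : 'I_n -> S) (P : {mpoly R[n]}) :
  (mmap (polyC \o f) (fun i => (v i)%:P + w i *: 'X) P)`_1
  = \sum_i w i * mmap f v P^`M(i).
Proof.
pose V i := (v i)%:P + w i *: 'X; rewrite -/V.
have e0 Q : (mmap (polyC \o f) V Q)`_0 = mmap f v Q.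
  rewrite -horner_coef0 -[LHS]/(horner_eval 0 _) mmap_comp.
  apply: mmap_eq => [c|i] /=; rewrite /horner_eval ?hornerC // /V.
  by rewrite hornerD hornerC hornerZ hornerX mulr0 addr0.
elim/mpoly_gen_ind: P => [c|i|p q IHp IHq|p q IHp IHq].
- rewrite mmapC /= coefC big1 // => i _.
  by rewrite mderivC raddf0 mulr0.
- rewrite mmapX mmap1U /V coefD coefC coefZ coefX add0r mulr1.
  rewrite (bigD1 i) //= mderivX mnm1E eqxx scale1r -{1}[U_(i)%MM]add0m addmK mpolyX0 rmorph1 mulr1.
  rewrite big1 ?addr0 // => j ne; rewrite mderivX mnm1E eq_sym (negbTE ne).
  by rewrite scale0r raddf0 mulr0.
- rewrite raddfD coefD IHp IHq -big_split; apply: eq_bigr => i _ /=.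
  by rewrite raddfD raddfD mulrDr.
rewrite rmorphM coefM big_ord_recl big_ord1 /= subn0 IHp IHq !e0.
rewrite mulr_sumr mulr_suml -big_split; apply: eq_bigr => i _ /=.
by rewrite mderivM rmorphD !rmorphM /=; ring.
Qed.

Section ValuationRing.
Variables (L K : closedFieldType) (iota : {rmorphism L -> K}) (O : {pred K}).
Hypothesis hO : specialisation_ring iota O.
Local Notation m := (max_ideal O).

HB.instance Definition _ := GRing.isSubringClosed.Build K O (vr_subring hO).

Lemma O1 : 1 \in O. Proof. exact: rpred1. Qed.
Lemma O0 : 0 \in O. Proof. exact: rpred0. Qed.
Lemma OD x y : x \in O -> y \in O -> x + y \in O. Proof. exact: rpredD. Qed.
Lemma ON x : x \in O -> - x \in O. Proof. by rewrite rpredN. Qed.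
Lemma OB x y : x \in O -> y \in O -> x - y \in O. Proof. exact: rpredB. Qed.
Lemma OM x y : x \in O -> y \in O -> x * y \in O. Proof. exact: rpredM. Qed.
Lemma OX x n : x \in O -> x ^+ n \in O. Proof. exact: rpredX. Qed.

Lemma polyO_X : 'X \is a polyOver O. Proof. exact: polyOverX. Qed.
Lemma polyO_1 : 1 \is a polyOver O. Proof. exact: rpred1. Qed.
Lemma polyO_C x : x \in O -> x%:P \is a polyOver O.
Proof. by rewrite polyOverC. Qed.
Lemma polyO_D p q : p \is a polyOver O -> q \is a polyOver O ->
  p + q \is a polyOver O.
Proof. exact: rpredD. Qed.
Lemma polyO_M p q : p \is a polyOver O -> q \is a polyOver O ->
  p * q \is a polyOver O.
Proof. exact: rpredM. Qed.
Lemma polyO_Z x p : x \in O -> p \is a polyOver O -> x *: p \is a polyOver O.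
Proof. exact: polyOverZ. Qed.
Lemma polyO_horner p x : p \is a polyOver O -> x \in O -> p.[x] \in O.
Proof. exact: rpred_horner. Qed.

Lemma polyO_intro (p : {poly K}) : (forall i, p`_i \in O) -> p \is a polyOver O.
Proof. by move=> h; apply/polyOverP. Qed.

Lemma polyO_coef p i : p \is a polyOver O -> p`_i \in O.
Proof. by move/polyOverP. Qed.

Lemma m_O x : x \in m -> x \in O. Proof. by case/andP. Qed.

Lemma m0 : 0 \in m. Proof. by rewrite inE /= O0 eqxx. Qed.

Lemma unitP x : x \in O -> x \notin m -> x != 0 /\ x^-1 \in O.
Proof. by rewrite inE /= => -> /=; rewrite negb_or negbK => /andP[]. Qed.

Lemma notin_O x : x \notin O -> x^-1 \in m.
Proof.
move=> xO; have [/(negP xO) //|xVO] := vr_total hO x.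
by rewrite inE /= xVO invrK xO orbT.
Qed.

Lemma notin_m x : x \notin m -> x != 0 /\ x^-1 \in O.
Proof.
have [xO|xO] := boolP (x \in O); first exact: unitP.
split; last by apply: m_O; apply: notin_O.
by apply: contra xO => /eqP->; apply: O0.
Qed.

Lemma mM a x : a \in O -> x \in m -> a * x \in m.
Proof.
move=> aO xm; have xO := m_O xm; move: (xm); rewrite !inE /= xO OM //=.
case: (eqVneq x 0) => [->|x0 /= xV]; first by rewrite mulr0 eqxx.
have [->|a0] := eqVneq a 0; first by rewrite mul0r eqxx.
rewrite mulf_eq0 (negbTE a0) (negbTE x0) /=; apply: contra xV => axV.
by rewrite -[x^-1](mulVKf a0) -invfM OM.
Qed.

Lemma mMr a x : a \in O -> x \in m -> x * a \in m.
Proof. by rewrite mulrC; apply: mM. Qed.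

(** The preorder v(a) <= v(b) of the valuation, without a value group. *)
Definition dv (a b : K) : Prop := exists2 c, c \in O & b = a * c.

Lemma dv_total a b : dv a b \/ dv b a.
Proof.
have [->|a0] := eqVneq a 0; first by right; exists 0; rewrite ?O0 ?mulr0.
have [->|b0] := eqVneq b 0; first by left; exists 0; rewrite ?O0 ?mulr0.
have [h|h] := vr_total hO (b / a).
  by left; exists (b / a) => //; rewrite mulrC divfK.
by right; exists (a / b); [rewrite -invf_div|rewrite mulrC divfK].
Qed.

Lemma dv_refl a : dv a a. Proof. by exists 1; rewrite ?O1 ?mulr1. Qed.
Lemma dv_trans b a c : dv a b -> dv b c -> dv a c.
Proof. by case=> x xO -> [y yO ->]; exists (x * y); rewrite ?OM ?mulrA. Qed.
Lemma dv0 a : dv a 0. Proof. by exists 0; rewrite ?O0 ?mulr0. Qed.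
Lemma dvD a b c : dv a b -> dv a c -> dv a (b + c).
Proof. by case=> x xO -> [y yO ->]; exists (x + y); rewrite ?OD ?mulrDr. Qed.
Lemma dvN a b : dv a b -> dv a (- b).
Proof. by case=> x xO ->; exists (- x); rewrite ?ON ?mulrN. Qed.
Lemma dvMr a b c : c \in O -> dv a b -> dv a (b * c).
Proof. by move=> cO [x xO ->]; exists (x * c); rewrite ?OM ?mulrA. Qed.
Lemma dvMl a b c : c \in O -> dv a b -> dv a (c * b).
Proof. by rewrite mulrC; apply: dvMr. Qed.
Lemma dv_mul a b c d : dv a b -> dv c d -> dv (a * c) (b * d).
Proof. by case=> x xO -> [y yO ->]; exists (x * y); [exact: OM|rewrite mulrACA]. Qed.
Lemma dvX a b n : dv a b -> dv (a ^+ n) (b ^+ n).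
Proof. by case=> x xO ->; exists (x ^+ n); rewrite ?OX ?exprMn. Qed.
Lemma dv_m a b : a \in m -> dv a b -> b \in m.
Proof. by move=> am [c cO ->]; apply: mMr. Qed.
Lemma mD x y : x \in m -> y \in m -> x + y \in m.
Proof.
move=> xm ym; have [d|d] := dv_total x y.
  by apply: (dv_m xm); apply: dvD d; apply: dv_refl.
by apply: (dv_m ym); apply: dvD d _; apply: dv_refl.
Qed.

Lemma mN x : x \in m -> - x \in m.
Proof. by move=> xm; rewrite -mulN1r mM // ON // O1. Qed.

Lemma mB x y : x \in m -> y \in m -> x - y \in m.
Proof. by move=> xm ym; rewrite mD // mN. Qed.

Lemma one_notin_m : 1 \notin m.
Proof. by rewrite inE /= O1 invr1 O1 oner_eq0. Qed.

Lemma m_unit x y : x \in m -> x * y = 1 -> y \notin O.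
Proof.
by move=> xm e; apply/negP => yO; have := mMr yO xm; rewrite e (negbTE one_notin_m).
Qed.

Lemma unitDm x y : x \notin m -> y \in m -> x + y \notin m.
Proof. by move=> xm ym; apply: contra xm => h; rewrite -[x](addrK y) mB. Qed.

Lemma unitN x : x \notin m -> - x \notin m.
Proof. by apply: contra => /mN; rewrite opprK. Qed.

Lemma unitM x y : x \notin m -> y \notin m -> x * y \notin m.
Proof.
case/notin_m=> x0 xV; apply: contra => h.
by rewrite -[y](mulKf x0) mM.
Qed.

Lemma iota_O a : iota a \in O. Proof. exact: vr_base hO a. Qed.

Lemma iota_unit a : a != 0 -> iota a \notin m.
Proof.
move=> a0; rewrite inE /= iota_O /= negb_or fmorph_eq0 a0 negbK.
by rewrite -fmorphV iota_O.
Qed.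

Lemma iota_m a : iota a \in m -> a = 0.
Proof. by apply: contraTeq; apply: iota_unit. Qed.

(** Algebraic closure of [K] replaces completeness. If no root is infinitesimal, all inverse roots
    are in [O], so [P] is its constant term times a polynomial over [O], and all its coefficients
    are infinitesimal. *)
Lemma hensel_root (P : {poly K}) : P \is a polyOver O -> P`_0 \in m ->
  (exists i, P`_i \notin m) -> exists2 s, s \in m & P.[s] = 0.
Proof.
move=> /polyOverP PO P0 [i Pi]; apply: NNPP => nroot.
have [r PE] := closed_field_poly_normal P.
have rm z : z \in r -> z \notin m.
  move=> zr; apply/negP => zm; apply: nroot; exists z => //.
  rewrite PE hornerZ horner_prod; apply/eqP; rewrite mulf_eq0; apply/orP; right.
  by rewrite prodf_seq_eq0; apply/hasP; exists z; rewrite //= hornerXsubC subrr.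
have [Q [QO Q0 QE]] : exists Q : {poly K}, [/\ Q \is a polyOver O, Q`_0 = 1
    & \prod_(z <- r) ('X - z%:P) = (\prod_(z <- r) - z) *: Q].
  elim: r rm {PE} => [|z r IH] rm.
    by exists 1; rewrite !big_nil scale1r coefC rpred1.
  have [|Q [QO Q0 QE]] := IH; first by move=> y yr; apply: rm; rewrite inE yr orbT.
  have /notin_m[z0 zV] := rm z (mem_head _ _).
  exists ((1 - z^-1 *: 'X) * Q); rewrite rpredM ?rpredB ?rpred1 ?polyOverZ ?polyOverX //.
  split=> //.
    by rewrite coef0M Q0 coefB coefZ coefX mulr0 subr0 coefC mulr1.
  rewrite !big_cons QE -scalerAr [in RHS]mulrC -scalerA; congr (_ *: _).
  rewrite scalerAl; congr (_ * _).
  by rewrite scalerBr scalerA mulNr mulfV // scaleN1r opprK addrC scaleNr -mul_polyC mulr1.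
move: P0 Pi; rewrite PE QE scalerA !coefZ Q0 mulr1 => P0.
by rewrite mMr //; apply: (polyOverP QO).
Qed.

Lemma horner_split2 (P : {poly K}) : P \is a polyOver O ->
  forall s, s \in O -> exists2 c, c \in O & P.[s] = P`_0 + P`_1 * s + s ^+ 2 * c.
Proof.
move=> PO s sO; exists (drop_poly 2 P).[s].
  rewrite rpred_horner //; apply/polyOverP => i; rewrite coef_drop_poly.
  by apply: (polyOverP PO).
rewrite -{1}[P](poly_take_drop 2) hornerD hornerM hornerXn mulrC; congr (_ + _).
rewrite (@horner_coef_wide _ 2) ?size_take_poly // big_ord_recl big_ord1.
by rewrite !coef_take_poly /= expr0 expr1 mulr1.
Qed.

Lemma hensel_simple (P : {poly K}) : P \is a polyOver O -> P`_0 \in m ->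
  P`_1 \notin m -> exists s, [/\ s \in m, P.[s] = 0 & dv P`_0 s].
Proof.
move=> PO P0 P1; have [|s sm Ps] := hensel_root PO P0; first by exists 1%N.
exists s; split=> //; have [c cO E] := horner_split2 PO (m_O sm).
pose u := P`_1 + s * c.
have um : u \notin m by apply: unitDm; rewrite // mMr.
have [u0 uV] := notin_m um; exists (- u^-1); first exact: ON.
have us : u * s = - P`_0.
  apply/eqP; rewrite -addr_eq0 addrC; apply/eqP.
  by rewrite -[RHS]Ps E /u; ring.
by apply: (mulfI u0); rewrite us mulrCA mulrN mulfV // mulrN1.
Qed.

Lemma dv_max (f : K -> K) x0 (s : seq K) : exists2 r, r \in x0 :: s &
  forall x, x \in x0 :: s -> dv (f x) (f r).
Proof.
elim: s => [|y s [r rs rmax]].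
  by exists x0; rewrite ?mem_head // => x; rewrite inE => /eqP->; apply: dv_refl.
have [d|d] := dv_total (f y) (f r).
  exists r => [|x]; first by move: rs; rewrite !inE => /orP[]->; rewrite ?orbT.
  rewrite !inE orbCA => /orP[/eqP->//|]; exact: rmax.
exists y => [|x]; first by rewrite !inE eqxx orbT.
rewrite !inE orbCA => /orP[/eqP->|/rmax h]; first exact: dv_refl.
exact: dv_trans h d.
Qed.

(* A root of [f] cannot be reached by Newton steps since O need not be complete.
   But [f] divides a polynomial [P], and an isometry without zeros stays away
   from the finitely many roots of [P]; so the values of [P], hence those of
   [f], would have bounded valuation. *)
Lemma isometry_root (f : K -> K) (P : {poly K}) t e :
  t \in m ->
  (forall x y, x \in m -> y \in m ->
     exists k, [/\ k \in O, k \notin m & f x - f y = k * (x - y)]) ->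
  (forall x, x \in m -> exists2 y, y \in m & dv (f x ^+ 2) (f y)) ->
  P != 0 -> (forall x, x \in m -> dv (f x) P.[x]) ->
  dv (lead_coef P) (t ^+ e) -> dv t (f 0) ->
  exists2 x, x \in m & f x = 0.
Proof.
move=> tm iso newton P0 fP leadP tf0; apply: NNPP => noroot.
have f_n0 x : x \in m -> f x != 0.
  by move=> xm; apply/eqP => fx; apply: noroot; exists x.
have fm x : x \in m -> f x \in m.
  move=> xm; have [k [kO _ E]] := iso x 0 xm m0.
  rewrite -[f x](subrK (f 0)) E subr0 mD ?mM //; exact: dv_m tm tf0.
have [rs PE] := closed_field_poly_normal P.
(* [rho] has the largest valuation among [f 0] and the values of [f] at the infinitesimal roots of
   [P]. Including 0 makes [t], and so a bound for the leading coefficient of [P], comparable with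
   [rho]. *)
have [r rr rmax] := dv_max f 0 [seq z <- rs | z \in m].
have r_m : r \in m.
  by move: rr; rewrite inE mem_filter => /orP[/eqP->|/andP[]//]; apply: m0.
set rho := f r in rmax.
have iter k : exists2 x, x \in m & dv (rho ^+ k.+2) (f x).
  elim: k => [|k [x xm h]]; first exact: newton.
  have [y ym h2] := newton x xm; exists y => //.
  apply: dv_trans h2; apply: dv_trans (dvX 2 h).
  rewrite -exprM; exists (rho ^+ (k.+2 * 2 - k.+3)).
    by rewrite OX // m_O // fm.
  by rewrite -exprD subnKC // muln2 -addnn -addSnnS leq_addr.
(* [N] counts the factors of [P.[x]]: the leading coefficient divides [rho ^+ e], and each of the
   [size rs] root factors divides [rho]. The two extra powers of [rho] in [f x] give the
   contradiction. *)
pose N := (e + size rs)%N; have [x xm hx] := iter N.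
have dvz z : z \in rs -> dv (x - z) rho.
  move=> zrs; have [zm|zm] := boolP (z \in m).
    have zz : z \in 0 :: [seq z <- rs | z \in m] by rewrite inE mem_filter zm zrs orbT.
    apply: dv_trans (rmax z zz).
    (* [f x] has larger valuation than [f z], so by the isometry x - z has the valuation of
       [f z]. *)
    have [k [kO km E]] := iso x z xm zm; have [k0 kV] := notin_m km.
    have [c1 c1O rhoE] := rmax z zz; have [c2 c2O fxE] := hx.
    set q := c1 * (rho ^+ N.+1 * c2).
    have qm : q \in m.
      by rewrite mM // mMr // exprS mMr ?OX ?m_O ?fm.
    have fx : f x = f z * q by rewrite fxE exprS {1}rhoE /q; ring.
    have u : q - 1 \notin m by rewrite addrC unitDm // unitN // one_notin_m.
    have [u0 uV] := notin_m u.
    exists (k * (q - 1)^-1); first exact: OM.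
    rewrite mulrA [(x - z) * k]mulrC -E fx -{3}[f z]mulr1 -mulrBr mulfK //.
  have xz : x - z \notin m.
    by apply: contra zm => h; rewrite -[z](subKr x) mB.
  have [xz0 xzV] := notin_m xz; exists ((x - z)^-1 * rho).
    by rewrite OM // m_O // fm.
  by rewrite mulVKf.
have dvprod : dv (\prod_(z <- rs) (x - z)) (rho ^+ size rs).
  elim: rs dvz {PE rr rmax N hx iter} => [|z rs IH] dvz.
    by rewrite big_nil expr0; apply: dv_refl.
  rewrite big_cons exprS; apply: dv_mul; first exact: dvz (mem_head _ _).
  by apply: IH => y yrs; apply: dvz; rewrite inE yrs orbT.
have dvP : dv P.[x] (rho ^+ N).
  rewrite PE hornerZ horner_prod /N exprD; apply: dv_mul.
    apply: dv_trans leadP _; apply: dvX; apply: dv_trans tf0 _.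
    by apply: rmax; rewrite mem_head.
  by under eq_bigr do rewrite hornerXsubC.
have [c cO E] := dv_trans hx (dv_trans (fP x xm) dvP).
have rho0 : rho ^+ N != 0 by rewrite expf_neq0 // f_n0.
have e1 : rho ^+ 2 * c = 1.
  by apply: (mulfI rho0); rewrite mulr1 mulrA -exprD addn2 -E.
suff: c \notin O by rewrite cO.
by apply: m_unit e1; rewrite expr2 mMr ?m_O ?fm.
Qed.

Lemma mmap_O n (v : 'I_n -> K) (P : {mpoly L[n]}) :
  (forall i, v i \in O) -> mmap iota v P \in O.
Proof. by move=> vO; apply: mmap_rpred => // c; apply: iota_O. Qed.

Lemma mmap_polyO n (v : 'I_n -> {poly K}) (P : {mpoly L[n]}) :
  (forall i, v i \is a polyOver O) -> mmap (polyC \o iota) v P \is a polyOver O.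
Proof. by move=> vO; apply: mmap_rpred => // c; rewrite polyOverC iota_O. Qed.

(** [I] stands for an [O]-submodule of [K]; it is used for the multiples of an element and for the
    maximal ideal. *)
Lemma mmap_congr n (I : K -> Prop) (v w : 'I_n -> K) (P : {mpoly L[n]}) :
  I 0 -> (forall x y, I x -> I y -> I (x + y)) ->
  (forall c x, c \in O -> I x -> I (x * c)) ->
  (forall i, v i \in O) -> (forall i, w i \in O) -> (forall i, I (v i - w i)) ->
  I (mmap iota v P - mmap iota w P).
Proof.
move=> I0 ID IM vO wO vw; elim/mpoly_gen_ind: P => [c|i|p q IHp IHq|p q IHp IHq].
- by rewrite !mmapC subrr.
- by rewrite !mmapX !mmap1U.
- by rewrite !mmapD opprD addrACA; apply: ID.
rewrite !rmorphM /=; set a1 := mmap _ v p in IHp *; set a2 := mmap _ w p in IHp *.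
set b1 := mmap _ v q in IHq *; set b2 := mmap _ w q in IHq *.
have -> : a1 * b1 - a2 * b2 = (a1 - a2) * b1 + (b1 - b2) * a2 by ring.
by apply: ID; apply: IM => //; apply: mmap_O.
Qed.

Lemma mmap_dv n (v w : 'I_n -> K) (P : {mpoly L[n]}) a :
  (forall i, v i \in O) -> (forall i, w i \in O) -> (forall i, dv a (v i - w i)) ->
  dv a (mmap iota v P - mmap iota w P).
Proof.
apply: mmap_congr => [|x y|c x]; [exact: dv0|exact: dvD|exact: dvMr].
Qed.

Lemma mmap_residue n (v w : 'I_n -> K) (P : {mpoly L[n]}) :
  (forall i, v i \in O) -> (forall i, w i \in O) ->
  (forall i, v i - w i \in m) -> mmap iota v P - mmap iota w P \in m.
Proof.
by apply: (mmap_congr (I := fun x => x \in m)) => [|x y|c x];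
  [exact: m0|exact: mD|exact: mMr].
Qed.

(** [e] is the order of vanishing of [p] at 0; the remaining factor has a nonzero residue and is a
    unit. *)
Lemma poly_dv_exp (p : {poly L}) t : t \in m -> p != 0 ->
  exists e, dv (map_poly iota p).[t] (t ^+ e).
Proof.
move=> tm p0; have [n [q q0 ->]] : exists n, exists2 q, q.[0] != 0 & p = q * 'X^n.
  have [n [q nq ->]] := multiplicity_XsubC p 0; exists n, q.
    by move: nq; rewrite p0.
  by rewrite polyC0 subr0.
exists n; rewrite rmorphM /= map_polyXn hornerM hornerXn.
have qO : map_poly iota q \is a polyOver O.
  by apply/polyOverP => i; rewrite coef_map /= iota_O.
have u : (map_poly iota q).[t] \notin m.
  have -> : (map_poly iota q).[t] = iota q.[0] + ((map_poly iota q).[t] - iota q.[0]).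
    by rewrite addrC subrK.
  apply: unitDm; first exact: iota_unit.
  have [d dE] : exists d, q = d * 'X + q.[0]%:P.
    exists (drop_poly 1 q); rewrite -{1}[q](poly_take_drop 1) addrC; congr (_ + _).
    apply/polyP => i; rewrite coef_take_poly coefC horner_coef0.
    by case: i.
  rewrite {1}dE rmorphD rmorphM /= map_polyX map_polyC hornerD hornerM hornerX hornerC.
  rewrite addrK mM // rpred_horner ?m_O //.
  by apply/polyOverP => i; rewrite coef_map /= iota_O.
have [u0 uV] := notin_m u; exists (map_poly iota q).[t]^-1 => //.
by rewrite mulrAC mulfV // mul1r.
Qed.

End ValuationRing.


(** * The two branches of a node *)

Definition vec3 (S : nzRingType) (a b c : S) : 'I_3 -> S := fun i => [:: a; b; c]`_i.

Lemma vec3_in (S : nzRingType) (a b c : S) (A : {pred S}) :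
  a \in A -> b \in A -> c \in A -> forall i, vec3 a b c i \in A.
Proof. by move=> aA bA cA [[|[|[|]]] //= ?]. Qed.

Lemma vec3_map (S T : nzRingType) (f : S -> T) (a b c : S) :
  f \o vec3 a b c =1 vec3 (f a) (f b) (f c).
Proof. by case=> [[|[|[|]]]]. Qed.

Lemma mmap_vec3 (R S T : comNzRingType) (j : {rmorphism R -> S})
    (f : {rmorphism S -> T}) (a b c : S) (P : {mpoly R[3]}) :
  f (mmap j (vec3 a b c) P) = mmap (f \o j) (vec3 (f a) (f b) (f c)) P.
Proof. by rewrite mmap_comp; apply: mmap_eq => //; apply: vec3_map. Qed.

(* In the basis e1, e2 the quadratic part of F is the product of the two
   coordinates; Ct collects the terms of degree at least 3. *)
Definition node_frame (L : closedFieldType) (F : {mpoly L[2]}) (e1 e2 : 'I_2 -> L)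
    (Ct : {mpoly L[3]}) : Prop :=
  forall (S : comNzRingType) (j : {rmorphism L -> S}) (t a b : S),
    mmap j (lin e1 e2 j (t * a) (t * b)) F
    = t ^+ 2 * (a * b + t * mmap j (vec3 t a b) Ct).

Section Local.
Variables (L K : closedFieldType) (iota : {rmorphism L -> K}) (O : {pred K}).
Hypothesis hO : specialisation_ring iota O.
Local Notation m := (max_ideal O).

Variables (F : {mpoly L[2]}) (e1 e2 : 'I_2 -> L) (Ct : {mpoly L[3]}).
Hypothesis frame : node_frame F e1 e2 Ct.

Local Notation val2 P x y := (mmap iota (lin e1 e2 iota x y) P).
Local Notation H a b c := (mmap iota (vec3 a b c) Ct).
Local Notation dv := (dv O).

(* Says that F vanishes at x e1 + x s e2, after division by x ^+ 2; the branch
   tangent to e2 is obtained by exchanging e1 and e2. *)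
Definition on_branch1 (x s : K) : Prop := s \in m /\ s = - (x * H x 1 s).

Lemma remainder_O a b c : a \in O -> b \in O -> c \in O -> H a b c \in O.
Proof. by move=> aO bO cO; apply: (mmap_O hO); apply: vec3_in. Qed.

Lemma remainder_dv d a b c a' b' c' :
  a \in O -> b \in O -> c \in O -> a' \in O -> b' \in O -> c' \in O ->
  dv d (a - a') -> dv d (b - b') -> dv d (c - c') ->
  dv d (H a b c - H a' b' c').
Proof.
move=> aO bO cO aO' bO' cO' da db dc.
apply: (mmap_dv hO); [exact: vec3_in|exact: vec3_in|].
by case=> [[|[|[|]]] //= ?].
Qed.

Lemma val_scale t a b : val2 F (t * a) (t * b) = t ^+ 2 * (a * b + t * H t a b).
Proof. exact: frame. Qed.

Lemma val_branch1 x s : on_branch1 x s -> val2 F x (x * s) = 0.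
Proof.
case=> _ sE; have := val_scale x 1 s; rewrite mulr1 => ->.
by rewrite mul1r {1}sE addNr mulr0.
Qed.

Lemma on_branch1P x s : x \in m -> s \in O -> x != 0 -> val2 F x (x * s) = 0 ->
  on_branch1 x s.
Proof.
move=> xm sO x0; have := val_scale x 1 s; rewrite mulr1 => -> /eqP.
rewrite mulf_eq0 expf_eq0 /= (negbTE x0) /= mul1r addr_eq0 => /eqP sE.
by split=> //; rewrite sE (mN hO) // (mMr hO) // remainder_O ?(O1 hO) ?(m_O xm).
Qed.

Lemma branch1_exists x : x \in m -> exists s, on_branch1 x s.
Proof.
move=> xm; have xO := m_O xm.
pose C := mmap (polyC \o iota) (vec3 x%:P 1 'X) Ct.
have CO : C \is a polyOver O.
  by apply: (mmap_polyO hO); apply: vec3_in;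
    [exact: (polyO_C hO)|exact: (polyO_1 hO)|exact: (polyO_X hO)].
have CE s : C.[s] = H x 1 s.
  rewrite -[C.[s]]/(horner_eval s C) mmap_vec3 /= /horner_eval !hornerE.
  by apply: mmap_eq => // c; rewrite /= /horner_eval hornerC.
have PO : 'X + x *: C \is a polyOver O.
  by apply: (polyO_D hO); [exact: (polyO_X hO)|exact: (polyO_Z hO)].
have [||s [sm Ps _]] := hensel_simple hO PO.
- by rewrite coefD coefX coefZ add0r; apply: (mMr hO) => //; apply: (polyO_coef hO).
- rewrite coefD coefX coefZ; apply: (unitDm hO); first exact: (one_notin_m hO).
  by apply: (mMr hO) => //; apply: (polyO_coef hO).
exists s; split=> //; move: Ps; rewrite hornerD hornerX hornerZ CE.
by move/eqP; rewrite addr_eq0 => /eqP.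
Qed.

(** When the two fixed-point equations are subtracted, s - s' returns only with an infinitesimal
    factor and is absorbed by a unit. With x = x' this shows that the first coordinate determines
    the point of the branch. *)
Lemma branch1_diff x x' s s' : x \in m -> x' \in m ->
  on_branch1 x s -> on_branch1 x' s' -> dv (x - x') (s - s').
Proof.
move=> xm xm' [sm sE] [sm' sE'].
have [xO xO' sO sO'] : [/\ x \in O, x' \in O, s \in O & s' \in O].
  by split; apply: m_O.
have O1 := O1 hO.
have [c cO cE] : dv (s - s') (H x' 1 s - H x' 1 s').
  apply: remainder_dv => //; rewrite ?subrr;
    first [exact: (dv0 hO)|exact: (dv_refl hO)].
have [d dO dE] : dv (x - x') (H x 1 s - H x' 1 s).
  apply: remainder_dv => //; rewrite ?subrr;
    first [exact: (dv0 hO)|exact: (dv_refl hO)].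
have E : (s - s') * (1 + x' * c) = (x - x') * - (H x 1 s + x' * d).
  rewrite mulrDr mulr1 mulrCA -cE {1}sE {1}sE'.
  have -> : (x - x') * - (H x 1 s + x' * d) = - ((x - x') * H x 1 s) - x' * ((x - x') * d).
    by ring.
  by rewrite -dE; ring.
have u : 1 + x' * c \notin m.
  by apply: (unitDm hO); [exact: (one_notin_m hO)|exact: (mMr hO)].
have [u0 uV] := notin_m hO u.
exists (- (H x 1 s + x' * d) * (1 + x' * c)^-1).
  apply: (OM hO) => //; apply: (ON hO); apply: (OD hO); first exact: remainder_O.
  exact: (OM hO).
by rewrite mulrA -E mulfK.
Qed.

Lemma branch1_chord x x' s s' : x \in m -> x' \in m ->
  on_branch1 x s -> on_branch1 x' s' ->
  exists2 mu, mu \in m & x * s - x' * s' = (x - x') * mu.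
Proof.
move=> xm xm' h h'; have [c cO cE] := branch1_diff xm xm' h h'.
exists (s + x' * c).
  by apply: (mD hO); [exact: h.1|exact: (mMr hO)].
by rewrite [RHS]mulrDr mulrCA -cE; ring.
Qed.

Definition dF x y al be :=
  \sum_i lin e1 e2 iota al be i * val2 F^`M(i) x y.

Lemma dF_lin x y al be : dF x y al be = al * dF x y 1 0 + be * dF x y 0 1.
Proof.
rewrite /dF !mulr_sumr -big_split; apply: eq_bigr => i _ /=.
by rewrite /lin; ring.
Qed.

Lemma dF_coef1 x y al be :
  (mmap (polyC \o iota)
     (lin e1 e2 (polyC \o iota) (x%:P + al *: 'X) (y%:P + be *: 'X)) F)`_1
  = dF x y al be.
Proof.
rewrite /dF -mmap_coef1; congr ((polyseq _)`_1); apply: mmap_eq => // i.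
rewrite /lin /= !mulrDr -!scalerAr -!mul_polyC !polyCD !polyCM.
by ring.
Qed.

(** The quadratic part xy has derivative y al + x be, and on the branch y = x s is negligible
    against x. *)
Lemma dF_branch1 x s al be : x \in m -> x != 0 -> on_branch1 x s ->
  al \in O -> be \in O ->
  exists2 c, c \in m & dF x (x * s) al be = x * (be + c).
Proof.
move=> xm x0 [sm _] alO beO; have xO := m_O xm; have sO := m_O sm; have O1 := O1 hO.
pose v := vec3 x%:P (1 + al *: 'X) (s%:P + be *: 'X).
pose C := mmap (polyC \o iota) v Ct.
have CO : C \is a polyOver O.
  have linO a b : a \in O -> b \in O -> a%:P + b *: 'X \is a polyOver O.
    move=> aO bO; apply: (polyO_D hO); first exact: (polyO_C hO).
    by apply: (polyO_Z hO) => //; apply: (polyO_X hO).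
  apply: (mmap_polyO hO); apply: vec3_in; [exact: (polyO_C hO)| |exact: linO].
  by rewrite -polyC1; apply: linO.
exists (al * s + x * C`_1).
  by apply: (mD hO); [apply: (mM hO)|apply: (mMr hO) => //; apply: (polyO_coef hO)].
(* With the direction multiplied by [x], point and direction are both multiples of [x], and [frame]
   applies over [{poly K}]. *)
apply: (mulfI x0).
have -> : x * dF x (x * s) al be = dF x (x * s) (x * al) (x * be).
  by rewrite dF_lin [RHS]dF_lin; ring.
rewrite -dF_coef1.
have -> : x%:P + (x * al) *: 'X = x%:P * (1 + al *: 'X).
  by rewrite mulrDr mulr1 -!mul_polyC polyCM mulrA.
have -> : (x * s)%:P + (x * be) *: 'X = x%:P * (s%:P + be *: 'X).
  by rewrite mulrDr -!mul_polyC !polyCM mulrA.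
rewrite (frame (polyC \o iota)) -/v -/C -rmorphXn coefCM coefD coefCM.
have -> : ((1 + al *: 'X) * (s%:P + be *: 'X))`_1 = be + al * s.
  rewrite coefM big_ord_recl big_ord1 /= subn0 !coefD !coefZ !coefX !coefC /=.
  by ring.
by ring.
Qed.

End Local.


Section PolyO.
Variables (L K : closedFieldType) (iota : {rmorphism L -> K}) (O : {pred K}).
Hypothesis hO : specialisation_ring iota O.

Lemma map_iota_polyO (p : {poly L}) : map_poly iota p \is a polyOver O.
Proof. by apply: (polyO_intro hO) => i; rewrite coef_map; apply: (iota_O hO). Qed.

Lemma horner_iota_O (p : {poly L}) x : x \in O -> (map_poly iota p).[x] \in O.
Proof. by apply: (polyO_horner hO); apply: map_iota_polyO. Qed.

Lemma horner_iota_residue (p : {poly L}) x : x \in max_ideal O ->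
  (map_poly iota p).[x] - iota p`_0 \in max_ideal O.
Proof.
move=> xm; have dE : p = drop_poly 1 p * 'X + (p`_0)%:P.
  rewrite -{1}[p](poly_take_drop 1) addrC; congr (_ + _).
  by apply/polyP => i; rewrite coef_take_poly coefC; case: i.
rewrite {1}dE rmorphD rmorphM /= map_polyX map_polyC hornerD hornerM hornerX hornerC.
by rewrite addrK; apply: (mM hO) => //; apply: horner_iota_O; apply: m_O.
Qed.

Lemma ev2_O x y P : x \in O -> y \in O -> ev2 iota x y P \in O.
Proof.
move=> xO yO; rewrite /ev2 /= /horner_eval; apply: (polyO_horner hO) => //.
by apply: (polyO_intro hO) => i; rewrite coef_map_id0 /= /horner_eval ?raddf0 ?horner0 //; apply: horner_iota_O.
Qed.
End PolyO.

Lemma ev2_swap (L : closedFieldType) (S : comNzRingType) (j : {rmorphism L -> S})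
    x y (P : {poly {poly L}}) : ev2 j x y P = ev2 j y x (swapXY P).
Proof.
have E a b Q : ev2 j a b Q = (map_poly (map_poly j) Q).[b%:P].[a].
  transitivity ((map_poly (horner_eval a) (map_poly (map_poly j) Q)).[horner_eval a b%:P]).
    by rewrite -map_poly_comp [horner_eval a b%:P]hornerC.
  exact: horner_map.
by rewrite !E -swapXY_map horner2_swapXY.
Qed.

(* Inner to outer, the variables of [P] are evaluated at x, t and y. *)
Definition ev3 (L : closedFieldType) (S : comNzRingType) (j : {rmorphism L -> S})
    (x t y : S) : {poly {poly {poly L}}} -> S :=
  horner_eval y \o map_poly (ev2 j x t).

HB.instance Definition _ L S j x t y := GRing.RMorphism.on (@ev3 L S j x t y).

(** * Truncated branches and their limits under a rational map *)

Section Branch.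
Variables (L K : closedFieldType) (iota : {rmorphism L -> K}) (O : {pred K}).
Hypothesis hO : specialisation_ring iota O.
Local Notation m := (max_ideal O).
Variables (F : {mpoly L[2]}) (e1 e2 : 'I_2 -> L) (Ct : {mpoly L[3]}).
Hypothesis frame : node_frame F e1 e2 Ct.
Hypothesis Firr : irreducible_poly2 (to_poly2 e1 e2 F).

Local Notation val2 P x y := (mmap iota (lin e1 e2 iota x y) P).
Local Notation H a b c := (mmap iota (vec3 a b c) Ct).
Local Notation dv := (dv O).
Local Notation branch := (on_branch1 iota O Ct).

Lemma m_nonzero : exists2 x, x \in m & x != 0.
Proof. exact: (vr_nontrivial hO). Qed.

(** Otherwise F would be a polynomial in the first coordinate alone, vanishing at a nonzero
    infinitesimal because the branch has a point above it; [poly_dv_exp] forbids this. *)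
Lemma to_poly2_size : (1 < size (to_poly2 e1 e2 F))%N.
Proof.
rewrite ltnNge; apply/negP => s1.
have [p pE] : exists p, to_poly2 e1 e2 F = p%:P.
  by exists (to_poly2 e1 e2 F)`_0; apply: size1_polyC.
have [x xm x0] := m_nonzero; have [s sb] := branch1_exists hO Ct xm.
have : ev2 iota x (x * s) p%:P = 0.
  by rewrite -pE ev2_to_poly2 (val_branch1 frame sb).
rewrite ev2C => px; have [p0|p0] := eqVneq p 0.
  case: Firr => nu /(_ 0 0); rewrite pE p0 mul0r polyC0 unitr0 => /(_ erefl).
  by case.
have [e [c _ /eqP]] := poly_dv_exp hO xm p0.
by rewrite px mul0r expf_eq0 (negbTE x0) andbF.
Qed.

(** On the curve a multiple of [G] is a polynomial in the first coordinate alone. This bounds the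
    valuation of [G] along a branch and also confines its zeros. *)
Lemma eliminate (G : {mpoly L[2]}) :
  (exists x y, val2 F x y = 0 /\ val2 G x y != 0) ->
  exists r : {poly L}, r != 0 /\ forall x y, x \in O -> y \in O ->
    val2 F x y = 0 -> dv (val2 G x y) (map_poly iota r).[x].
Proof.
case=> x0 [y0 [F0 G0]].
have [|r [a [b [r0 rE]]]] := irr_eliminate Firr to_poly2_size (G := to_poly2 e1 e2 G).
  move=> Q QE; move: G0; rewrite -ev2_to_poly2 QE rmorphM /= ev2_to_poly2 F0 mul0r.
  by rewrite eqxx.
exists r; split=> // x y xO yO Fxy; exists (ev2 iota x y b); first exact: (ev2_O hO).
rewrite -(ev2C iota x y) rE rmorphD !rmorphM /= !ev2_to_poly2 Fxy mulr0 add0r.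
by rewrite mulrC.
Qed.

(** Picard iterates in [{poly L}] of the equation s = - x H(x, 1, s) of the branch; every iteration
    is correct to one more power of x. *)
Fixpoint branch_poly (n : nat) : {poly L} :=
  if n is k.+1 then - ('X * mmap polyC (vec3 'X 1 (branch_poly k)) Ct) else 0.

Lemma branch_polyP n x s : x \in m -> branch x s ->
  dv (x ^+ n) (s - (map_poly iota (branch_poly n)).[x]).
Proof.
move=> xm [sm sE]; have xO := m_O xm; have sO := m_O sm.
elim: n => [|n IH].
  by exists s => //=; rewrite rmorph0 horner0 subr0 mul1r.
set b := (map_poly iota (branch_poly n)).[x] in IH *.
have bO : b \in O by apply: (horner_iota_O hO).
have -> : (map_poly iota (branch_poly n.+1)).[x] = - (x * H x 1 b).
  rewrite -[LHS]/((horner_eval x \o map_poly iota) (branch_poly n.+1)) /=.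
  rewrite rmorphN rmorphM /= map_polyX /horner_eval hornerN hornerM hornerX.
  congr (- (_ * _)).
  rewrite -[LHS]/((horner_eval x \o map_poly iota) (mmap _ _ _)) mmap_vec3.
  rewrite /= /horner_eval map_polyX hornerX rmorph1 hornerC -/b.
  by apply: mmap_eq => // c; rewrite /= map_polyC hornerC.
rewrite {1}sE opprK addrC -mulrBr exprS; apply: (dv_mul hO); first exact: (dv_refl hO).
apply: (remainder_dv hO) => //; rewrite ?(O1 hO) ?subrr //; try exact: (dv0 hO).
have -> : b - s = - (s - b) by rewrite opprB.
exact: (dvN hO).
Qed.

Lemma val2_dv a x y y' (G : {mpoly L[2]}) : x \in O -> y \in O -> y' \in O ->
  dv a (y - y') -> dv a (val2 G x y - val2 G x y').
Proof.
move=> xO yO yO' d; have linO z : z \in O -> forall i, lin e1 e2 iota x z i \in O.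
  by move=> zO i; apply: (OD hO); apply: (OM hO) => //; apply: (iota_O hO).
apply: (mmap_dv hO); [exact: linO|exact: linO|] => i.
have -> : lin e1 e2 iota x y i - lin e1 e2 iota x y' i = iota (e2 i) * (y - y').
  by rewrite /lin; ring.
by apply: (dvMl hO) => //; apply: (iota_O hO).
Qed.

(* Restricting psi to the branch, truncated beyond its order, its lowest
   coefficient vector is the centre of the lifted branch. *)
Lemma branch_center (N : nat) (psi : 'I_N -> {mpoly L[2]}) :
  (exists j x y, val2 F x y = 0 /\ val2 (psi j) x y != 0) ->
  exists zeta : 'I_N -> L, (exists j, zeta j != 0) /\
    forall x s, x \in m -> x != 0 -> branch x s ->
      exists2 c, c != 0 &
        forall j, c * val2 (psi j) x (x * s) - iota (zeta j) \in m.
Proof.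
case=> j0 /eliminate[r [r0 rE]].
pose p n j := mmap polyC (lin e1 e2 polyC 'X ('X * branch_poly n)) (psi j).
have pE n j x : (map_poly iota (p n j)).[x]
    = val2 (psi j) x (x * (map_poly iota (branch_poly n)).[x]).
  rewrite -[LHS]/((horner_eval x \o map_poly iota) (p n j)) mmap_comp.
  apply: mmap_eq => [c|i] /=; rewrite /horner_eval ?map_polyC ?hornerC //.
  by rewrite /lin rmorphD !rmorphM /= !map_polyC map_polyX !hornerE.
have dvp n j x s : x \in m -> branch x s ->
    dv (x ^+ n) (val2 (psi j) x (x * s) - (map_poly iota (p n j)).[x]).
  move=> xm sb; have xO := m_O xm; have sO := m_O sb.1; rewrite pE.
  have bO := horner_iota_O hO (branch_poly n) xO.
  apply: val2_dv => //; try exact: (OM hO).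
  by rewrite -mulrBr; apply: (dvMl hO) => //; apply: branch_polyP.
have [n [j1 [k0 [ltk0 pk0]]]] : exists n j k, (k < n)%N /\ (p n j)`_k != 0.
  (* If every truncation vanished to its order, [psi j0] would be divisible by all powers of x on
     the branch, whereas it divides the value of [r] and hence some [x ^+ e]. *)
  apply: NNPP => nex; have [x xm x0] := m_nonzero.
  have [s sb] := branch1_exists hO Ct xm; have xO := m_O xm; have sO := m_O sb.1.
  have [e xe] := poly_dv_exp hO xm r0.
  have dvxe : dv (val2 (psi j0) x (x * s)) (x ^+ e).
    apply: (dv_trans hO) xe; apply: rE => //; first exact: (OM hO).
    exact: (val_branch1 frame sb).
  have dvx : dv (x ^+ e.+1) (val2 (psi j0) x (x * s)).
    rewrite -[X in dv _ X](subrK (map_poly iota (p e.+1 j0)).[x]).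
    apply: (dvD hO); first exact: dvp.
    have -> : p e.+1 j0 = drop_poly e.+1 (p e.+1 j0) * 'X^(e.+1).
      rewrite -{1}[p e.+1 j0](poly_take_drop e.+1) -[RHS]add0r; congr (_ + _).
      apply/polyP => i; rewrite coef_take_poly coef0; case: ltnP => // lti.
      by apply/eqP; apply: contra_notT nex => ne; exists e.+1, j0, i.
    rewrite rmorphM /= map_polyXn hornerM hornerXn; apply: (dvMl hO).
      exact: (horner_iota_O hO).
    exact: (dv_refl hO).
  have [c cO E] := dv_trans hO dvx dvxe.
  have : x * c = 1.
    by apply: (@mulfI _ (x ^+ e)); rewrite ?expf_neq0 // mulr1 {2}E exprSr mulrA.
  by move/(m_unit hO xm); rewrite cO.
have [k [j2 pk] kmin] := ex_minimal id (ex_intro (fun k => exists j, (p n j)`_k != 0)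
                                  k0 (ex_intro _ j1 pk0)).
have ltk : (k < n)%N by apply: leq_ltn_trans ltk0; apply: kmin; exists j1.
exists (fun j => (p n j)`_k); split; first by exists j2.
(* [k] is the least order among all components, so dividing by [x ^+ k] leaves an integral vector
   with residue [zeta]; the truncation error keeps the factor [x ^+ (n - k)], infinitesimal as k <
   n. *)
move=> x s xm x0 sb; exists (x ^+ k)^-1; first by rewrite invr_eq0 expf_neq0.
move=> j; have [c cO E] := dvp n j x s xm sb.
have pjE : p n j = drop_poly k (p n j) * 'X^k.
  rewrite -{1}[p n j](poly_take_drop k) -[RHS]add0r; congr (_ + _).
  apply/polyP => i; rewrite coef_take_poly coef0; case: ltnP => // lti.
  apply/eqP; rewrite -[_ == _]negbK; apply/negP => ne.
  by have := kmin i (ex_intro _ j ne); rewrite leqNgt lti.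
have : val2 (psi j) x (x * s) =
    x ^+ k * ((map_poly iota (drop_poly k (p n j))).[x] + x ^+ (n - k) * c).
  rewrite -[LHS](subrK (map_poly iota (p n j)).[x]) E {1}pjE.
  rewrite rmorphM /= map_polyXn hornerM hornerXn mulrDr mulrA -exprD subnKC 1?ltnW //.
  by rewrite addrC mulrC.
move->; rewrite mulKf ?expf_neq0 // addrAC; apply: (mD hO).
  have -> : (p n j)`_k = (drop_poly k (p n j))`_0 by rewrite coef_drop_poly.
  exact: (horner_iota_residue hO).
apply: (mMr hO) => //; have : (0 < n - k)%N by rewrite subn_gt0.
by case: (n - k)%N => // i _; rewrite exprS; apply: (mMr hO) => //; apply: (OX hO); apply: m_O.
Qed.

End Branch.


(** * Meeting the translated branch *)

Arguments ev3 : simpl never.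

Lemma ev3C (L : closedFieldType) (S : comNzRingType) (j : {rmorphism L -> S}) x t y c :
  ev3 j x t y c%:P = ev2 j x t c.
Proof. by rewrite /ev3 /= map_polyC /horner_eval hornerC. Qed.

Lemma ev3X (L : closedFieldType) (S : comNzRingType) (j : {rmorphism L -> S}) x t y :
  ev3 j x t y 'X = y.
Proof. by rewrite /ev3 /= map_polyX /horner_eval hornerX. Qed.

Section PolyEval.
Variables (A S : comNzRingType) (f : {rmorphism A -> S}) (y : S).
Implicit Types P Q : {poly A}.

Lemma horner_mapD P Q :
  (map_poly f (P + Q)).[y] = (map_poly f P).[y] + (map_poly f Q).[y].
Proof. by rewrite rmorphD hornerD. Qed.

Lemma horner_mapB P Q :
  (map_poly f (P - Q)).[y] = (map_poly f P).[y] - (map_poly f Q).[y].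
Proof. by rewrite rmorphB hornerD hornerN. Qed.

Lemma horner_mapM P Q :
  (map_poly f (P * Q)).[y] = (map_poly f P).[y] * (map_poly f Q).[y].
Proof. by rewrite rmorphM hornerM. Qed.
End PolyEval.

Lemma ev3B (L : closedFieldType) (S : comNzRingType) (j : {rmorphism L -> S}) x t y
    (P Q : {poly {poly {poly L}}}) : ev3 j x t y (P - Q) = ev3 j x t y P - ev3 j x t y Q.
Proof. exact: (@horner_mapB {poly {poly L}} S (ev2 j x t) y). Qed.

Lemma ev3M (L : closedFieldType) (S : comNzRingType) (j : {rmorphism L -> S}) x t y
    (P Q : {poly {poly {poly L}}}) : ev3 j x t y (P * Q) = ev3 j x t y P * ev3 j x t y Q.
Proof. exact: (@horner_mapM {poly {poly L}} S (ev2 j x t) y). Qed.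

Lemma ev3D (L : closedFieldType) (S : comNzRingType) (j : {rmorphism L -> S}) x t y
    (P Q : {poly {poly {poly L}}}) : ev3 j x t y (P + Q) = ev3 j x t y P + ev3 j x t y Q.
Proof. exact: (@horner_mapD {poly {poly L}} S (ev2 j x t) y). Qed.

Lemma ev2E (L : closedFieldType) (S : comNzRingType) (j : {rmorphism L -> S}) x y P :
  ev2 j x y P = (map_poly (fun c => (map_poly j c).[x]) P).[y].
Proof. by []. Qed.

Lemma ev3E (L : closedFieldType) (S : comNzRingType) (j : {rmorphism L -> S}) x t y P :
  ev3 j x t y P = (map_poly (ev2 j x t) P).[y].
Proof. by []. Qed.

Lemma ev2_eq (L : closedFieldType) (S : comNzRingType) (j j' : {rmorphism L -> S}) x y P :
  j =1 j' -> ev2 j x y P = ev2 j' x y P.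
Proof.
move=> jj'; rewrite !ev2E; congr (_.[_]); apply: eq_map_poly => c.
by congr (_.[_]); apply: eq_map_poly.
Qed.

Lemma ev3_comp (L : closedFieldType) (S S' : comNzRingType) (j : {rmorphism L -> S})
    (f : {rmorphism S -> S'}) (j' : {rmorphism L -> S'}) x t y P :
  f \o j =1 j' -> f (ev3 j x t y P) = ev3 j' (f x) (f t) (f y) P.
Proof.
move=> fj; rewrite !ev3E -[LHS]horner_map -map_poly_comp; congr (_.[_]).
apply: eq_map_poly => c; rewrite -(ev2_eq _ _ c fj).
exact: (ev2_comp j f).
Qed.

Lemma map_horner0E (L : closedFieldType) (P : {poly {poly {poly L}}}) :
  map_poly (horner_eval 0) P = ev3 (polyC \o polyC) 'X%:P 0 'X P.
Proof.
rewrite ev3E -[LHS]comp_polyXr /comp_poly -map_poly_comp.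
congr (_.[_]); apply: eq_map_poly => c; rewrite ev2E.
have -> : map_poly (fun d => (map_poly (polyC \o polyC) d).['X%:P]) c = map_poly polyC c.
  apply: eq_map_poly => d; rewrite map_poly_comp -[X in X = _]/(_.['X%:P]) horner_map /=.
  by rewrite -[in RHS](comp_polyXr d) /comp_poly.
by rewrite -[X in _ = _.[X]]polyC0 horner_map.
Qed.

Section Meeting.
Variables (L K : closedFieldType) (iota : {rmorphism L -> K}) (O : {pred K}).
Hypothesis hO : specialisation_ring iota O.
Local Notation m := (max_ideal O).
Variables (F : {mpoly L[2]}) (e1 e2 : 'I_2 -> L) (Ct : {mpoly L[3]}).
Hypothesis frame : node_frame F e1 e2 Ct.
Hypothesis Firr : irreducible_poly2 (to_poly2 e1 e2 F).

Local Notation val2 P x y := (mmap iota (lin e1 e2 iota x y) P).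
Local Notation H a b c := (mmap iota (vec3 a b c) Ct).
Local Notation dv := (dv O).
Local Notation branch := (on_branch1 iota O Ct).

Lemma ev3_O x t y P : x \in O -> t \in O -> y \in O -> ev3 iota x t y P \in O.
Proof.
move=> xO tO yO; rewrite /ev3 /= /horner_eval; apply: (polyO_horner hO) => //.
by apply: (polyO_intro hO) => i; rewrite coef_map /=; apply: (ev2_O hO).
Qed.

(** Division by [t] is what makes [irr_eliminate_deform] applicable: the fibre at t = 0 becomes a
    directional derivative of [F], which is nonzero on the branch because [v] is nonzero. *)
Lemma shift_eliminate (u v : L) : v != 0 ->
  exists r : {poly {poly L}}, r != 0 /\ forall x t y, x \in O -> t \in O -> y \in O ->
    t != 0 -> val2 F x y = 0 ->
    dv (val2 F (x - t * iota u) (y - t * iota v) / t) (ev2 iota x t r).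
Proof.
move=> v0; pose jj := (polyC \o (polyC \o polyC) : {rmorphism L -> {poly {poly {poly L}}}}).
pose X := 'X%:P%:P : {poly {poly {poly L}}}.
pose T := 'X%:P : {poly {poly {poly L}}}.
pose Y := 'X : {poly {poly {poly L}}}.
pose Fs : {poly {poly {poly L}}} := mmap jj (lin e1 e2 jj (X - T * jj u) (Y - T * jj v)) F.
pose Fl : {poly {poly {poly L}}} := map_poly polyC (to_poly2 e1 e2 F).
have jE (S : comNzRingType) (j : {rmorphism L -> S}) x t y c : ev3 j x t y (jj c) = j c.
  by rewrite /jj /= ev3C ev2C map_polyC hornerC.
have XE (S : comNzRingType) (j : {rmorphism L -> S}) x t y : ev3 j x t y X = x.
  by rewrite /X /= ev3C ev2C map_polyX hornerX.
have TE (S : comNzRingType) (j : {rmorphism L -> S}) x t y : ev3 j x t y T = t.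
  by rewrite /T /= ev3C ev2X.
have FsE (S : comNzRingType) (j : {rmorphism L -> S}) x t y :
    ev3 j x t y Fs = mmap j (lin e1 e2 j (x - t * j u) (y - t * j v)) F.
  rewrite /Fs; set w := lin _ _ _ _ _.
  transitivity (mmap (ev3 j x t y \o jj) (ev3 j x t y \o w) F).
    exact: (mmap_comp jj (ev3 j x t y : {rmorphism _ -> _})).
  apply: mmap_eq => [c|i]; first exact: jE.
  rewrite -[LHS]/(ev3 j x t y (jj (e1 i) * (X - T * jj u) + jj (e2 i) * (Y - T * jj v))).
  by rewrite ev3D !ev3M !ev3B !ev3M !jE XE TE ev3X.
have FlE (S : comNzRingType) (j : {rmorphism L -> S}) x t y :
    ev3 j x t y Fl = mmap j (lin e1 e2 j x y) F.
  rewrite -ev2_to_poly2 ev3E ev2E /Fl -map_poly_comp.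
  by congr (_.[_]); apply: eq_map_poly => c; apply: ev2C.
have DE (S : comNzRingType) (j : {rmorphism L -> S}) x t y : ev3 j x t y (Fs - Fl)
    = mmap j (lin e1 e2 j (x - t * j u) (y - t * j v)) F - mmap j (lin e1 e2 j x y) F.
  by rewrite -FsE -(FlE S j x t y) ev3B.
have e0 : map_poly (horner_eval 0) (Fs - Fl) = 0.
  rewrite map_horner0E DE; apply/eqP; rewrite subr_eq0; apply/eqP.
  by apply: mmap_eq => // i; rewrite !mul0r !subr0.
(* G is the difference quotient (F(q - t w) - F(q)) / t; its fibre at t = 0 is
   minus the derivative of F along w. *)
have [G GE] := map_horner0_factor e0.
have TG (S : comNzRingType) (j : {rmorphism L -> S}) x t y :
    t * ev3 j x t y G = mmap j (lin e1 e2 j (x - t * j u) (y - t * j v)) F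
                       - mmap j (lin e1 e2 j x y) F.
  by rewrite -DE GE ev3M /= polyC0 subr0 -/T TE.
have [|r [a [b [r0 rE]]]] := irr_eliminate_deform Firr (to_poly2_size hO frame Firr) (G := G).
  move=> Q QE; have [x xm x0] := m_nonzero hO; have [s sb] := branch1_exists hO Ct xm.
  have [c cm dE] := dF_branch1 hO frame xm x0 sb (O0 hO) (O1 hO).
  have [c' cm' dE'] := dF_branch1 hO frame xm x0 sb (O1 hO) (O0 hO).
  (* The constant term of [g], a polynomial in t, is computed twice: it is 0 by divisibility by [F],
     and it is the derivative of [F] along -(u, v), which is x times a unit by [dF_branch1]. *)
  pose g := ev3 (polyC \o iota) x%:P 'X (x * s)%:P G.
  have g0 : g`_0 = 0.
    have fj : horner_eval 0 \o (polyC \o iota) =1 iota.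
      by move=> d; rewrite /= /horner_eval hornerC.
    have fj' : ev2 iota x (x * s) \o (polyC \o polyC) =1 iota.
      by move=> d; rewrite /= ev2C map_polyC hornerC.
    rewrite -horner_coef0 -[LHS]/(horner_eval 0 g) (ev3_comp _ _ _ _ fj).
    rewrite /= /horner_eval !hornerC hornerX.
    have := ev3_comp 'X%:P 0 'X G fj'.
    rewrite -map_horner0E QE rmorphM /= ev2_to_poly2 (val_branch1 frame sb) mul0r.
    by rewrite ev2C ev2X map_polyX hornerX rmorph0 => <-.
  have : g`_0 = dF iota F e1 e2 x (x * s) (- iota u) (- iota v).
    have -> : g`_0 = ('X * g)`_1 by rewrite coefXM.
    rewrite -dF_coef1 (TG _ (polyC \o iota)) coefB.
    have -> : mmap (polyC \o iota) (lin e1 e2 (polyC \o iota) x%:P (x * s)%:P) F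
              = (val2 F x (x * s))%:P.
      rewrite mmap_comp; apply: mmap_eq => // i.
      by rewrite /lin /= polyCD !polyCM.
    rewrite coefC subr0; congr ((polyseq _)`_1); apply: mmap_eq => // i.
    by rewrite /lin /= -!mul_polyC !polyCN; ring.
  rewrite g0 dF_lin dE dE' => /esym e.
  have : iota v + (iota u * c' + iota v * c) \notin m.
    apply: (unitDm hO); first exact: (iota_unit hO).
    by apply: (mD hO); apply: (mM hO) => //; apply: (iota_O hO).
  case/(notin_m hO) => /eqP[]; apply: (mulfI x0); rewrite mulr0 -[RHS]oppr0 -[X in - X]e.
  by ring.
exists r; split=> // x t y xO tO yO t0 Fxy.
exists (ev3 iota x t y b); first exact: ev3_O.
have := congr1 (ev3 iota x t y) rE.
rewrite ev3D !ev3M ev3C FlE Fxy mulr0 add0r => ->.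
have := TG _ iota x t y; rewrite Fxy subr0 => <-.
by rewrite [t * _]mulrC mulfK // mulrC.
Qed.

(** The second-order error of the tangent to s is what makes the later Newton step quadratic. *)
Lemma branch1_tangent x s : x \in m -> branch x s ->
  exists2 la, la \in O & forall h s', h \in m -> branch (x + h) s' ->
    dv (h ^+ 2) (s' - (s + la * h)).
Proof.
move=> xm [sm sE]; have xO := m_O xm; have sO := m_O sm; have O1 := O1 hO.
pose v := vec3 x 1 s.
have vO : forall i, v i \in O by apply: vec3_in.
pose D1 := mmap iota v Ct^`M(0); pose D3 := mmap iota v Ct^`M(2%:R).
have D1O : D1 \in O by apply: (mmap_O hO).
have D3O : D3 \in O by apply: (mmap_O hO).
have : 1 + x * D3 \notin m.
  by apply: (unitDm hO); [exact: (one_notin_m hO)|exact: (mMr hO)].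
case/(notin_m hO) => u0 uV.
have HO : H x 1 s \in O by apply: (remainder_O hO).
(* The derivative of s obtained by differentiating s + x H(x, 1, s) = 0 implicitly. *)
pose la := - (H x 1 s + x * D1) * (1 + x * D3)^-1.
have laO : la \in O.
  apply: (OM hO) => //; apply: (ON hO); apply: (OD hO) => //; exact: (OM hO).
exists la => // h s' hm [sm' sE']; have hO' := m_O hm; have sO' := m_O sm'.
pose w := vec3 1 0 la.
pose V i := (v i)%:P + w i *: 'X.
pose C := mmap (polyC \o iota) V Ct.
have VO i : V i \is a polyOver O.
  apply: (polyO_D hO); first exact: (polyO_C hO).
  apply: (polyO_Z hO); last exact: (polyO_X hO).
  by apply: vec3_in => //; apply: (O0 hO).
have CO : C \is a polyOver O by apply: (mmap_polyO hO).
have CE z : C.[z] = H (x + z) 1 (s + la * z).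
  rewrite -[C.[z]]/(horner_eval z C) mmap_comp; apply: mmap_eq => [c|i] /=.
    by rewrite /horner_eval hornerC.
  rewrite /horner_eval /V hornerD hornerC hornerZ hornerX /v /w /vec3.
  by case: i => [[|[|[|]]]] //= _; rewrite ?mul1r ?mul0r ?addr0.
have C1 : C`_1 = D1 + la * D3.
  rewrite /C mmap_coef1 !big_ord_recl big_ord0 /w /vec3 /= mul1r mul0r add0r addr0.
  by congr (_ + _ * mmap _ _ _^`M(_)); apply/val_inj.
have C0 : C`_0 = H x 1 s by rewrite -horner_coef0 CE mulr0 !addr0.
(* The defect of the linear approximation in the branch equation. The choice of [la] kills its
   linear coefficient, so its value at [h] is divisible by [h ^+ 2]. *)
pose E := (s%:P + la *: 'X) + (x%:P + 'X) * C.
have EO : E \is a polyOver O.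
  apply: (polyO_D hO).
    apply: (polyO_D hO); first exact: (polyO_C hO).
    by apply: (polyO_Z hO) => //; apply: (polyO_X hO).
  apply: (polyO_M hO) => //; apply: (polyO_D hO); first exact: (polyO_C hO).
  exact: (polyO_X hO).
have E0 : E`_0 = 0.
  by rewrite -horner_coef0 /E !hornerE CE mulr0 !addr0 {1}sE addNr.
have E1 : E`_1 = 0.
  rewrite /E mulrDl !coefD coefCM coefXM coefZ coefX !coefC /= add0r mulr1 C1 C0.
  by rewrite /la; field.
have [c cO] := horner_split2 hO EO hO'; rewrite E0 E1 mul0r !add0r.
rewrite /E !hornerE CE; set sg := s + la * h => Eh.
have sgO : sg \in O by apply: (OD hO) => //; apply: (OM hO).
have xhm : x + h \in m by apply: (mD hO).
have [d dO dE] : dv (s' - sg) (H (x + h) 1 s' - H (x + h) 1 sg).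
  apply: (remainder_dv hO) => //; try exact: m_O; rewrite ?subrr;
    first [exact: (dv0 hO)|exact: (dv_refl hO)].
have : 1 + (x + h) * d \notin m.
  by apply: (unitDm hO); [exact: (one_notin_m hO)|exact: (mMr hO)].
case/(notin_m hO) => w0 wV; exists (- c * (1 + (x + h) * d)^-1).
  by apply: (OM hO) => //; apply: (ON hO).
rewrite mulrA mulrN -Eh; apply: (mulIf w0); rewrite mulfVK //.
rewrite mulrDr mulr1 mulrCA -dE {1}sE'; by ring.
Qed.

Lemma branch_function : exists g : K -> K, forall x, x \in m -> branch x (g x).
Proof.
have ex x : exists s, (x \in m) ==> ((s \in m) && (s == - (x * H x 1 s))).
  have [xm|_] := boolP (x \in m); last by exists 0.
  by have [s [sm /eqP sE]] := branch1_exists hO Ct xm; exists s; rewrite sm sE.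
exists (fun x => xchoose (ex x)) => x xm.
by have /implyP/(_ xm)/andP[sm /eqP] := xchooseP (ex x).
Qed.

Lemma branches_meet_shift t (u v : L) : t \in m -> t != 0 -> u != 0 -> v != 0 ->
  exists x s r, [/\ x \in m /\ x != 0, branch x s, r \in m,
    x - t * iota u = (x * s - t * iota v) * r
    & x * s - t * iota v != 0 /\ val2 F (x - t * iota u) (x * s - t * iota v) = 0].
Proof.
move=> tm t0 u0 v0; have tO := m_O tm; have O1 := O1 hO.
set U := iota u; set V := iota v.
have UO : U \in O := iota_O hO u.
have VO : V \in O := iota_O hO v.
have Uu : U \notin m := iota_unit hO u0.
have Vu : V \notin m := iota_unit hO v0.
have [g gP] := branch_function.
(* With first coordinate t (U + xi), the shifted point is t times (xi, [Y xi]), and [f] is the value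
   of [F] there divided by [t ^+ 2]. As [Y xi] reduces to -V, a unit, the term [xi * Y xi] makes [f]
   an isometry. *)
pose X xi := t * (U + xi); pose Y xi := (U + xi) * g (X xi) - V.
pose f xi := xi * Y xi + t * H t xi (Y xi).
have Xm xi : xi \in m -> X xi \in m.
  by move=> xim; apply: (mMr hO) => //; apply: (OD hO) => //; apply: m_O.
have gm xi : xi \in m -> g (X xi) \in m by move=> xim; apply: (gP _ (Xm _ xim)).1.
have UxO xi : xi \in m -> U + xi \in O by move=> xim; apply: (OD hO) => //; apply: m_O.
have YO xi : xi \in m -> Y xi \in O.
  move=> xim; apply: (OB hO) => //; apply: (OM hO); first exact: UxO.
  by apply: m_O; apply: gm.
have fE xi : val2 F (X xi - t * U) (X xi * g (X xi) - t * V) = t ^+ 2 * f xi.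
  rewrite /f -(val_scale iota frame); congr (mmap _ (lin _ _ _ _ _) _); rewrite /X /Y; ring.
have dX xi xi' : X xi - X xi' = t * (xi - xi') by rewrite /X; ring.
have dY xi xi' : xi \in m -> xi' \in m ->
    exists2 mu, mu \in m & Y xi - Y xi' = (xi - xi') * mu.
  move=> xim xim'.
  have [c cO cE] := branch1_diff hO (Xm _ xim) (Xm _ xim') (gP _ (Xm _ xim)) (gP _ (Xm _ xim')).
  exists ((U + xi) * (t * c) + g (X xi')).
    by apply: (mD hO); [apply: (mM hO); [exact: UxO|exact: (mMr hO)]|exact: gm].
  have -> : Y xi - Y xi' = (U + xi) * (g (X xi) - g (X xi')) + (xi - xi') * g (X xi').
    by rewrite /Y; ring.
  by rewrite cE dX; ring.
have f_iso xi xi' : xi \in m -> xi' \in m ->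
    exists k, [/\ k \in O, k \notin m & f xi - f xi' = k * (xi - xi')].
  move=> xim xim'; have [mu mum muE] := dY xi xi' xim xim'.
  have [c cO cE] : dv (xi - xi') (H t xi (Y xi) - H t xi' (Y xi')).
    apply: (remainder_dv hO) => //; try exact: m_O; try exact: YO; rewrite ?subrr ?muE.
    - exact: (dv0 hO).
    - exact: (dv_refl hO).
    by exists mu => //; apply: m_O.
  pose M := (U + xi) * g (X xi) + xi' * mu + t * c.
  have Mm : M \in m.
    apply: (mD hO); last exact: (mMr hO).
    by apply: (mD hO); [apply: (mM hO); [exact: UxO|exact: gm]|apply: (mMr hO) => //; apply: m_O].
  exists (- V + M); split.
  - by apply: (OD hO); [exact: (ON hO)|exact: m_O].
  - by apply: (unitDm hO) => //; apply: (unitN hO).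
  have -> : f xi - f xi' = (xi - xi') * Y xi + xi' * (Y xi - Y xi')
      + t * (H t xi (Y xi) - H t xi' (Y xi')) by rewrite /f; ring.
  by rewrite muE cE /M /Y; ring.
have fm xi : xi \in m -> f xi \in m.
  move=> xim; apply: (mD hO); first by apply: (mMr hO) => //; apply: YO.
  by apply: (mMr hO) => //; apply: (remainder_O hO) => //; [apply: m_O|apply: YO].
(* [g] is not a polynomial, so Hensel's lemma is applied to [Q], where [g] is replaced by its
   tangent at [X xi]. The root [th] is divisible by [f xi], and the replacement costs a multiple of
   [th ^+ 2]. *)
have newton xi : xi \in m -> exists2 xi', xi' \in m & dv (f xi ^+ 2) (f xi').
  move=> xim; have xiO := m_O xim; set s := g (X xi).
  have sm : s \in m by apply: gm. have sO := m_O sm.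
  have [la laO laP] := branch1_tangent (Xm _ xim) (gP _ (Xm _ xim)).
  pose q := ((U + xi)%:P + 'X) * (s%:P + (la * t) *: 'X) - V%:P.
  have linO a b : a \in O -> b \in O -> a%:P + b *: 'X \is a polyOver O.
    move=> aO bO; apply: (polyO_D hO); first exact: (polyO_C hO).
    by apply: (polyO_Z hO) => //; apply: (polyO_X hO).
  have linO1 a : a \in O -> a%:P + 'X \is a polyOver O.
    by move=> aO; rewrite -['X]scale1r; apply: linO.
  have qO : q \is a polyOver O.
    rewrite /q -polyCN; apply: (polyO_D hO); last by apply: (polyO_C hO); apply: (ON hO).
    by apply: (polyO_M hO); [apply: linO1; apply: UxO|apply: linO => //; apply: (OM hO)].
  pose C := mmap (polyC \o iota) (vec3 t%:P (xi%:P + 'X) q) Ct.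
  have CO : C \is a polyOver O.
    by apply: (mmap_polyO hO); apply: vec3_in => //; [exact: (polyO_C hO)|exact: linO1].
  have CE z : C.[z] = H t (xi + z) q.[z].
    rewrite -[C.[z]]/(horner_eval z C) mmap_vec3 /= /horner_eval hornerC hornerD hornerC hornerX.
    by apply: mmap_eq => // c; rewrite /= hornerC.
  pose Q := (xi%:P + 'X) * q + t%:P * C.
  have QE z : Q.[z] = (xi + z) * q.[z] + t * H t (xi + z) q.[z].
    have E (p c : {poly K}) : ((xi%:P + 'X) * p + t%:P * c).[z]
        = (xi + z) * p.[z] + t * c.[z].
      by rewrite hornerD !hornerM hornerD !hornerC hornerX.
    by rewrite -CE E.
  have QO : Q \is a polyOver O.
    apply: (polyO_D hO); apply: (polyO_M hO) => //; [exact: linO1|exact: (polyO_C hO)].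
  have qE z : q.[z] = (U + (xi + z)) * (s + la * (t * z)) - V.
    by rewrite /q hornerD hornerN hornerM hornerD [(s%:P + _).[_]]hornerD hornerZ !hornerX !hornerC; ring.
  have Q0 : Q`_0 = f xi.
    rewrite -horner_coef0 QE qE !addr0 !mulr0 addr0.
    by rewrite /f /Y.
  have Q1 : Q`_1 \notin m.
    have -> : Q`_1 = - V + ((U + xi) * s + xi * q`_1 + t * C`_1).
      rewrite /Q coefD coefCM mulrDl coefD coefCM coefXM /=.
      rewrite -[q`_0]horner_coef0 qE !addr0 !mulr0 addr0.
      by ring.
    apply: (unitDm hO); first exact: (unitN hO).
    apply: (mD hO); last by apply: (mMr hO) => //; apply: (polyO_coef hO).
    apply: (mD hO); first by apply: (mM hO) => //; apply: UxO.
    by apply: (mMr hO) => //; apply: (polyO_coef hO).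
  have Q0m : Q`_0 \in m by rewrite Q0; apply: fm.
  have [th [thm Qth dth]] := hensel_simple hO QO Q0m Q1.
  have xim' : xi + th \in m by apply: (mD hO).
  exists (xi + th) => //; set xi1 := xi + th in xim' *.
  have X1 : X xi1 = X xi + t * th by rewrite /X /xi1; ring.
  have tthm : t * th \in m by apply: (mM hO).
  have ds := laP (t * th) (g (X xi1)) tthm; rewrite -X1 in ds.
  have {ds} ds := ds (gP _ (Xm _ xim')).
  have ds' : dv (th ^+ 2) (g (X xi1) - (s + la * (t * th))).
    apply: (dv_trans hO) ds; rewrite exprMn; apply: (dvMl hO); first exact: (OX hO).
    exact: (dv_refl hO).
  have dYq : dv (th ^+ 2) (Y xi1 - q.[th]).
    have -> : Y xi1 - q.[th] = (U + xi1) * (g (X xi1) - (s + la * (t * th))).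
      by rewrite qE /Y /xi1; ring.
    by apply: (dvMl hO) => //; apply: UxO.
  apply: (dv_trans hO) (_ : dv (th ^+ 2) _); first by rewrite -Q0; apply: (dvX hO).
  have -> : f xi1 = xi1 * (Y xi1 - q.[th]) + t * (H t xi1 (Y xi1) - H t xi1 q.[th]).
    have e0 : xi1 * q.[th] + t * H t xi1 q.[th] = 0.
      by rewrite -[RHS]Qth QE.
    by rewrite /f -[LHS]subr0 -e0; ring.
  apply: (dvD hO); first by apply: (dvMl hO) => //; apply: m_O.
  apply: (dvMl hO) => //; apply: (remainder_dv hO) => //; try exact: m_O; try exact: YO.
  - by apply: (polyO_horner hO) => //; apply: m_O.
  - by rewrite subrr; apply: (dv0 hO).
  - by rewrite subrr; apply: (dv0 hO).
have [r [r0 rP]] := shift_eliminate u v0.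
(* The polynomial for [isometry_root] is r(t (U + xi), t), viewed in xi. Its leading coefficient is
   a nonzero polynomial over [L] evaluated at [t], times [t] to the degree of [p]; hence the
   exponent [e + (size p).-1]. *)
pose ev := horner_eval t \o map_poly iota : {rmorphism {poly L} -> K}.
pose R := swapXY r.
have lR : lead_coef R != 0 by rewrite lead_coef_eq0 swapXY_eq0.
have [e le] := poly_dv_exp hO tm lR.
have evR : ev (lead_coef R) != 0.
  case: le => c _ /eqP; apply: contraTneq => e0.
  by rewrite -[_.[t]]/(ev (lead_coef R)) e0 mul0r expf_neq0.
pose p := map_poly ev R; pose l := t *: 'X + (t * U)%:P : {poly K}.
have lp : lead_coef p = ev (lead_coef R) by rewrite lead_coef_map_id0 ?rmorph0.
have sl : size l = 2%N.
  by rewrite /l size_addl size_scale ?size_polyX // size_polyC; case: (_ == _).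
have ll : lead_coef l = t.
  by rewrite lead_coefE sl /l coefD coefZ coefX coefC mulr1 addr0.
have lP : lead_coef (p \Po l) = ev (lead_coef R) * t ^+ (size p).-1.
  by rewrite lead_coef_comp ?sl // lp ll.
have [| | | |xi xim f0] := @isometry_root _ _ _ _ hO f (p \Po l) t (e + (size p).-1) tm f_iso newton.
- by rewrite -lead_coef_eq0 lP mulf_neq0 ?expf_neq0.
- move=> xi xim; have Xim := Xm _ xim.
  have -> : (p \Po l).[xi] = ev2 iota (X xi) t r.
    rewrite horner_comp /l hornerD hornerZ hornerX hornerC ev2_swap ev2E.
    by congr (_.[_]); rewrite /X; ring.
  apply: (dv_trans hO) (rP (X xi) t (X xi * g (X xi)) _ _ _ _ _) => //.
  + rewrite fE expr2 -mulrA mulrC mulKf //; apply: (dvMl hO) => //.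
    exact: (dv_refl hO).
  + exact: m_O.
  + by apply: (OM hO); apply: m_O => //; apply: gm.
  + exact: (val_branch1 frame (gP _ Xim)).
- rewrite lP exprD; apply: (dv_mul hO) => //; exact: (dv_refl hO).
- rewrite /f mul0r add0r; apply: (dvMr hO); last exact: (dv_refl hO).
  by apply: (remainder_O hO) => //; [exact: (O0 hO)|apply: YO; apply: (m0 hO)].
have Yu : Y xi \notin m.
  rewrite /Y addrC; apply: (unitDm hO); first exact: (unitN hO).
  by apply: (mM hO); [exact: UxO|exact: gm].
have [Y0 YV] := notin_m hO Yu.
have YE : X xi * g (X xi) - t * V = t * Y xi by rewrite /X /Y; ring.
exists (X xi), (g (X xi)), (xi * (Y xi)^-1); split.
- split; first exact: Xm; apply: mulf_neq0 => //.
  by have [] := notin_m hO (unitDm hO Uu xim).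
- exact: gP (Xm _ xim).
- exact: (mMr hO).
- by rewrite YE [xi * _]mulrC mulrA mulfK // /X; ring.
- by rewrite fE f0 mulr0 YE mulf_neq0.
Qed.

End Meeting.


(** * Bases adapted to the two tangents of a node *)

Lemma mmap1_scale (n : nat) (S : comNzRingType) (c : S) (v : 'I_n -> S)
    (m : 'X_{1..n}) : mmap1 (fun i => c * v i) m = c ^+ mdeg m * mmap1 v m.
Proof.
rewrite /mmap1 mdegE -prodrXr -big_split; apply: eq_bigr => i _.
by rewrite exprMn.
Qed.

Lemma mmapCX (n : nat) (R S : comNzRingType) (j : {rmorphism R -> S})
    (v : 'I_n -> S) c m : mmap j v (c *: 'X_[m]) = j c * mmap1 v m.
Proof. by rewrite -mul_mpolyC rmorphM /= mmapC mmapX. Qed.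

Lemma mmap_homog (n d : nat) (R S : comNzRingType) (j : {rmorphism R -> S}) (c : S)
    (v : 'I_n -> S) (P : {mpoly R[n]}) : P \is d.-homog ->
  mmap j (fun i => c * v i) P = c ^+ d * mmap j v P.
Proof.
move/dhomogP => hP; rewrite /mmap mulr_sumr; apply: eq_big_seq => m /hP <-.
by rewrite mmap1_scale mulrCA.
Qed.

Lemma ord2P (i : 'I_2) : i = 0 \/ i = 1.
Proof. by case: i => [[|[|//]] ?]; [left|right]; apply/val_inj. Qed.

Section NodeFrame.
Variables (L : closedFieldType) (F : {mpoly L[2]}) (e1 e2 : 'I_2 -> L).
Hypothesis F0 : pihomog mdeg 0 F = 0.
Hypothesis F1 : pihomog mdeg 1 F = 0.
Hypothesis F2 : forall (S : comNzRingType) (j : {rmorphism L -> S}) (a b : S),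
  mmap j (lin e1 e2 j a b) (pihomog mdeg 2 F) = a * b.

Lemma node_frame_exists : exists Ct, node_frame F e1 e2 Ct.
Proof.
pose h := lin e1 e2 (@mpolyC 3 L) 'X_1 'X_2%:R.
(* A monomial of degree d >= 3 scales by t^d; the identity already displays t^2 and one further t,
   which leaves the exponent d - 3. *)
exists (\sum_(m <- msupp F | (2 < mdeg m)%N)
  mpolyC 3 F@_m * ('X_0 ^+ (mdeg m - 3) * mmap1 h m)).
move=> S j t a b; set v := lin e1 e2 j a b.
have lE : lin e1 e2 j (t * a) (t * b) =1 (fun i => t * v i).
  by move=> i; rewrite /lin /v /lin; ring.
rewrite (mmap_eq _ (fun=> erefl) lE) {lE}.
pose G m := j F@_m * (t ^+ mdeg m * mmap1 v m).
have -> : mmap j (fun i => t * v i) F = \sum_(m <- msupp F) G m.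
  by apply: eq_bigr => m _; rewrite mmap1_scale.
have deg d : \sum_(m <- msupp F | mdeg m == d) G m
             = t ^+ d * mmap j v (pihomog mdeg d F).
  rewrite pihomogE raddf_sum mulr_sumr; apply: eq_bigr => m /eqP md /=.
  by rewrite mmapCX /G md mulrCA.
have big : \sum_(m <- msupp F | (2 < mdeg m)%N) G m = t ^+ 2 * (t *
    mmap j (vec3 t a b) (\sum_(m <- msupp F | (2 < mdeg m)%N)
      mpolyC 3 F@_m * ('X_0 ^+ (mdeg m - 3) * mmap1 h m))).
  rewrite raddf_sum mulrA -exprSr mulr_sumr; apply: eq_bigr => m lt /=.
  rewrite !rmorphM /= rmorphXn /= mmapC mmapX mmap1U /G.
  have -> : mmap j (vec3 t a b) (mmap1 h m) = mmap1 v m.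
    rewrite /mmap1 rmorph_prod; apply: eq_bigr => i _.
    rewrite rmorphXn /= /h /lin rmorphD !rmorphM /= !mmapC !mmapX !mmap1U.
    by [].
  rewrite -{1}(subnKC lt) exprD /=; rewrite /vec3 /=; by ring.
rewrite (bigID (fun m => mdeg m == 0%N)) /= deg F0 raddf0 mulr0 add0r.
rewrite (bigID (fun m => mdeg m == 1%N)) /=.
have -> : \sum_(m <- msupp F | (mdeg m != 0) && (mdeg m == 1%N)) G m = 0.
  transitivity (\sum_(m <- msupp F | mdeg m == 1%N) G m).
    by apply: eq_bigl => m; case: eqP => // ->.
  by rewrite deg F1 raddf0 mulr0.
rewrite add0r (bigID (fun m => mdeg m == 2%N)) /= mulrDr -big -(F2 j a b) -/v -deg.
congr (_ + _); apply: eq_bigl => m.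
  by case: (mdeg m) => [|[|[|]]].
by case: (mdeg m) => [|[|[|]]].
Qed.
End NodeFrame.

Lemma node_frames (L : closedFieldType) (F : {mpoly L[2]}) : ordinary_double_point F ->
  exists e1 e2 C1 C2, [/\ e1 0 * e2 1 - e1 1 * e2 0 != 0,
    node_frame F e1 e2 C1 & node_frame F e2 e1 C2].
Proof.
case=> _ [F0 F1] F2n [a [b [c [d [F2 npeq]]]]].
pose D := a * d - b * c.
have D0 : D != 0.
  apply/eqP => D0; apply: npeq.
  have E : a * d = b * c by apply/eqP; rewrite -subr_eq0; apply/eqP.
  have ab : (a != 0) || (b != 0).
    apply: contraNT F2n; rewrite negb_or !negbK => /andP[/eqP a0 /eqP b0].
    by rewrite F2 a0 b0 !scale0r addr0 mul0r.
  have cd : (c != 0) || (d != 0).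
    apply: contraNT F2n; rewrite negb_or !negbK => /andP[/eqP a0 /eqP b0].
    by rewrite F2 a0 b0 !scale0r addr0 mulr0.
  have [a0|a0] := eqVneq a 0.
    have b0 : b != 0 by move: ab; rewrite a0 eqxx.
    have c0 : c = 0.
      by apply/eqP; move/eqP: E; rewrite a0 mul0r eq_sym mulf_eq0 (negbTE b0).
    have d0 : d != 0 by move: cd; rewrite c0 eqxx.
    exists (d / b); first by rewrite mulf_neq0 ?invr_eq0.
    apply/rowP => i; rewrite !mxE a0 c0.
    by case: i => [[|[|[|]]]] //= _; rewrite ?mulr0 ?divfK.
  have c0 : c != 0.
    apply: contraTneq cd => c0; rewrite c0 eqxx negbK.
    by move/eqP: E; rewrite c0 mulr0 mulf_eq0 (negbTE a0).
  exists (c / a); first by rewrite mulf_neq0 ?invr_eq0.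
  apply/rowP => i; rewrite !mxE.
  case: i => [[|[|[|]]]] //= _; rewrite ?mulr0 ?divfK //.
  by apply: (mulfI a0); rewrite E; field.
(* The basis dual to the forms cX + dY and aX + bY: [e1] spans aX + bY = 0 and [e2] spans cX + dY =
   0. *)
pose e1 := (fun i => if i == 0 then - b / D else a / D) : 'I_2 -> L.
pose e2 := (fun i => if i == 0 then d / D else - c / D) : 'I_2 -> L.
have val (S : comNzRingType) (j : {rmorphism L -> S}) w :
    mmap j w (pihomog mdeg 2 F) = (j a * w 0 + j b * w 1) * (j c * w 0 + j d * w 1).
  by rewrite F2 rmorphM !raddfD /= !mmapCX !mmap1U.
have l1 (S : comNzRingType) (j : {rmorphism L -> S}) x y :
    j a * lin e1 e2 j x y 0 + j b * lin e1 e2 j x y 1 = y.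
  have -> : j a * lin e1 e2 j x y 0 + j b * lin e1 e2 j x y 1 =
      j (a * (- b / D) + b * (a / D)) * x + j (a * (d / D) + b * (- c / D)) * y.
    by rewrite /lin /= !rmorphD !rmorphM; ring.
  have -> : a * (- b / D) + b * (a / D) = 0 by ring.
  have -> : a * (d / D) + b * (- c / D) = 1 by rewrite /D; field.
  by rewrite rmorph0 rmorph1 mul0r add0r mul1r.
have l2 (S : comNzRingType) (j : {rmorphism L -> S}) x y :
    j c * lin e1 e2 j x y 0 + j d * lin e1 e2 j x y 1 = x.
  have -> : j c * lin e1 e2 j x y 0 + j d * lin e1 e2 j x y 1 =
      j (c * (- b / D) + d * (a / D)) * x + j (c * (d / D) + d * (- c / D)) * y.
    by rewrite /lin /= !rmorphD !rmorphM; ring.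
  have -> : c * (- b / D) + d * (a / D) = 1 by rewrite /D; field.
  have -> : c * (d / D) + d * (- c / D) = 0 by ring.
  by rewrite rmorph0 rmorph1 mul0r addr0 mul1r.
have linC (S : comNzRingType) (j : {rmorphism L -> S}) x y : lin e2 e1 j x y =1 lin e1 e2 j y x.
  by move=> i; rewrite /lin addrC.
have [|C1 f1] := @node_frame_exists L F e1 e2 F0 F1.
  by move=> S j x y; rewrite val l1 l2 mulrC.
have [|C2 f2] := @node_frame_exists L F e2 e1 F0 F1.
  by move=> S j x y; rewrite (mmap_eq _ (fun=> erefl) (linC S j x y)) val l1 l2.
exists e1, e2, C1, C2; split=> //; rewrite /e1 /e2 /=.
have -> : - b / D * (- c / D) - a / D * (d / D) = - D^-1.
  by rewrite /D; field.
by rewrite oppr_eq0 invr_eq0.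
Qed.


(** * Projective points and lines *)

Section ProjectiveEquality.
Variables (R : fieldType) (n : nat).
Implicit Types x y z : 'rV[R]_n.

Lemma peq_refl x : peq x x.
Proof. by exists 1; rewrite ?oner_eq0 ?scale1r. Qed.

Lemma peq_sym x y : peq x y -> peq y x.
Proof.
case=> c c0 ->; exists c^-1; first by rewrite invr_eq0.
by rewrite scalerA mulVf // scale1r.
Qed.

Lemma peq_trans y x z : peq x y -> peq y z -> peq x z.
Proof.
case=> c c0 -> [d d0 ->]; exists (d * c); first by rewrite mulf_neq0.
by rewrite scalerA.
Qed.

Lemma peq_minor x y i j : peq x y -> x 0 i * y 0 j = x 0 j * y 0 i.
Proof. by case=> c _ ->; rewrite !mxE; ring. Qed.

Lemma row_neq0 x : x != 0 -> exists i, x 0 i != 0.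
Proof.
move=> x0; apply: NNPP => nex; case/eqP: x0; apply/rowP => i.
by rewrite mxE; apply/eqP; apply: contra_notT nex => h; exists i.
Qed.

Lemma neq0_row x i : x 0 i != 0 -> x != 0.
Proof. by apply: contra_neq => ->; rewrite mxE. Qed.

Lemma minor_peq x y : x != 0 -> y != 0 ->
  (forall i j, x 0 i * y 0 j = x 0 j * y 0 i) -> peq x y.
Proof.
case/row_neq0 => i xi y0 mn; have [j yj] := row_neq0 y0.
have yi : y 0 i != 0.
  by apply: contraNneq xi => yi; have := mn j i; rewrite yi mulr0 => /esym/eqP;
     rewrite mulf_eq0 (negbTE yj) orbF.
exists (y 0 i / x 0 i); first by rewrite mulf_neq0 ?invr_eq0.
by apply/rowP => k; rewrite mxE mulrAC [y 0 i * _]mulrC (mn k i) mulrAC mulfV // mul1r.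
Qed.

Lemma peq_neq0 x y : peq x y -> x != 0 -> y != 0.
Proof. by case=> c c0 -> x0; rewrite scaler_eq0 negb_or c0. Qed.

Lemma proj_card_cover (S : 'rV[R]_n -> Prop) (s : seq 'rV[R]_n) :
  (forall y, S y -> exists2 x, x \in s & peq x y) -> exists k, proj_card S k.
Proof.
move=> cover; pose T (s' : seq 'rV[R]_n) y := S y /\ exists2 x, x \in s' & peq x y.
have [k [x [xS xinj xcov]]] : exists k, proj_card (T s) k.
  elim: s {cover} => [|a s [k [x [xS xinj xcov]]]].
    exists 0%N, (fun=> 0); split=> [[]|[]|y [_ []]] //.
  case: (classic (exists y, S y /\ peq a y /\ forall i, ~ peq (x i) y)); last first.
    move=> nex; exists k, x; split=> // [i|y [Sy [b]]].
      by have [Sx [b bs bx]] := xS i; split=> //; exists b; rewrite // inE bs orbT.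
    rewrite inE => /predU1P[->|bs] byy; last by apply: xcov; split=> //; exists b.
    by apply: NNPP => ny; apply: nex; exists y; do 2!split=> //; move=> i xy; apply: ny; exists i.
  case=> y0 [Sy0 [ay0 nxy0]].
  exists k.+1, (fun i => if unlift ord0 i is Some j then x j else y0); split.
  - move=> i; case: unliftP => [j|] _.
      by have [Sx [b bs bx]] := xS j; split=> //; exists b; rewrite // inE bs orbT.
    by split=> //; exists a; rewrite // inE eqxx.
  - move=> i j; case: (unliftP ord0 i) => [i'|] ->; case: (unliftP ord0 j) => [j'|] -> //.
    + by move/xinj->.
    + by move/nxy0.
    + by move/peq_sym/nxy0.
  - move=> y [Sy [b]]; rewrite inE => /predU1P[->|bs] byy.
      exists ord0; rewrite unlift_none; exact: peq_trans (peq_sym ay0) byy.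
    have [|i xy] := xcov y; first by split=> //; exists b.
    by exists (lift ord0 i); rewrite liftK.
by exists k, x; split=> // [i|y Sy]; [case: (xS i)|apply: xcov; split=> //; apply: cover].
Qed.
End ProjectiveEquality.

(** * Homogenisation and points at infinity *)

Section Homogenise.
Variables (R : fieldType) (F : {mpoly R[2]}).

Lemma homogenise_eval (S : comNzRingType) (j : {rmorphism R -> S}) (p : 'I_3 -> S) :
  mmap j p (homogenise F) = \sum_(m <- msupp F) j F@_m *
    ((p 0 ^+ m 0 * p 1 ^+ m 1) * p 2%:R ^+ ((msize F).-1 - mdeg m)).
Proof.
rewrite /homogenise raddf_sum; apply: eq_bigr => m _ /=.
rewrite -mul_mpolyC !rmorphM /= mmapC rmorphXn /= mmapX mmap1U.
congr (_ * (_ * _ ^+ _)); last by congr (p _); apply/val_inj.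
rewrite rmorph_prod !big_ord_recl big_ord0 mulr1 /= !rmorphXn /= !mmapX !mmap1U.
by congr (p _ ^+ m _ * p _ ^+ m _); apply/val_inj.
Qed.

Lemma homogenise_affine (S : comNzRingType) (j : {rmorphism R -> S}) (w : 'I_2 -> S) :
  mmap j (vec3 (w 0) (w 1) 1) (homogenise F) = mmap j w F.
Proof.
rewrite homogenise_eval; apply: eq_bigr => m _; rewrite /vec3 /= expr1n mulr1.
rewrite /mmap1 !big_ord_recl big_ord0 mulr1.
by congr (_ * (w _ ^+ m _ * w _ ^+ m _)); apply/val_inj.
Qed.

Lemma mdeg2 (m : 'X_{1.. 2}) : mdeg m = (m 0%R + m 1%R)%N.
Proof.
rewrite mdegE !big_ord_recl big_ord0 addn0.
by congr (m _ + m _)%N; apply/val_inj.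
Qed.

Lemma homogenise_scale (S : comNzRingType) (j : {rmorphism R -> S}) (c : S) (p : 'I_3 -> S) :
  mmap j (fun i => c * p i) (homogenise F)
  = c ^+ (msize F).-1 * mmap j p (homogenise F).
Proof.
rewrite !homogenise_eval mulr_sumr; apply: eq_big_seq => m mF.
have le : (mdeg m <= (msize F).-1)%N.
  by have := msize_mdeg_lt mF; case: (msize F).
have -> : c ^+ (msize F).-1 = c ^+ m 0 * c ^+ m 1 * c ^+ ((msize F).-1 - mdeg m).
  by rewrite -!exprD -mdeg2 subnKC.
rewrite !exprMn; set k := ((msize F).-1 - mdeg m)%N.
move: (c ^+ m 0) (c ^+ m 1) (c ^+ k) (p 0 ^+ m 0) (p 1 ^+ m 1) (p 2%:R ^+ k).
by move=> *; ring.
Qed.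

(** At infinity only the part of top degree survives. In fixed total degree a monomial is determined
    by one exponent, so setting the other coordinate to 1 cancels nothing and the leading
    coefficient stays visible. *)
Lemma homogenise_top (i : 'I_2) : F != 0 ->
  mmap polyC (vec3 (if i == 0 then 1 else 'X) (if i == 0 then 'X else 1) 0)
    (homogenise F) != 0 :> {poly R}.
Proof.
move=> F0; set P := mmap _ _ _; pose m0 := mlead F.
have m0F : m0 \in msupp F by apply: mlead_supp.
have dm0 : mdeg m0 = (msize F).-1 by rewrite -mlead_deg.
pose k (m : 'X_{1.. 2}) := if i == 0 then m 1 else m 0.
suff: P`_(k m0) = F@_m0.
  by move=> e; apply: contraTneq m0F => P0; rewrite mcoeff_msupp -e P0 coef0 eqxx.
rewrite /P homogenise_eval coef_sum (bigD1_seq m0) //= ?msupp_uniq //.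
have E (m : 'X_{1.. 2}) : (vec3 (if i == 0 then 1 else 'X) (if i == 0 then 'X else 1) 0 0 : {poly R}) ^+ m 0 *
   vec3 (if i == 0 then 1 else 'X) (if i == 0 then 'X else 1) 0 1 ^+ m 1 = 'X^(k m).
  by rewrite /vec3 /k /=; case: (i == 0); rewrite expr1n ?mul1r ?mulr1.
rewrite E dm0 subnn expr0 mulr1 coefCM coefXn eqxx mulr1.
rewrite big1_seq ?addr0 // => m /andP[ne mF]; rewrite E coefCM.
have : (mdeg m <= (msize F).-1)%N by have := msize_mdeg_lt mF; case: (msize F).
rewrite leq_eqVlt => /predU1P[dm|lt]; last first.
  rewrite /vec3 /=; move: lt; rewrite -subn_gt0; case: (_ - _)%N => // d _.
  by rewrite exprS mul0r mulr0 coef0 mulr0.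
rewrite dm subnn expr0 mulr1 coefXn; case: eqP => [e|_]; last by rewrite mulr0.
case/eqP: ne; apply/mnmP => l; move: e dm; rewrite -dm0 !mdeg2 /k.
by case: (i == 0) => e /eqP; rewrite -e ?eqn_add2l ?eqn_add2r => /eqP e';
  case: (ord2P l) => ->.
Qed.
End Homogenise.

Lemma map_meval (L K : fieldType) (iota : {rmorphism L -> K}) n (P : {mpoly L[n]})
  (v : 'I_n -> K) : (map_mpoly iota P).@[v] = mmap iota v P.
Proof.
rewrite /map_mpoly -[LHS]/(mmap idfun v _) mmap_comp.
by apply: mmap_eq => [c|i] /=; rewrite -/(meval v _) ?mevalC ?mevalXU.
Qed.

Lemma meval_iota (L K : fieldType) (iota : {rmorphism L -> K}) n (P : {mpoly L[n]})
  (v : 'I_n -> L) : iota P.@[v] = mmap iota (iota \o v) P.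
Proof. by rewrite /meval mmap_comp; apply: mmap_eq. Qed.


Lemma lin_swap (L : closedFieldType) (e1 e2 : 'I_2 -> L) (S : comNzRingType)
    (j : L -> S) x y : lin e2 e1 j x y =1 lin e1 e2 j y x.
Proof. by move=> i; rewrite /lin addrC. Qed.

Lemma mmap_lin_swap (L : closedFieldType) (e1 e2 : 'I_2 -> L) (S : comNzRingType)
    (j : {rmorphism L -> S}) x y P :
  mmap j (lin e2 e1 j x y) P = mmap j (lin e1 e2 j y x) P.
Proof. by apply: mmap_eq => //; apply: lin_swap. Qed.

Section Coordinates.
Variables (L : closedFieldType) (e1 e2 : 'I_2 -> L).
Let D := e1 0 * e2 1 - e1 1 * e2 0.
Hypothesis D0 : D != 0.
Variables (S : comNzRingType) (j : {rmorphism L -> S}).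

Definition coord1 (w : 'I_2 -> S) := j (e2 1 / D) * w 0 - j (e2 0 / D) * w 1.
Definition coord2 (w : 'I_2 -> S) := j (e1 0 / D) * w 1 - j (e1 1 / D) * w 0.

Lemma coordK w : lin e1 e2 j (coord1 w) (coord2 w) =1 w.
Proof.
have DV : j D^-1 * (j (e1 0) * j (e2 1) - j (e1 1) * j (e2 0)) = 1.
  by rewrite -!rmorphM -rmorphB -rmorphM /= mulVf ?rmorph1.
move=> i; rewrite /lin /coord1 /coord2 !rmorphM -[RHS]mul1r -DV.
by case: (ord2P i) => ->; ring.
Qed.

Lemma lin_inj x y x' y' : lin e1 e2 j x y =1 lin e1 e2 j x' y' -> x = x' /\ y = y'.
Proof.
have DV : j D^-1 * (j (e1 0) * j (e2 1) - j (e1 1) * j (e2 0)) = 1.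
  by rewrite -!rmorphM -rmorphB -rmorphM /= mulVf ?rmorph1.
have c1 a b : coord1 (lin e1 e2 j a b) = a.
  by rewrite /coord1 /lin !rmorphM -[RHS]mul1r -DV; ring.
have c2 a b : coord2 (lin e1 e2 j a b) = b.
  by rewrite /coord2 /lin !rmorphM -[RHS]mul1r -DV; ring.
move=> e; split; [rewrite -(c1 x y) -(c1 x' y')|rewrite -(c2 x y) -(c2 x' y')];
  by rewrite /coord1 /coord2 !e.
Qed.
End Coordinates.

Lemma vec3_row3 (R : fieldType) (a b c : R) : row3 a b c 0 =1 vec3 a b c.
Proof. by move=> i; rewrite mxE. Qed.

(** * Both branches together, and intersections with lines *)

Section Node.
Variables (L K : closedFieldType) (iota : {rmorphism L -> K}) (O : {pred K}).
Hypothesis hO : specialisation_ring iota O.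
Local Notation m := (max_ideal O).
Variables (F : {mpoly L[2]}) (Firr : irreducible_mpoly F).
Variables (e1 e2 : 'I_2 -> L) (C1 C2 : {mpoly L[3]}).
Hypothesis D0 : e1 0 * e2 1 - e1 1 * e2 0 != 0.
Hypothesis fr1 : node_frame F e1 e2 C1.
Hypothesis fr2 : node_frame F e2 e1 C2.

Local Notation val2 P x y := (mmap iota (lin e1 e2 iota x y) P).
Local Notation branch1 := (on_branch1 iota O C1).
Local Notation branch2 := (on_branch1 iota O C2).

Lemma det_swap : e2 0 * e1 1 - e2 1 * e1 0 != 0.
Proof. by rewrite -oppr_eq0 opprB [e2 1 * _]mulrC [e2 0 * _]mulrC. Qed.

Lemma irr1 : irreducible_poly2 (to_poly2 e1 e2 F).
Proof. exact: (to_poly2_irr D0 Firr). Qed.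

Lemma irr2 : irreducible_poly2 (to_poly2 e2 e1 F).
Proof. exact: (to_poly2_irr det_swap Firr). Qed.

(** Divisibility in [O] is total, so one coordinate divides the other. The quotient then satisfies a
    branch equation, which forces it to be infinitesimal. *)
Lemma node_branches x y : x \in m -> y \in m -> val2 F x y = 0 ->
  (exists2 s, y = x * s & branch1 x s) \/ (exists2 r, x = y * r & branch2 y r).
Proof.
move=> xm ym Fxy; have [[s sO yE]|[r rO xE]] := dv_total hO x y.
- have [x0|x0] := eqVneq x 0.
    left; exists 0; first by rewrite yE x0 !mul0r.
    by split; rewrite ?(m0 hO) // x0 mul0r oppr0.
  by left; exists s => //; apply: (on_branch1P hO fr1) => //; rewrite -yE.
- have [y0|y0] := eqVneq y 0.
    right; exists 0; first by rewrite xE y0 !mul0r.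
    by split; rewrite ?(m0 hO) // y0 mul0r oppr0.
  by right; exists r => //; apply: (on_branch1P hO fr2) => //; rewrite -xE (mmap_lin_swap e1 e2).
Qed.

Lemma origin_on_curve : val2 F 0 0 = 0.
Proof. by have := val_scale iota fr1 0 0 0; rewrite mul0r expr0n mul0r. Qed.

Lemma eliminate1 G : (exists x y, val2 F x y = 0 /\ val2 G x y != 0) ->
  exists r : {poly L}, r != 0 /\ forall x y, x \in O -> y \in O ->
    val2 F x y = 0 -> val2 G x y = 0 -> (map_poly iota r).[x] = 0.
Proof.
case/(eliminate hO fr1 irr1) => r [r0 rE]; exists r; split=> // x y xO yO F0 G0.
by have [c _ ->] := rE x y xO yO F0; rewrite G0 mul0r.
Qed.

Lemma eliminate2 G : (exists x y, val2 F x y = 0 /\ val2 G x y != 0) ->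
  exists r : {poly L}, r != 0 /\ forall x y, x \in O -> y \in O ->
    val2 F x y = 0 -> val2 G x y = 0 -> (map_poly iota r).[y] = 0.
Proof.
case=> x0 [y0 [F0 G0]].
have [|r [r0 rE]] := eliminate hO fr2 irr2 (G := G).
  by exists y0, x0; rewrite !(mmap_lin_swap e1 e2).
exists r; split=> // x y xO yO F1 G1.
have [|c _ ->] := rE y x yO xO; first by rewrite (mmap_lin_swap e1 e2).
by rewrite (mmap_lin_swap e1 e2) G1 mul0r.
Qed.

(** Eliminating either coordinate leaves finitely many values for the other, so the common zeros lie
    in a finite grid. *)
Lemma common_zeros_finite G : (exists x y, val2 F x y = 0 /\ val2 G x y != 0) ->
  exists s : seq 'rV[L]_3, forall w : 'I_2 -> L, F.@[w] = 0 -> G.@[w] = 0 ->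
    row3 (w 0) (w 1) 1 \in s.
Proof.
move=> nz; have [r1 [r10 r1E]] := eliminate1 nz; have [r2 [r20 r2E]] := eliminate2 nz.
have roots (r : {poly L}) : r != 0 -> exists rs : seq L, forall z, root r z -> z \in rs.
  move=> r0; have [rs rsE] := closed_field_poly_normal r; exists rs => z.
  by rewrite rsE rootZ ?lead_coef_eq0 // root_prod_XsubC.
have [s1 s1E] := roots r1 r10; have [s2 s2E] := roots r2 r20.
exists [seq row3 (e1 0 * x + e2 0 * y) (e1 1 * x + e2 1 * y) 1 | x <- s1, y <- s2].
move=> w Fw Gw; have [x [y wE]] : exists x y, lin e1 e2 idfun x y =1 w.
  exists (coord1 e1 e2 idfun w), (coord2 e1 e2 idfun w); exact: (coordK D0 idfun).
have wE' : lin e1 e2 iota (iota x) (iota y) =1 iota \o w.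
  by move=> i; rewrite /= -[w i]wE /lin rmorphD !rmorphM.
have E P : val2 P (iota x) (iota y) = iota P.@[w].
  by rewrite meval_iota; apply: mmap_eq.
have xO := iota_O hO x; have yO := iota_O hO y.
have rt (r : {poly L}) z : (map_poly iota r).[iota z] = 0 -> root r z.
  by move=> rz; rewrite -(fmorph_root iota); apply/rootP.
apply/allpairsP; exists (x, y); rewrite s1E ?s2E /=.
- by split=> //; rewrite -!wE.
- by apply: rt; apply: (r2E (iota x)) => //; rewrite E ?Fw ?Gw rmorph0.
- by apply: rt; apply: (r1E _ (iota y)) => //; rewrite E ?Fw ?Gw rmorph0.
Qed.

Lemma F_neq0 : F != 0.
Proof.
apply/eqP => F0; case: Firr => _ /(_ 0 0); rewrite F0 mulr0 => /(_ erefl).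
by rewrite unitr0; case.
Qed.

Definition line_affine (v : 'rV[L]_3) : {mpoly L[2]} :=
  (v 0 0)%:MP * 'X_0 + (v 0 1)%:MP * 'X_1 + (v 0 2%:R)%:MP.

Lemma line_affineE (S : comNzRingType) (j : {rmorphism L -> S}) v (w : 'I_2 -> S) :
  mmap j w (line_affine v) = j (v 0 0) * w 0 + j (v 0 1) * w 1 + j (v 0 2%:R).
Proof.
by rewrite /line_affine !raddfD /= !rmorphM /= !mmapC !mmapX !mmap1U.
Qed.

Lemma ord3P (i : 'I_3) : [\/ i = 0, i = 1 | i = 2%:R].
Proof.
by case: i => [[|[|[|//]]] ?];
  [constructor 1|constructor 2|constructor 3]; apply/val_inj.
Qed.

(** A line missing the node is nonzero there. A line through it, restricted to the branch along
    [e1], is x times (its value at [e1] plus an infinitesimal), and likewise for [e2]; its values at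
    both basis vectors cannot vanish. *)
Lemma line_not_component v : v != 0 ->
  exists x y, val2 F x y = 0 /\ val2 (line_affine v) x y != 0.
Proof.
move=> v0; have [c0|c0] := eqVneq (v 0 2%:R) 0; last first.
  exists 0, 0; rewrite origin_on_curve line_affineE /lin !mulr0 addr0 !mulr0 !add0r.
  by rewrite fmorph_eq0.
have [x xm x0] := m_nonzero hO.
pose l (e : 'I_2 -> L) := v 0 0 * e 0 + v 0 1 * e 1.
have key (e e' : 'I_2 -> L) s : s \in m -> l e != 0 ->
    iota (v 0 0) * lin e e' iota x (x * s) 0
    + iota (v 0 1) * lin e e' iota x (x * s) 1 + iota (v 0 2%:R) != 0.
  move=> sm le; rewrite c0 rmorph0 addr0 /lin.
  have -> : iota (v 0 0) * (iota (e 0) * x + iota (e' 0) * (x * s)) +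
      iota (v 0 1) * (iota (e 1) * x + iota (e' 1) * (x * s))
      = x * (iota (l e) + iota (l e') * s).
    by rewrite /l !rmorphD !rmorphM; ring.
  rewrite mulf_neq0 //; apply: (notin_m hO _).1.
  by apply: (unitDm hO); [exact: (iota_unit hO)|apply: (mM hO) => //; apply: (iota_O hO)].
have [l1|l1] := eqVneq (l e1) 0; last first.
  have [s sb] := branch1_exists hO C1 xm.
  exists x, (x * s); rewrite (val_branch1 fr1 sb) line_affineE; split=> //.
  exact: key sb.1 l1.
have [l2|l2] := eqVneq (l e2) 0; last first.
  have [s sb] := branch1_exists hO C2 xm.
  exists (x * s), x; rewrite -!(mmap_lin_swap e1 e2) (val_branch1 fr2 sb) line_affineE.
  by split=> //; apply: key sb.1 l2.
case/eqP: v0; apply/rowP => i; rewrite mxE.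
have k1 : v 0 0 * (e1 0 * e2 1 - e1 1 * e2 0) = 0.
  transitivity (l e1 * e2 1 - l e2 * e1 1); first by rewrite /l; ring.
  by rewrite l1 l2 !mul0r subr0.
have k2 : v 0 1 * (e1 0 * e2 1 - e1 1 * e2 0) = 0.
  transitivity (l e2 * e1 0 - l e1 * e2 0); first by rewrite /l; ring.
  by rewrite l1 l2 !mul0r subr0.
case: (ord3P i) => ->; [move/eqP: k1|move/eqP: k2|exact: c0];
  by rewrite mulf_eq0 (negbTE D0) orbF => /eqP.
Qed.

Lemma member_X (R : fieldType) (v p : 'rV[R]_3) :
  (member (fun i => 'X_i) v).@[p 0] = v 0 0 * p 0 0 + v 0 1 * p 0 1 + v 0 2%:R * p 0 2%:R.
Proof.
rewrite /member raddf_sum /= !big_ord_recl big_ord0 addr0 !mevalZ !mevalXU addrA.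
by congr (v 0 _ * p 0 _ + v 0 _ * p 0 _ + v 0 _ * p 0 _); apply/val_inj.
Qed.

Lemma lines_finite_system : finite_system F 1 (fun i : 'I_3 => 'X_i : {mpoly L[3]}).
Proof.
split=> [i|v v0|v v0].
- by rewrite dhomogX /= mdeg1.
- apply: contra_neq v0 => e; apply/rowP => i; rewrite mxE.
  have := congr1 (fun P : {mpoly L[3]} => P.@[(delta_mx 0 i : 'rV[L]_3) 0]) e.
  rewrite member_X meval0 !mxE; case: (ord3P i) => -> /=;
  by rewrite !(mulr0, mulr1, addr0, add0r).
have [s sE] := common_zeros_finite (line_not_component v0).
have T0 := homogenise_top 0 F_neq0.
set T := mmap _ _ _ in T0.
have [rs rsE] := closed_field_poly_normal T.
(* The cover consists of [0:1:0], the remaining points at infinity given by the roots of [T], and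
   the affine points. *)
apply: (@proj_card_cover _ _ _ (row3 0 1 0 :: [seq row3 1 z 0 | z <- rs] ++ s)).
move=> p [[p0 Fp]]; rewrite member_X => lp.
have rowE (q : 'rV[L]_3) : q = row3 (q 0 0) (q 0 1) (q 0 2%:R).
  by apply/rowP => i; rewrite !mxE; case: (ord3P i) => ->.
have [z0|z0] := eqVneq (p 0 2%:R) 0.
- have [x0|x0] := eqVneq (p 0 0) 0.
    have y0 : p 0 1 != 0.
      by apply: contra_neq p0 => y0; rewrite [p]rowE x0 y0 z0; apply/rowP => i;
         rewrite !mxE; case: (ord3P i) => ->.
    exists (row3 0 1 0); first by rewrite inE eqxx.
    exists (p 0 1) => //; apply/rowP => i; rewrite !mxE.
    by case: (ord3P i) => ->; rewrite /= ?mulr0 ?mulr1.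
  exists (row3 1 (p 0 1 / p 0 0) 0).
    rewrite inE mem_cat; apply/orP; right; apply/orP; left; apply/mapP.
    exists (p 0 1 / p 0 0) => //; suff: root T (p 0 1 / p 0 0).
      by rewrite rsE rootZ ?lead_coef_eq0 // root_prod_XsubC.
    apply/rootP; rewrite -[LHS]/(horner_eval _ T) /T mmap_vec3.
    rewrite /= /horner_eval hornerX horner0 -polyC1 hornerC.
    have -> : mmap (horner_eval (p 0 1 / p 0 0) \o polyC) (vec3 1 (p 0 1 / p 0 0) 0)
        (homogenise F) = mmap idfun (fun i => (p 0 0)^-1 * p 0 i) (homogenise F).
      apply: mmap_eq => [c|i]; first by rewrite /= /horner_eval hornerC.
      by case: (ord3P i) => ->; rewrite /vec3 /= ?mulVf ?z0 ?mulr0 // mulrC.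
    by rewrite homogenise_scale -/(meval _ _) Fp mulr0.
  exists (p 0 0) => //; apply/rowP => i; rewrite !mxE.
  by case: (ord3P i) => ->; rewrite /= ?mulr0 ?mulr1 // mulrC divfK.
pose w := (fun i => if i == 0 then p 0 0 / p 0 2%:R else p 0 1 / p 0 2%:R) : 'I_2 -> L.
exists (row3 (w 0) (w 1) 1).
  rewrite inE mem_cat sE ?orbT //.
    rewrite -[LHS]/(mmap idfun w F) -homogenise_affine.
    have -> : mmap idfun (vec3 (w 0) (w 1) 1) (homogenise F)
        = mmap idfun (fun i => (p 0 2%:R)^-1 * p 0 i) (homogenise F).
      apply: mmap_eq => // i.
      by case: (ord3P i) => ->; rewrite /vec3 /w /= ?mulVf // mulrC.
    by rewrite homogenise_scale -/(meval _ _) Fp mulr0.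
  rewrite -[LHS]/(mmap idfun w _) line_affineE /w /=.
  apply: (mulfI z0); rewrite mulr0 -[RHS]lp; field.
  exact: z0.
exists (p 0 2%:R) => //; apply/rowP => i; rewrite !mxE.
by case: (ord3P i) => ->; rewrite /w /= ?mulr1 // mulrC divfK.
Qed.

Lemma homog1E (R : fieldType) (P : {mpoly R[3]}) : P \is 1%N.-homog ->
  P = \sum_i P@_(U_(i)) *: 'X_i.
Proof.
move=> hP; apply/mpolyP => k; rewrite raddf_sum /=.
under eq_bigr do rewrite mcoeffZ mcoeffX.
have [/mdeg1P[i /eqP->]|k1] := boolP (mdeg k == 1%N).
  rewrite (bigD1 i) //= eqxx mulr1 big1 ?addr0 // => i' ne.
  by rewrite eq_mnm1 (negbTE ne) mulr0.
rewrite (dhomog_nemf_coeff hP k1) big1 // => i _.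
by case: eqP => [e|_]; rewrite ?mulr0 //; move: k1; rewrite -e mdeg1.
Qed.

(* A maximal system of lines contains every line, in particular one that misses
   the double point. *)
Lemma maximal_lines_origin s (B : 'I_s.+1 -> {mpoly L[3]}) : maximal_system F 1 B ->
  exists i, (B i)@_(U_(2%:R)) != 0.
Proof.
case=> hB hmax.
have [|v vE] := hmax _ _ lines_finite_system _ (row3 0 0 1).
  move=> v; exists (\row_i (member B v)@_(U_(i))).
  rewrite [RHS]homog1E; first by apply: eq_bigr => i _; rewrite mxE.
  by rewrite rpred_sum // => i _; apply: rpredZ; apply: (fs_degree hB).
apply: NNPP => nex.
have := congr1 (fun P : {mpoly L[3]} => P@_(U_(2%:R))) vE.
rewrite /member !raddf_sum /= big1 => [|i _].
  rewrite !big_ord_recl big_ord0 !mcoeffZ !mcoeffX !mxE /= !eq_mnm1 /= !mul0r !add0r.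
  by rewrite mul1r addr0 => /esym/eqP; rewrite oner_eq0.
rewrite mcoeffZ; have [->|ne] := eqVneq (B i)@_(U_(2%:R)) 0; first by rewrite mulr0.
by case: nex; exists i.
Qed.
End Node.


(** * K-points of the nonsingular model *)

Lemma affine_ptE (R : fieldType) (q : 'rV[R]_2) :
  affine_pt q 0 =1 vec3 (q 0 0) (q 0 1) 1.
Proof.
move=> i; rewrite /affine_pt mxE; case: splitP => j jE.
  case: (ord2P j) jE => -> /=; case: i => [[|[|[|]]] //= ?] _; by rewrite /vec3.
by rewrite mxE (ord1 j) /= in jE *; case: i jE => [[|[|[|]]]].
Qed.

Section Transfer.
Variables (L K : closedFieldType) (iota : {rmorphism L -> K}).
Variables (F : {mpoly L[2]}) (M : model L) (hM : nonsingular_model F M).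
Local Notation MK := (base_change iota M).
Implicit Types x : 'rV[K]_(amb M).+1.

Lemma eval_rowK (i : 'I_(npatch M)) x k :
  eval_row (patch (m := MK) i) x 0 k = mmap iota (x 0) (patch (m := M) i k).
Proof. by rewrite mxE; apply: map_meval. Qed.

Lemma mpointK x : mpoint (M := MK) x <->
  x != 0 /\ forall g, g \in eqns M -> mmap iota (x 0) g = 0.
Proof.
split=> [] [x0 gx]; split=> // g gM.
  by rewrite -map_meval; apply: gx; apply/mapP; exists g.
by case/mapP: gM => h hM' ->; rewrite map_meval; apply: gx.
Qed.

Lemma specialise_mpoint x (w : {mpoly L[(amb M).+1]}) :
  mpoint (M := MK) x -> mmap iota (x 0) w != 0 ->
  exists a : 'rV[L]_(amb M).+1, [/\ mpoint a, w.@[a 0] != 0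
    & forall g, mmap iota (x 0) g = 0 -> g.@[a 0] = 0].
Proof.
move=> /mpointK[x0 gx] w0; have [l xl] := row_neq0 x0.
(* The factor ['X_l] keeps the specialised vector nonzero. *)
have [|a [wa ga]] := specialise_point (iota := iota) (x := x 0) (w := w * 'X_l).
  by rewrite rmorphM /= mmapX mmap1U mulf_neq0.
have aE g : g.@[(\row_i a i) 0] = g.@[a] by apply: mmap_eq => // i; rewrite mxE.
exists (\row_i a i); move: wa; rewrite mevalM mevalXU mulf_eq0 negb_or => /andP[wa al].
split=> [||g /ga]; rewrite ?aE //; split=> [|g /gx/ga]; rewrite ?aE //.
by apply: (neq0_row (i := l)); rewrite mxE.
Qed.

(** A nonzero minor, together with a nonzero coordinate of each triple, would survive at some
    [L]-point of the model, where the maps agree. The transfers [imageK] and [psi_invK] follow the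
    same pattern. *)
Lemma welldefK x i i' : mpoint (M := MK) x ->
  eval_row (patch (m := MK) i) x != 0 -> eval_row (patch (m := MK) i') x != 0 ->
  peq (eval_row (patch (m := MK) i) x) (eval_row (patch (m := MK) i') x).
Proof.
move=> xZ A0 B0; apply: minor_peq => // k l.
have [k0 Ak0] := row_neq0 A0; have [l0 Bl0] := row_neq0 B0.
rewrite !eval_rowK in Ak0 Bl0 *; apply/eqP; rewrite -subr_eq0; apply/negPn/negP => mn.
pose p := patch (m := M) i; pose p' := patch (m := M) i'.
have [|a [aZ wa _]] := specialise_mpoint (w := (p k * p' l - p l * p' k) * (p k0 * p' l0)) xZ.
  by rewrite rmorphM rmorphB !rmorphM /= !mulf_neq0.
move: wa; rewrite mevalM mevalB !mevalM !mulf_eq0 !negb_or => /and3P[wa ak al].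
have Ai : eval_row p a != 0 by apply: (neq0_row (i := k0)); rewrite mxE.
have Bi : eval_row p' a != 0 by apply: (neq0_row (i := l0)); rewrite mxE.
have := nm_welldef hM aZ (ex_intro _ i (conj Ai (peq_refl _)))
  (ex_intro _ i' (conj Bi (peq_refl _))).
by move/(@peq_minor _ _ _ _ k l); rewrite !mxE => /eqP; rewrite -subr_eq0 (negbTE wa).
Qed.

Lemma mmap_to_uniqK x p p' : mpoint (M := MK) x -> mmap_to (M := MK) x p ->
  mmap_to (M := MK) x p' -> peq p p'.
Proof.
move=> xZ [i [A0 Ap]] [i' [B0 Bp]].
apply: peq_trans (peq_sym Ap) _; apply: peq_trans Bp; exact: welldefK.
Qed.

Lemma mmap_patch (n : nat) (P : {mpoly L[n]}) (f : 'I_n -> {mpoly L[(amb M).+1]})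
    (S : comNzRingType) (j : {rmorphism L -> S}) (x : 'I_(amb M).+1 -> S) :
  mmap j x (mmap (@mpolyC _ L) f P) = mmap j (fun k => mmap j x (f k)) P.
Proof.
by rewrite mmap_comp; apply: mmap_eq => // c; rewrite /= mmapC.
Qed.

Lemma imageK x i : mpoint (M := MK) x -> eval_row (patch (m := MK) i) x != 0 ->
  mmap iota (eval_row (patch (m := MK) i) x 0) (homogenise F) = 0.
Proof.
move=> xZ A0; have [k0 Ak0] := row_neq0 A0; rewrite eval_rowK in Ak0.
apply/eqP/negPn/negP => h0; pose p := patch (m := M) i.
pose G := mmap (@mpolyC _ L) p (homogenise F).
have GE : mmap iota (x 0) G = mmap iota (eval_row (patch (m := MK) i) x 0) (homogenise F).
  by rewrite mmap_patch; apply: mmap_eq => // k; rewrite eval_rowK.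
have [|a [aZ wa _]] := specialise_mpoint (w := G * p k0) xZ.
  by rewrite rmorphM /= mulf_neq0 ?GE.
move: wa; rewrite mevalM mulf_eq0 negb_or => /andP[wa ak].
have Ai : eval_row p a != 0 by apply: (neq0_row (i := k0)); rewrite mxE.
have [_ /eqP] := nm_image hM aZ (ex_intro _ i (conj Ai (peq_refl _))).
suff -> : (homogenise F).@[eval_row p a 0] = G.@[a 0] by rewrite (negbTE wa).
rewrite -[RHS]/(mmap idfun (a 0) G) mmap_patch; apply: mmap_eq => // k.
by rewrite mxE.
Qed.

Section Inverse.
Variable psi : 'I_(amb M).+1 -> {mpoly L[3]}.
Hypothesis psi_on : forall p, proj_closure F p -> eval_row psi p != 0 ->
  mpoint (M := M) (eval_row psi p) /\ mmap_to (M := M) (eval_row psi p) p.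
Hypothesis psi_inv : forall (x : 'rV[L]_(amb M).+1) p, mpoint (M := M) x -> mmap_to x p ->
  eval_row psi p != 0 -> peq (eval_row psi p) x.

Local Notation psiK p := (\row_k mmap iota (p : 'I_3 -> K) (psi k)).

Lemma psi_invK x i : mpoint (M := MK) x -> eval_row (patch (m := MK) i) x != 0 ->
  psiK (eval_row (patch (m := MK) i) x 0) != 0 ->
  peq (psiK (eval_row (patch (m := MK) i) x 0)) x.
Proof.
move=> xZ A0 B0; have x0 : x != 0 by case: xZ.
apply: minor_peq => // k l; pose p := patch (m := M) i.
have [k0 Ak0] := row_neq0 A0; have [l0 Bl0] := row_neq0 B0.
rewrite eval_rowK in Ak0; rewrite !mxE in Bl0 *.
pose G k := mmap (@mpolyC _ L) p (psi k).
have GE k' : mmap iota (x 0) (G k') = mmap iota (eval_row (patch (m := MK) i) x 0) (psi k').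
  by rewrite mmap_patch; apply: mmap_eq => // z; rewrite eval_rowK.
apply/eqP; rewrite -subr_eq0; apply/negPn/negP => mn.
have [|a [aZ wa _]] := specialise_mpoint (w := (G k * 'X_l - G l * 'X_k) * (p k0 * G l0)) xZ.
  rewrite rmorphM rmorphB !rmorphM /= !GE !mmapX !mmap1U !mulf_neq0 //.
move: wa; rewrite mevalM mevalB !mevalM !mevalXU !mulf_eq0 !negb_or => /and3P[wa ak al].
have Ai : eval_row p a != 0 by apply: (neq0_row (i := k0)); rewrite mxE.
have Ga k' : (G k').@[a 0] = (psi k').@[eval_row p a 0].
  rewrite -[LHS]/(mmap idfun (a 0) (G k')) mmap_patch; apply: mmap_eq => // z.
  by rewrite mxE.
have Bi : eval_row psi (eval_row p a) != 0.
  by apply: (neq0_row (i := l0)); rewrite mxE -Ga.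
have := psi_inv aZ (ex_intro _ i (conj Ai (peq_refl _))) Bi.
move/(@peq_minor _ _ _ _ k l); rewrite !mxE -!Ga => /eqP.
by rewrite -subr_eq0 (negbTE wa).
Qed.

Lemma psi_onK (q : 'rV[K]_2) : mmap iota (q 0) F = 0 -> psiK (affine_pt q 0) != 0 ->
  mpoint (M := MK) (psiK (affine_pt q 0)) /\
  mmap_to (M := MK) (psiK (affine_pt q 0)) (affine_pt q).
Proof.
move=> Fq B0; have [l0 Bl0] := row_neq0 B0; rewrite mxE in Bl0.
pose D P : {mpoly L[2]} := mmap (@mpolyC 2 L) (vec3 'X_0 'X_1 1) (P : {mpoly L[3]}).
have DE (S : comNzRingType) (j : {rmorphism L -> S}) (w : 'I_2 -> S) P :
    mmap j w (D P) = mmap j (vec3 (w 0) (w 1) 1) P.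
  rewrite /D mmap_vec3; apply: mmap_eq => [c|i]; first by rewrite /= mmapC.
  by rewrite /= !mmapX !mmap1U rmorph1.
have DK P : mmap iota (q 0) (D P) = mmap iota (affine_pt q 0) P.
  by rewrite DE; apply: mmap_eq => // i; rewrite affine_ptE.
pose G k := D (psi k).
pose pt (a : 'I_2 -> L) := row3 (a 0) (a 1) 1.
have DL (a : 'I_2 -> L) P : (D P).@[a] = P.@[pt a 0].
  by rewrite -[LHS]/(mmap idfun a _) DE; apply: mmap_eq => // i; rewrite vec3_row3.
have spec (w : {mpoly L[2]}) : mmap iota (q 0) w != 0 ->
    exists p, [/\ eval_row psi p != 0, mpoint (M := M) (eval_row psi p),
      mmap_to (M := M) (eval_row psi p) p
    & exists a, [/\ p = pt a, w.@[a] != 0 & forall g, mmap iota (q 0) g = 0 -> g.@[a] = 0]].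
  move=> w0; have [|a [wa ga]] := specialise_point (iota := iota) (x := q 0) (w := w * G l0).
    by rewrite rmorphM /= mulf_neq0 // DK.
  move: wa; rewrite mevalM mulf_eq0 negb_or => /andP[wa al].
  have psia : eval_row psi (pt a) != 0.
    by apply: (neq0_row (i := l0)); rewrite mxE -DL.
  have pa : proj_closure F (pt a).
    split; first by apply: (neq0_row (i := 2%:R)); rewrite mxE oner_eq0.
    rewrite -(ga F) //; transitivity (mmap idfun (vec3 (a 0) (a 1) 1) (homogenise F)).
      by apply: mmap_eq => // i; rewrite vec3_row3.
    exact: homogenise_affine.
  have [pZ pm] := psi_on pa psia.
  by exists (pt a); split=> //; exists a.
pose GG (g : {mpoly L[(amb M).+1]}) : {mpoly L[2]} := mmap (@mpolyC 2 L) G g.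
have GGK g : mmap iota (q 0) (GG g) = mmap iota (psiK (affine_pt q 0) 0) g.
  rewrite /GG mmap_comp; apply: mmap_eq => [c|k] /=; first by rewrite mmapC.
  by rewrite DK mxE.
have GGL a g : (GG g).@[a] = g.@[eval_row psi (pt a) 0].
  rewrite -[LHS]/(mmap idfun a _) mmap_comp; apply: mmap_eq => [c|k] /=.
    by rewrite mmapC.
  by rewrite -[LHS]/((D (psi k)).@[a]) DL mxE.
have BZ : mpoint (M := MK) (psiK (affine_pt q 0)).
  apply/mpointK; split=> // g gM; rewrite -GGK; apply/eqP/negPn/negP => gq.
  have [p [_ [_ pZ] _ [a [pE wa _]]]] := spec _ gq.
  by move: wa; rewrite GGL -pE pZ // eqxx.
split=> //.
have [i Ai] : exists i : 'I_(npatch M),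
    eval_row (patch (m := MK) i) (psiK (affine_pt q 0)) != 0.
  (* Here relations rather than an inequality are transferred: if all triples vanished at the lifted
     point, they would vanish at its specialisation, where some triple is defined. *)
  apply: NNPP => nex.
  have [|p [_ _ [i [Ai _]] [a [pE _ ga]]]] := spec 1.
    by rewrite rmorph1 oner_eq0.
  have [k Aik] := row_neq0 Ai; case/eqP: Aik; rewrite mxE pE -GGL; apply: ga.
  rewrite GGK -eval_rowK; apply/eqP; apply: contra_notT nex => ne.
  by exists i; apply: (neq0_row ne).
exists i; split=> //; apply: minor_peq => //.
  apply: (neq0_row (i := 2%:R)); rewrite affine_ptE /vec3 /=; exact: oner_neq0.
move=> k l; apply/eqP; rewrite -subr_eq0; apply/negPn/negP => mn.
have [k0 Ak0] := row_neq0 Ai; rewrite eval_rowK in Ak0.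
pose p := patch (m := M) i; pose V k : {mpoly L[2]} := D 'X_k.
have [|r [_ rZ rm [a [rE wa _]]]] :=
    spec ((GG (p k) * V l - GG (p l) * V k) * GG (p k0)).
  rewrite rmorphM rmorphB !rmorphM /= !GGK /V !DK !mmapX !mmap1U mulf_neq0 //.
  by rewrite -!eval_rowK.
move: wa; rewrite mevalM mevalB !mevalM mulf_eq0 negb_or !GGL /V !DL !mevalXU -rE => /andP[wa ak].
have Ri : eval_row p (eval_row psi r) != 0.
  by apply: (neq0_row (i := k0)); rewrite mxE.
have := nm_welldef hM rZ (ex_intro _ i (conj Ri (peq_refl _))) rm.
by move/(@peq_minor _ _ _ _ k l)/eqP; rewrite -subr_eq0 !mxE (negbTE wa).
Qed.
End Inverse.
End Transfer.

(** * Specialisation of projective points *)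

Section Specialises.
Variables (L K : closedFieldType) (iota : {rmorphism L -> K}) (O : {pred K}).
Hypothesis hO : specialisation_ring iota O.
Local Notation m := (max_ideal O).
Local Notation spec := (specialises iota O).

(** Both vectors are residues of multiples of one vector, so their minors are infinitesimal; being
    in [L], they are zero. *)
Lemma specialises_uniq n (x : 'rV[K]_n) (p p' : 'rV[L]_n) :
  p != 0 -> p' != 0 -> spec x p -> spec x p' -> peq p p'.
Proof.
move=> p0 p'0 [c c0 cx] [c' c'0 c'x]; apply: minor_peq => // i j.
apply/eqP; rewrite -subr_eq0; apply/eqP; apply: (iota_m hO).
have E y (r : 'rV[L]_n) k : y * x 0 k - iota (r 0 k) \in m ->
    exists2 d, d \in m & iota (r 0 k) = y * x 0 k + d.
  by move=> h; exists (- (y * x 0 k - iota (r 0 k))); [exact: (mN hO)|ring].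
have [d1 d1m e1] := E _ _ _ (cx i); have [d2 d2m e2] := E _ _ _ (c'x j).
have [d3 d3m e3] := E _ _ _ (cx j); have [d4 d4m e4] := E _ _ _ (c'x i).
have -> : iota (p 0 i * p' 0 j - p 0 j * p' 0 i) =
    iota (p 0 i) * d2 + d1 * (iota (p' 0 j) - d2)
    - (iota (p 0 j) * d4 + d3 * (iota (p' 0 i) - d4)).
  by rewrite rmorphB !rmorphM /= e1 e2 e3 e4; ring.
have iO := iota_O hO.
by apply: (mB hO); apply: (mD hO); first [exact: (mM hO)|
  by apply: (mMr hO) => //; apply: (OB hO) => //; apply: m_O].
Qed.

Lemma specialises_peql n (x x' : 'rV[K]_n) (p : 'rV[L]_n) :
  peq x x' -> spec x p -> spec x' p.
Proof.
case=> k k0 -> [c c0 cx]; exists (c / k); first by rewrite mulf_neq0 ?invr_eq0.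
by move=> i; rewrite mxE mulrA divfK.
Qed.

Lemma specialises_peqr n (x : 'rV[K]_n) (p p' : 'rV[L]_n) :
  peq p p' -> spec x p -> spec x p'.
Proof.
case=> k k0 -> [c c0 cx]; exists (iota k * c); first by rewrite mulf_neq0 ?fmorph_eq0.
move=> i; rewrite mxE rmorphM -mulrA -mulrBr; apply: (mM hO) => //.
exact: (iota_O hO).
Qed.

Lemma specialises_mmap (F : {mpoly L[2]}) (M : model L) (hM : nonsingular_model F M)
    (x : 'rV[K]_(amb M).+1) (z : 'rV[L]_(amb M).+1) p p0 :
  mpoint (M := base_change iota M) x -> mmap_to (M := base_change iota M) x p ->
  spec x z -> mmap_to z p0 -> spec p p0.
Proof.
move=> xZ xp [c c0 cx] [i [Ai Ap0]]; pose P := patch (m := M) i.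
have [d hd] := nm_forms hM i.
have cxO k : c * x 0 k \in O.
  rewrite -[c * _](subrK (iota (z 0 k))); apply: (OD hO); last exact: (iota_O hO).
  exact: m_O.
have E k : c ^+ d * mmap iota (x 0) (P k) - iota (eval_row P z 0 k) \in m.
  rewrite -(mmap_homog _ _ _ (hd k)) mxE meval_iota.
  by apply: (mmap_residue hO) => // l; apply: (iota_O hO).
have xA : spec (eval_row (patch (m := base_change iota M) i) x) (eval_row P z).
  exists (c ^+ d); first by rewrite expf_neq0.
  by move=> k; rewrite eval_rowK.
have [k zk] := row_neq0 Ai.
have xi : eval_row (patch (m := base_change iota M) i) x != 0.
  apply: (neq0_row (i := k)); rewrite eval_rowK; apply: contraNneq (iota_unit hO zk) => e.
  by rewrite -[iota _]opprK (mN hO) // -sub0r -[X in X - _](mulr0 (c ^+ d)) -e E.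
apply: specialises_peqr Ap0 _; apply: specialises_peql xA.
exact: (mmap_to_uniqK hM xZ (ex_intro _ i (conj xi (peq_refl _))) xp).
Qed.
End Specialises.


(** * Branches and points of the model *)

Section AffinePoint.
Variables (L K : closedFieldType) (iota : {rmorphism L -> K}) (O : {pred K}).
Hypothesis hO : specialisation_ring iota O.
Local Notation m := (max_ideal O).
Variables (F : {mpoly L[2]}) (F0 : F != 0).

(* A point at infinity of the curve is the limit of K-points of its affine part,
   obtained by Hensel's lemma on a line at infinitesimal distance. *)
Lemma affine_point_off (d : nat) (P : {mpoly L[3]}) (p : 'rV[L]_3) :
  P \is d.-homog -> proj_closure F p -> P.@[p 0] != 0 ->
  exists w : 'I_2 -> K, mmap iota w F = 0 /\ mmap iota (vec3 (w 0) (w 1) 1) P != 0.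
Proof.
move=> hP [p0 Fp] Pp.
have affine (V : 'I_3 -> K) : V 2%:R != 0 -> mmap iota V (homogenise F) = 0 ->
    mmap iota V P != 0 ->
    exists w : 'I_2 -> K, mmap iota w F = 0 /\ mmap iota (vec3 (w 0) (w 1) 1) P != 0.
  move=> V2 FV PV; pose w i := (V 2%:R)^-1 * (if i == 0 :> 'I_2 then V 0 else V 1).
  have wE : vec3 (w 0) (w 1) 1 =1 (fun i => (V 2%:R)^-1 * V i).
    by move=> i; case: (ord3P i) => ->; rewrite /vec3 /w //= mulVf.
  exists w; rewrite -homogenise_affine !(mmap_eq _ (fun=> erefl) wE).
  rewrite homogenise_scale FV mulr0 (mmap_homog _ _ _ hP); split=> //.
  by rewrite mulf_neq0 // expf_neq0 // invr_eq0.
have [z0|z0] := eqVneq (p 0 2%:R) 0; last first.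
  apply: (affine (iota \o p 0)); rewrite /= ?fmorph_eq0 // -meval_iota.
    by rewrite Fp rmorph0.
  by rewrite fmorph_eq0.
pose V (S : comNzRingType) (i : 'I_2) (s z : S) :=
  vec3 (if i == 0 then 1 else s) (if i == 0 then s else 1) z.
have [i [y [c [c0 pE]]]] : exists i y c, c != 0 /\ forall k, p 0 k = c * V L i y 0 k.
  have [x0|x0] := eqVneq (p 0 0) 0.
    have y0 : p 0 1 != 0.
      apply: contra_neq p0 => y0; apply/rowP => k.
      by rewrite mxE; case: (ord3P k) => ->.
    exists 1, 0, (p 0 1); split=> // k.
    by case: (ord3P k) => ->; rewrite /V /vec3 /= ?mulr0 ?mulr1.
  exists 0, (p 0 1 / p 0 0), (p 0 0); split=> // k.
  by case: (ord3P k) => ->; rewrite /V /vec3 /= ?mulr0 ?mulr1 // mulrC divfK.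
have T0 := homogenise_top i F0; set T := mmap _ _ _ in T0.
have VE (S S' : comNzRingType) (f : {rmorphism S -> S'}) s z k :
    f (V S i s z k) = V S' i (f s) (f z) k.
  by case: (ord3P k) => ->; rewrite /V /vec3 /=; case: (i == 0); rewrite ?rmorph1.
have TE a : T.[a] = mmap idfun (V L i a 0) (homogenise F).
  rewrite -[LHS]/(horner_eval a T) /T mmap_comp; apply: mmap_eq => [b|k] /=.
    by rewrite /horner_eval hornerC.
  rewrite -[LHS]/((horner_eval a : {rmorphism _ -> _}) (V _ i 'X 0 k)) VE.
  by rewrite /= /horner_eval hornerX horner0.
have FVy : mmap idfun (V L i y 0) (homogenise F) = 0.
  apply: (mulfI (expf_neq0 (msize F).-1 c0)).
  rewrite mulr0 -homogenise_scale -[RHS]Fp; exact: mmap_eq.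
have PVy : mmap idfun (V L i y 0) P != 0.
  apply: contraNneq Pp => e.
  rewrite -[P.@[_]]/(mmap idfun (p 0) P) (mmap_eq _ (fun=> erefl) pE) (mmap_homog _ _ _ hP).
  by rewrite e mulr0.
have [z zm zn0] := m_nonzero hO; have zO := m_O zm.
have VO s : s \in O -> forall k, V K i s z k \in O.
  by move=> sO; apply: vec3_in => //; case: (i == 0) => //; apply: (O1 hO).
have near s a Q : s \in O -> s - iota a \in m ->
    mmap iota (V K i s z) Q - iota (mmap idfun (V L i a 0) Q) \in m.
  move=> sO sa; rewrite [iota _]meval_iota; apply: (mmap_residue hO) => [||k].
  - exact: VO.
  - by move=> k; apply: (iota_O hO).
  rewrite /= VE rmorph0; case: (ord3P k) => ->; rewrite /V /vec3 /=.
  - by case: (i == 0); rewrite ?subrr ?(m0 hO).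
  - by case: (i == 0); rewrite ?subrr ?(m0 hO).
  - by rewrite subr0.
pose Vp := V {poly K} i ((iota y)%:P + 'X) z%:P.
pose f := mmap (polyC \o iota) Vp (homogenise F).
have fE s : f.[s] = mmap iota (V K i (iota y + s) z) (homogenise F).
  rewrite -[LHS]/(horner_eval s f) mmap_comp; apply: mmap_eq => [b|k] /=.
    by rewrite /horner_eval hornerC.
  rewrite -[LHS]/((horner_eval s : {rmorphism _ -> _}) (Vp k)) VE.
  by rewrite /= /horner_eval hornerD !hornerC hornerX.
have fO : f \is a polyOver O.
  apply: (mmap_polyO hO); apply: vec3_in; last exact: (polyO_C hO).
    case: (i == 0); first exact: (polyO_1 hO).
    by apply: (polyO_D hO); [apply: (polyO_C hO); apply: (iota_O hO)|apply: (polyO_X hO)].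
  case: (i == 0); last exact: (polyO_1 hO).
  by apply: (polyO_D hO); [apply: (polyO_C hO); apply: (iota_O hO)|apply: (polyO_X hO)].
have f0 : f`_0 \in m.
  rewrite -horner_coef0 fE addr0.
  have := near (iota y) y (homogenise F) (iota_O hO y).
  by rewrite FVy rmorph0 subr0 subrr; apply; apply: (m0 hO).
(* The residue of [f] is [T] shifted by [y]; a value where [T] is nonzero shows that some
   coefficient of [f] is a unit. *)
have [a nra] : exists a, ~~ root T a by apply/closed_nonrootP.
have fu : exists l, f`_l \notin m.
  apply: NNPP => nex; have fm l : f`_l \in m.
    by apply/negPn; apply: contra_notN nex => h; exists l.
  have : f.[iota a - iota y] \in m.
    rewrite horner_coef; apply: (big_ind (fun x => x \in m)).
    - exact: (m0 hO).
    - by move=> *; apply: (mD hO).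
    - by move=> l _; apply: (mMr hO) => //; apply: (OX hO); apply: (OB hO); apply: (iota_O hO).
  rewrite fE addrC subrK => h.
  have := near (iota a) a (homogenise F) (iota_O hO a).
  rewrite subrr => /(_ (m0 hO)) h'; move/negP: nra; apply; apply/rootP.
  rewrite TE; apply: (iota_m hO).
  by rewrite -[iota _](subKr (mmap iota (V K i (iota a) z) (homogenise F))) (mB hO).
have [s sm fs] := hensel_root hO fO f0 fu.
have ysO : iota y + s \in O by apply: (OD hO); [apply: (iota_O hO)|apply: m_O].
apply: (affine (V K i (iota y + s) z)) => //; first by rewrite -fE.
have ys : iota y + s - iota y \in m by rewrite addrAC subrr add0r.
have := near _ _ P ysO ys; set A := mmap _ _ _; set B := iota _ => AB.
have Bu : B \notin m by apply: (iota_unit hO).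
by have := (notin_m hO (unitDm hO Bu AB)).1; rewrite addrC subrK.
Qed.
End AffinePoint.

Section Branches.
Variables (L K : closedFieldType) (iota : {rmorphism L -> K}) (O : {pred K}).
Hypothesis hO : specialisation_ring iota O.
Local Notation m := (max_ideal O).
Local Notation spec := (specialises iota O).
Variables (F : {mpoly L[2]}) (Firr : irreducible_mpoly F).
Variables (M : model L) (hM : nonsingular_model F M).
Local Notation MK := (base_change iota M).
Variable psi : 'I_(amb M).+1 -> {mpoly L[3]}.
Hypothesis psi_on : forall p, proj_closure F p -> eval_row psi p != 0 ->
  mpoint (M := M) (eval_row psi p) /\ mmap_to (M := M) (eval_row psi p) p.
Hypothesis psi_inv : forall (x : 'rV[L]_(amb M).+1) p, mpoint (M := M) x -> mmap_to x p ->
  eval_row psi p != 0 -> peq (eval_row psi p) x.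

Variable dpsi : nat.
Hypothesis psi_homog : form_family psi dpsi.

Definition psi_at (q : 'rV[K]_2) : 'rV[K]_(amb M).+1 :=
  \row_k mmap iota (affine_pt q 0) (psi k).

Definition pt (e1 e2 : 'I_2 -> L) (x y : K) : 'rV[K]_2 := \row_i lin e1 e2 iota x y i.

Lemma ptE e1 e2 x y : pt e1 e2 x y 0 =1 lin e1 e2 iota x y.
Proof. by move=> i; rewrite mxE. Qed.

Lemma pt_swap e1 e2 x y : pt e2 e1 x y = pt e1 e2 y x.
Proof. by apply/rowP => i; rewrite !mxE lin_swap. Qed.

Lemma mmap_pt e1 e2 x y (P : {mpoly L[2]}) :
  mmap iota (pt e1 e2 x y 0) P = mmap iota (lin e1 e2 iota x y) P.
Proof. by apply: mmap_eq => // i; rewrite mxE. Qed.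

(* z is the point of the model over which the branch tangent to e1 lies. *)
Definition branch_over (e1 e2 : 'I_2 -> L) (C : {mpoly L[3]}) (z : 'rV[L]_(amb M).+1) : Prop :=
  z != 0 /\ forall x s, x \in m -> x != 0 -> on_branch1 iota O C x s ->
    spec (psi_at (pt e1 e2 x (x * s))) z.

Lemma branch_over_exists e1 e2 C : node_frame F e1 e2 C ->
  e1 0 * e2 1 - e1 1 * e2 0 != 0 ->
  (exists2 p, proj_closure F p & eval_row psi p != 0) ->
  exists z, branch_over e1 e2 C z.
Proof.
move=> fr D0 [p Fp psip]; have [l pl] := row_neq0 psip; rewrite mxE in pl.
(* [psi] is known to be nonzero at some point of the closure, possibly at infinity, while
   [branch_center] works with affine coordinates. *)
have [w [Fw Pw]] := affine_point_off hO (F_neq0 Firr) (psi_homog l) Fp pl.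
pose D P : {mpoly L[2]} := mmap (@mpolyC 2 L) (vec3 'X_0 'X_1 1) (P : {mpoly L[3]}).
have DE (v : 'I_2 -> K) P : mmap iota v (D P) = mmap iota (vec3 (v 0) (v 1) 1) P.
  rewrite /D mmap_vec3; apply: mmap_eq => [c|i]; first by rewrite /= mmapC.
  by rewrite /= !mmapX !mmap1U rmorph1.
have [|zeta [[j zj] hz]] := branch_center hO fr (to_poly2_irr D0 Firr)
    (psi := fun k => D (psi k)).
  exists l, (coord1 e1 e2 iota w), (coord2 e1 e2 iota w).
  by rewrite !(mmap_eq _ (fun=> erefl) (coordK D0 iota w)) DE.
exists (\row_k zeta k); split; first by apply: (neq0_row (i := j)); rewrite mxE.
move=> x s xm x0 sb; have [c c0 hc] := hz x s xm x0 sb.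
exists c => // k; rewrite !mxE.
suff -> : mmap iota (affine_pt (pt e1 e2 x (x * s)) 0) (psi k)
          = mmap iota (lin e1 e2 iota x (x * s)) (D (psi k)) by apply: hc.
by rewrite DE; apply: mmap_eq => // i; rewrite affine_ptE !ptE.
Qed.

Lemma psi_at_lift (q : 'rV[K]_2) : mmap iota (q 0) F = 0 -> psi_at q != 0 ->
  mpoint (M := MK) (psi_at q) /\ mmap_to (M := MK) (psi_at q) (affine_pt q).
Proof. exact: (psi_onK hM psi_on). Qed.

Lemma spec_neq0 n (x : 'rV[K]_n) (z : 'rV[L]_n) : z != 0 -> spec x z -> x != 0.
Proof.
move=> /row_neq0[k zk] [c c0 h]; apply: (neq0_row (i := k)).
apply: contraNneq (iota_unit hO zk) => e.
by rewrite -[iota _]opprK (mN hO) // -sub0r -[X in X - _](mulr0 c) -e h.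
Qed.

Lemma branch_over_lift e1 e2 C z x s : node_frame F e1 e2 C -> branch_over e1 e2 C z ->
  x \in m -> x != 0 -> on_branch1 iota O C x s ->
  let q := pt e1 e2 x (x * s) in
  [/\ mpoint (M := MK) (psi_at q), spec (psi_at q) z, psi_at q != 0
    & mmap_to (M := MK) (psi_at q) (affine_pt q)].
Proof.
move=> fr [z0 hz] xm x0 sb q; have sq := hz x s xm x0 sb.
have q0 : psi_at q != 0 := spec_neq0 z0 sq.
have Fq : mmap iota (q 0) F = 0 by rewrite mmap_pt (val_branch1 fr sb).
by have [] := psi_at_lift Fq q0.
Qed.

Section Frames.
Variables (e1 e2 : 'I_2 -> L) (C1 C2 : {mpoly L[3]}).
Hypothesis D0 : e1 0 * e2 1 - e1 1 * e2 0 != 0.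
Hypothesis fr1 : node_frame F e1 e2 C1.
Hypothesis fr2 : node_frame F e2 e1 C2.
Variables (zeta1 zeta2 : 'rV[L]_(amb M).+1).
Hypothesis hz1 : branch_over e1 e2 C1 zeta1.
Hypothesis hz2 : branch_over e2 e1 C2 zeta2.

(** Off the node the image is a nonzero infinitesimal point of one branch, where [psi] is nonzero
    and inverts the map. Its value thus specialises both to [z] and to the limit of that branch,
    which identifies the two. *)
Lemma near_point (x : 'rV[K]_(amb M).+1) (z : 'rV[L]_(amb M).+1) (p : 'rV[K]_3) :
  mpoint (M := MK) x -> spec x z -> branch_at (affine_pt (0 : 'rV[L]_2)) z ->
  mmap_to (M := MK) x p -> (p 0 0 != 0) || (p 0 1 != 0) ->
  exists q : 'rV[K]_2, [/\ peq (affine_pt q) p, peq (psi_at q) x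
    & (exists a s, [/\ a \in m, on_branch1 iota O C1 a s, q = pt e1 e2 a (a * s)
          & peq zeta1 z])
      \/ (exists b r, [/\ b \in m, on_branch1 iota O C2 b r, q = pt e1 e2 (b * r) b
          & peq zeta2 z])].
Proof.
move=> xZ xz [zZ zo] xp pn0; have z0 : z != 0 by case: zZ.
have [c c0 cp] := specialises_mmap hO hM xZ xp xz zo.
have o0 k : affine_pt (0 : 'rV[L]_2) 0 k = vec3 0 0 1 k by rewrite affine_ptE !mxE.
have p0m := cp 0; have p1m := cp 1; have p2m := cp 2%:R.
rewrite !o0 /vec3 /= ?rmorph0 ?rmorph1 ?subr0 in p0m p1m p2m.
have u : c * p 0 2%:R \notin m.
  by rewrite -[_ * _](subrK 1) addrC; apply: (unitDm hO) => //; apply: (one_notin_m hO).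
have [u0 uV] := notin_m hO u.
pose k := (c * p 0 2%:R)^-1 * c.
have k0 : k != 0 by rewrite mulf_neq0 ?invr_eq0.
have km i : c * p 0 i \in m -> k * p 0 i \in m.
  by move=> h; rewrite /k -mulrA; apply: (mM hO).
pose q : 'rV[K]_2 := \row_i (if i == 0 then k * p 0 0 else k * p 0 1).
have pq : peq p (affine_pt q).
  exists k => //; apply/rowP => i; rewrite affine_ptE !mxE /=.
  by case: (ord3P i) => -> //; rewrite /vec3 /k /= -mulrA mulVf.
have qm i : q 0 i \in m by rewrite mxE; case: ifP => _; apply: km.
have qn0 : q != 0.
  case/orP: pn0 => h; [apply: (neq0_row (i := 0))|apply: (neq0_row (i := 1))];
  by rewrite mxE mulf_neq0.
have Fq : mmap iota (q 0) F = 0.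
  case: xp => i [Ai Aip]; have FA := imageK hM xZ Ai.
  have [d d0 qE] := peq_trans Aip pq.
  rewrite -homogenise_affine.
  rewrite (_ : mmap _ _ _ = mmap iota (fun l => d * eval_row (patch (m := MK) i) x 0 l)
    (homogenise F)); last first.
    by apply: mmap_eq => // l; rewrite -affine_ptE qE mxE.
  by rewrite homogenise_scale FA mulr0.
pose a := coord1 e1 e2 iota (q 0); pose b := coord2 e1 e2 iota (q 0).
have qE : q = pt e1 e2 a b by apply/rowP => i; rewrite ptE (coordK D0).
have am : a \in m.
  by apply: (mB hO); apply: (mM hO) => //; apply: (iota_O hO).
have bm : b \in m.
  by apply: (mB hO); apply: (mM hO) => //; apply: (iota_O hO).
clearbody a b.
have Fab : mmap iota (lin e1 e2 iota a b) F = 0 by rewrite -mmap_pt -qE.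
have xq : mmap_to (M := MK) x (affine_pt q).
  by case: xp => i [Ai Aip]; exists i; split=> //; apply: peq_trans Aip pq.
have inv : psi_at q != 0 -> peq (psi_at q) x.
  case: xq => i [Ai [d d0 AE]]; set A := eval_row _ x in Ai AE.
  have psiE : psi_at q = d ^+ dpsi *: \row_k mmap iota (A 0) (psi k).
    apply/rowP => l; rewrite !mxE -(mmap_homog _ _ _ (psi_homog l)).
    by apply: mmap_eq => // l'; rewrite AE mxE.
  rewrite psiE scaler_eq0 negb_or => /andP[dn0 psiA].
  have h := psi_invK psi_inv xZ Ai psiA.
  by apply: peq_trans h; apply: peq_sym; exists (d ^+ dpsi).
exists q; have [[s bE sb]|[r aE rb]] := node_branches hO fr1 fr2 am bm Fab.
- have a0 : a != 0.
    apply: contra_neq qn0 => a0; rewrite qE bE a0 mul0r; apply/rowP => i.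
    by rewrite !mxE /lin !mulr0 addr0.
  have [_ sp n0 _] := branch_over_lift fr1 hz1 am a0 sb.
  rewrite -bE -qE in sp n0; have px := inv n0.
  split=> //; first exact: peq_sym.
  left; exists a, s; split=> //; first by rewrite -bE.
  apply: (specialises_uniq hO hz1.1 z0) xz.
  exact: specialises_peql px sp.
- have b0 : b != 0.
    apply: contra_neq qn0 => b0; rewrite qE aE b0 mul0r; apply/rowP => i.
    by rewrite !mxE /lin !mulr0 addr0.
  have [_ sp n0 _] := branch_over_lift fr2 hz2 bm b0 rb.
  rewrite pt_swap -aE -qE in sp n0; have px := inv n0.
  split=> //; first exact: peq_sym.
  right; exists b, r; split=> //; first by rewrite -aE.
  apply: (specialises_uniq hO hz2.1 z0) xz.
  exact: specialises_peql px sp.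
Qed.

Definition line_through (w : 'I_3 -> K) (z : 'rV[L]_(amb M).+1) (x : 'rV[K]_(amb M).+1) :=
  [/\ mpoint (M := MK) x, spec x z & exists p, [/\ mmap_to (M := MK) x p,
     w 0 * p 0 0 + w 1 * p 0 1 + w 2%:R * p 0 2%:R = 0
   & (p 0 0 != 0) || (p 0 1 != 0)]].

(** The constant coefficient of the moving line is a linear form in the parameter, nonzero by
    maximality of the system. At a generic parameter it does not vanish, so the line misses the node
    and the two points counted by the multiplicity lie off it. *)
Lemma touch_points z (l : 'rV[L]_3) : touches iota O F (affine_pt (0 : 'rV[L]_2)) z l ->
  exists x0 x1 w, [/\ ~ peq x0 x1, forall k, w k - iota (l 0 k) \in m,
    line_through w z x0 & line_through w z x1].
Proof.
case=> l0 _ [n n2 [s [B [v0 [hB [v00 lE] [v' v'near] hcard]]]]].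
have [[c c0 cv] [v'0 vgen]] := v'near.
have [x [xS xinj _]] := hcard v' v'near.
have hB1 i : B i \is 1%N.-homog by apply: (fs_degree hB.1).
pose W k := \sum_i v' 0 i * iota (B i)@_(U_(k)).
have HE p : (member (fun i => map_mpoly iota (B i)) v').@[p : 'I_3 -> K]
    = W 0 * p 0 + W 1 * p 1 + W 2%:R * p 2%:R.
  rewrite /member raddf_sum /= /W !mulr_suml -!big_split; apply: eq_bigr => i _ /=.
  rewrite mevalZ map_meval [in LHS](homog1E (hB1 i)) raddf_sum /=.
  rewrite !big_ord_recl big_ord0 addr0 !mmapCX !mmap1U !mulrDr !mulrA addrA.
  by congr (v' 0 i * iota (B i)@_(U_(_)) * p _ + v' 0 i * iota (B i)@_(U_(_)) * p _
    + v' 0 i * iota (B i)@_(U_(_)) * p _); apply/val_inj.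
have lk k : l 0 k = \sum_i v0 0 i * (B i)@_(U_(k)).
  have := congr1 (fun P : {mpoly L[3]} => P@_(U_(k))) lE.
  rewrite /line_form /member !raddf_sum /=.
  under [X in _ = X -> _]eq_bigr do rewrite mcoeffZ.
  move<-; rewrite (bigD1 k) //= mcoeffZ mcoeffX eqxx mulr1 big1 ?addr0 // => i ne.
  by rewrite mcoeffZ mcoeffX eq_mnm1 (negbTE ne) mulr0.
have W2 : W 2%:R != 0.
  have [i0 Bi0] := maximal_lines_origin hO Firr D0 fr1 fr2 hB.
  pose P : {mpoly L[s.+1]} := \sum_i (B i)@_(U_(2%:R)) *: 'X_i.
  have hP : P \is 1%N.-homog.
    by rewrite rpred_sum // => i _; apply: rpredZ; rewrite dhomogX /= mdeg1.
  have P0 : P != 0.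
    apply: contra_neq Bi0 => P0; have := congr1 (mcoeff U_(i0)) P0.
    rewrite /P raddf_sum /= mcoeff0 (bigD1 i0) //= mcoeffZ mcoeffX eqxx mulr1.
    by rewrite big1 ?addr0 // => i ne; rewrite mcoeffZ mcoeffX eq_mnm1 (negbTE ne) mulr0.
  have := vgen 1%N P hP P0; rewrite map_meval raddf_sum /=.
  by under eq_bigr do rewrite mmapCX mmap1U mulrC.
have xline i : line_through (fun k => c * W k) z (x i).
  have [xZ xz [p xp Hp]] := xS i; split=> //; exists p; split=> //.
    by rewrite -!mulrA -!mulrDr -HE Hp mulr0.
  apply/negPn; rewrite negb_or !negbK; apply/negP => /andP[/eqP p0 /eqP p1].
  move: Hp; rewrite HE p0 p1 !mulr0 !add0r => /eqP; rewrite mulf_eq0 (negbTE W2) /=.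
  move=> /eqP p2; case: xp => j [Aj /peq_neq0/(_ Aj)/eqP]; apply; apply/rowP => k.
  by rewrite mxE; case: (ord3P k) => ->.
have n0 : (0 < n)%N by apply: leq_trans n2.
exists (x (Ordinal n0)), (x (Ordinal n2)), (fun k => c * W k); split=> // [/xinj []//|k].
rewrite lk rmorph_sum mulr_sumr -sumrB; apply: (big_ind (fun y => y \in m)).
- exact: (m0 hO).
- by move=> *; apply: (mD hO).
move=> i _; rewrite rmorphM mulrA -mulrBl; apply: (mMr hO) => //.
exact: (iota_O hO).
Qed.

Lemma touch_center z l : branch_at (affine_pt (0 : 'rV[L]_2)) z ->
  touches iota O F (affine_pt (0 : 'rV[L]_2)) z l -> peq zeta1 z \/ peq zeta2 z.
Proof.
move=> hz /touch_points[x0 [_ [w [_ _ [x0Z x0z [p [x0p _ pn0]]] _]]]].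
have [q [_ _ [[a [s [_ _ _ h]]]|[b [r [_ _ _ h]]]]]] := near_point x0Z x0z hz x0p pn0.
  by left.
by right.
Qed.

(** As the limits differ, both points are on the first branch, and their chord has direction e1 + mu
    e2 with mu infinitesimal. The moving line contains this chord; reduction modulo the maximal
    ideal gives the equation for [l]. *)
Lemma touch_tangent z l : branch_at (affine_pt (0 : 'rV[L]_2)) z ->
  touches iota O F (affine_pt (0 : 'rV[L]_2)) z l -> ~ peq zeta1 zeta2 ->
  peq zeta1 z -> l 0 0 * e1 0 + l 0 1 * e1 1 = 0.
Proof.
move=> hz htouch n12 z1z; have [x0 [x1 [w [nx wl l0 l1]]]] := touch_points htouch.
have key x : line_through w z x -> exists a s, [/\ a \in m, on_branch1 iota O C1 a s,
    peq (psi_at (pt e1 e2 a (a * s))) x &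
    w 0 * pt e1 e2 a (a * s) 0 0 + w 1 * pt e1 e2 a (a * s) 0 1 + w 2%:R = 0].
  case=> xZ xz [p [xp wp pn0]].
  have [q [qp px [[a [s [am sb qE h]]]|[b [r [_ _ _ h]]]]]] := near_point xZ xz hz xp pn0;
    last by case: n12; apply: peq_trans z1z (peq_sym h).
  exists a, s; split=> //; rewrite -qE //.
  case: qp => d d0 pE.
  have pk k : p 0 k = d * vec3 (q 0 0) (q 0 1) 1 k by rewrite pE mxE affine_ptE.
  move: wp; rewrite !pk /vec3 /= mulr1.
  move=> e; apply: (mulfI d0); rewrite mulr0 -[RHS]e; ring.
have [a [s [am sb px0 e0]]] := key x0 l0; have [a' [s' [am' sb' px1 e1']]] := key x1 l1.
have [mu mum muE] := branch1_chord hO am am' sb sb'.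
have aa' : a - a' != 0.
  apply/eqP => h; apply: nx; move: muE; rewrite h mul0r => /eqP; rewrite subr_eq0 => /eqP.
  move/eqP: h; rewrite subr_eq0 => /eqP h h'.
  by apply: peq_trans (peq_sym px0) _; rewrite h' h.
have e : iota (l 0 0 * e1 0 + l 0 1 * e1 1) =
   - (mu * (w 0 * iota (e2 0) + w 1 * iota (e2 1))
      - (w 0 - iota (l 0 0)) * - iota (e1 0) + (w 1 - iota (l 0 1)) * iota (e1 1)).
  have e : w 0 * (iota (e1 0) + mu * iota (e2 0)) + w 1 * (iota (e1 1) + mu * iota (e2 1)) = 0.
    apply: (mulfI aa'); rewrite mulr0.
    transitivity (w 0 * ((a - a') * iota (e1 0) + (a - a') * mu * iota (e2 0))
      + w 1 * ((a - a') * iota (e1 1) + (a - a') * mu * iota (e2 1))); first by ring.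
    rewrite -muE -[RHS](subrr 0) -{1}e0 -e1' !ptE /lin; ring.
  rewrite rmorphD !rmorphM /= -[LHS]subr0 -e; ring.
have wO k : w k \in O.
  rewrite -[w k](subrK (iota (l 0 k))); apply: (OD hO); last exact: (iota_O hO).
  by apply: m_O.
have iO := iota_O hO.
apply: (iota_m hO); rewrite e; apply: (mN hO); apply: (mD hO); last exact: (mMr hO).
apply: (mB hO); apply: (mMr hO) => //; last exact: (ON hO).
by apply: (OD hO); apply: (OM hO).
Qed.
End Frames.
End Branches.


(** * Intersections of the curve with its translate *)

Lemma mmap_translate (R : fieldType) (S : comNzRingType) (j : {rmorphism R -> S})
    (G : {mpoly R[2]}) (x y : R) (w : 'I_2 -> S) :
  mmap j w (translate G x y) = mmap j (fun i => w i - j (if i == 0 then x else y)) G.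
Proof.
rewrite /translate /comp_mpoly mmap_comp; apply: mmap_eq => [c|i] /=.
  by rewrite mmapC.
by case: (ord2P i) => ->; rewrite (tnth_nth 0) /= rmorphB /= mmapX mmap1U mmapC.
Qed.

Section Gradient.
Variables (L K : fieldType) (iota : {rmorphism L -> K}) (F : {mpoly L[2]}).

Lemma grad_map (q : 'rV[K]_2) (w : 'I_2 -> K) :
  \sum_i w i * grad (map_mpoly iota F) q 0 i = \sum_i w i * mmap iota (q 0) F^`M(i).
Proof.
rewrite -mmap_coef1; under eq_bigr do rewrite mxE.
rewrite -(mmap_coef1 (@idfun K)); congr ((polyseq _)`_1).
rewrite /map_mpoly mmap_comp; apply: mmap_eq => [c|i] /=; first by rewrite mmapC.
by rewrite mmapX mmap1U.
Qed.

Lemma grad_translate (x y : K) (q : 'rV[K]_2) (w : 'I_2 -> K) :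
  \sum_i w i * grad (translate (map_mpoly iota F) x y) q 0 i
  = \sum_i w i * mmap iota (fun k => q 0 k - (if k == 0 then x else y)) F^`M(i).
Proof.
rewrite -mmap_coef1; under eq_bigr do rewrite mxE.
rewrite -(mmap_coef1 (@idfun K)) mmap_translate; congr ((polyseq _)`_1).
rewrite /map_mpoly mmap_comp; apply: mmap_eq => [c|i] /=; first by rewrite mmapC.
rewrite mmapX mmap1U.
by case: (ord2P i) => ->; rewrite /= addrAC -polyCB.
Qed.
End Gradient.

Section Crossing.
Variables (L K : closedFieldType) (iota : {rmorphism L -> K}) (O : {pred K}).
Hypothesis hO : specialisation_ring iota O.
Local Notation m := (max_ideal O).
Variables (F : {mpoly L[2]}) (Firr : irreducible_mpoly F).

(* q lies on the branch of C tangent to e1 and on the translate of the branch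
   tangent to e2, in the coordinates of the basis e1, e2. *)
Definition crossing (e1 e2 : 'I_2 -> L) (C1 C2 : {mpoly L[3]}) (t u v : K)
    (q : 'rV[K]_2) : Prop :=
  exists x s y r, [/\ x \in m /\ y \in m, on_branch1 iota O C1 x s,
    on_branch1 iota O C2 y r, q = pt iota e1 e2 x (x * s)
    & x - t * u = y * r /\ x * s - t * v = y].

Variables (e1 e2 : 'I_2 -> L) (C1 C2 : {mpoly L[3]}).
Hypothesis D0 : e1 0 * e2 1 - e1 1 * e2 0 != 0.
Hypothesis fr1 : node_frame F e1 e2 C1.
Hypothesis fr2 : node_frame F e2 e1 C2.
Variables (t : K) (tm : t \in m) (t0 : t != 0).
Variables (u v : L) (u0 : u != 0) (v0 : v != 0).

Local Notation U := (iota u).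
Local Notation V := (iota v).
Local Notation FK := (map_mpoly iota F).
Local Notation Ft := (translate FK (t * iota (e1 0 * u + e2 0 * v))
                                   (t * iota (e1 1 * u + e2 1 * v))).
Local Notation cross := (crossing e1 e2 C1 C2 t U V).

Lemma crossing_exists : exists q, cross q.
Proof.
have [x [s [r [[xm x0] sb rm xE [y0 Fy]]]]] :=
  branches_meet_shift hO fr1 (to_poly2_irr D0 Firr) tm t0 u0 v0.
have ym : x * s - t * V \in m.
  apply: (mB hO); first by apply: (mMr hO) => //; apply: m_O; apply: sb.1.
  by apply: (mMr hO) => //; apply: (iota_O hO).
exists (pt iota e1 e2 x (x * s)), x, s, (x * s - t * V), r; split=> //.
apply: (on_branch1P hO fr2) => //; first exact: m_O.
by rewrite (mmap_lin_swap e1 e2) -xE.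
Qed.

(** Two crossings would span a chord of both branches. Then dy = mu dx and dx = nu dy with mu and nu
    infinitesimal, so both differences vanish. *)
Lemma crossing_uniq q q' : cross q -> cross q' -> q = q'.
Proof.
case=> x [s [y [r [[xm ym] sb rb -> [xE yE]]]]].
case=> x' [s' [y' [r' [[xm' ym'] sb' rb' -> [xE' yE']]]]].
have [mu mum muE] := branch1_chord hO xm xm' sb sb'.
have [nu num nuE] := branch1_chord hO ym ym' rb rb'.
have dy : y - y' = (x - x') * mu by rewrite -yE -yE' -muE; ring.
have dx : x - x' = (y - y') * nu by rewrite -nuE -xE -xE'; ring.
have : (x - x') * (1 - mu * nu) = 0.
  by rewrite mulrBr mulr1 mulrA -dy -dx subrr.
have : 1 - mu * nu \notin m.
  apply: (unitDm hO); first exact: (one_notin_m hO).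
  by apply: (mN hO); apply: (mMr hO) => //; apply: m_O.
case/(notin_m hO)=> w0 _ /eqP; rewrite mulf_eq0 (negbTE w0) orbF subr_eq0 => /eqP xx.
suff -> : x' * s' = x * s by rewrite xx.
by apply/eqP; rewrite eq_sym -subr_eq0 muE xx subrr mul0r.
Qed.

(** If x or y were 0, one of [U] and [V] would be an infinitesimal multiple of the other, although
    both are units. The derivative and lifting lemmas apply only away from the node. *)
Lemma crossing_neq0 x s y r : s \in m -> r \in m ->
  x - t * U = y * r -> x * s - t * V = y -> x != 0 /\ y != 0.
Proof.
move=> sm rm xE yE; have Uu := iota_unit hO u0; have Vu := iota_unit hO v0.
split; apply/eqP => z0.
- move/negP: Uu; apply; have : t * U = t * (V * r).
    apply: oppr_inj; rewrite -[LHS]sub0r -{1}z0 xE -yE z0; ring.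
  by move/(mulfI t0)->; apply: (mM hO) => //; apply: (iota_O hO).
- move/negP: Vu; apply; have : t * V = t * (U * s).
    move/eqP: yE; rewrite z0 subr_eq0 => /eqP <-.
    by move/eqP: xE; rewrite z0 mul0r subr_eq0 => /eqP ->; rewrite mulrA.
  by move/(mulfI t0)->; apply: (mM hO) => //; apply: (iota_O hO).
Qed.

Lemma pt_shift x y i : pt iota e1 e2 x y 0 i -
    (if i == 0 then t * iota (e1 0 * u + e2 0 * v) else t * iota (e1 1 * u + e2 1 * v))
  = lin e1 e2 iota (x - t * U) (y - t * V) i.
Proof.
by case: (ord2P i) => ->; rewrite ptE /lin /= rmorphD !rmorphM; ring.
Qed.

Lemma translate_eval x y : Ft.@[pt iota e1 e2 x y 0]
  = mmap iota (lin e1 e2 iota (x - t * U) (y - t * V)) F.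
Proof.
rewrite -[LHS]/(mmap idfun _ _) mmap_translate -[LHS]/(meval _ _) map_meval.
by apply: mmap_eq => // i; rewrite /= pt_shift.
Qed.

Lemma FK_eval x y : FK.@[pt iota e1 e2 x y 0] = mmap iota (lin e1 e2 iota x y) F.
Proof. by rewrite map_meval mmap_pt. Qed.

Lemma pt_m x y : x \in m -> y \in m -> forall i, pt iota e1 e2 x y 0 i \in m.
Proof.
move=> xm ym i; rewrite ptE; apply: (mD hO); apply: (mM hO) => //;
exact: (iota_O hO).
Qed.

Lemma crossing_meets q : cross q ->
  [/\ FK.@[q 0] = 0, Ft.@[q 0] = 0 & forall i, q 0 i \in m].
Proof.
case=> x [s [y [r [[xm ym] sb rb -> [xE yE]]]]]; split.
- by rewrite FK_eval (val_branch1 fr1 sb).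
- by rewrite translate_eval xE yE -(mmap_lin_swap e1 e2) (val_branch1 fr2 rb).
- by apply: pt_m => //; apply: (mMr hO) => //; apply: m_O; apply: sb.1.
Qed.

(** A nonzero point on both branches would have reciprocal slopes s and s', both infinitesimal. *)
Lemma crossing_disjoint q : cross q -> crossing e2 e1 C2 C1 t V U q -> False.
Proof.
case=> x [s [y [r [[xm ym] sb rb -> [xE yE]]]]].
case=> x' [s' [y' [r' [[xm' ym'] sb' rb' e [xE' yE']]]]].
rewrite [pt iota e2 _ _ _]pt_swap in e.
have [|e1' e2'] := lin_inj D0 (j := iota) (x := x) (y := x * s) (x' := x' * s') (y' := x').
  by move=> i; rewrite -!ptE e.
have [x0 _] := crossing_neq0 sb.1 rb.1 xE yE.
have : s * s' = 1 by apply: (mulfI x0); rewrite mulr1 mulrA e2' -e1'.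
by move/(m_unit hO sb.1); rewrite (m_O sb'.1).
Qed.

(** If q and its shift lay on the same branch, their chord would have direction (U, V), whose slope
    is a unit and not infinitesimal. The two mixed cases are the crossings. *)
Lemma crossing_complete (q : 'rV[K]_2) :
  FK.@[q 0] = 0 -> Ft.@[q 0] = 0 -> (forall i, q 0 i \in m) ->
  cross q \/ crossing e2 e1 C2 C1 t V U q.
Proof.
move=> Fq Ftq qm; have [a [b [am bm qE]]] :
    exists a b, [/\ a \in m, b \in m & q = pt iota e1 e2 a b].
  exists (coord1 e1 e2 iota (q 0)), (coord2 e1 e2 iota (q 0)); split.
  - by apply: (mB hO); apply: (mM hO) => //; apply: (iota_O hO).
  - by apply: (mB hO); apply: (mM hO) => //; apply: (iota_O hO).
  - by apply/rowP => i; rewrite ptE (coordK D0).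
rewrite qE FK_eval in Fq; rewrite qE translate_eval in Ftq.
have Uu := iota_unit hO u0; have Vu := iota_unit hO v0.
have am' : a - t * U \in m by apply: (mB hO) => //; apply: (mMr hO) => //; apply: (iota_O hO).
have bm' : b - t * V \in m by apply: (mB hO) => //; apply: (mMr hO) => //; apply: (iota_O hO).
have [[s bE sb]|[r aE rb]] := node_branches hO fr1 fr2 am bm Fq;
  have [[s' bE' sb']|[r' aE' rb']] := node_branches hO fr1 fr2 am' bm' Ftq.
- have [mu mum muE] := branch1_chord hO am am' sb sb'.
  case/negP: Vu; have : t * V = t * (U * mu).
    rewrite mulrA; rewrite -bE -bE' in muE.
    have -> : t * V = b - (b - t * V) by ring.
    by rewrite muE; ring.
  by move/(mulfI t0)->; apply: (mM hO) => //; apply: (iota_O hO).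
- by left; exists a, s, (b - t * V), r'; split=> //; rewrite -?bE.
- right; exists b, r, (a - t * U), s'; split=> //; rewrite -?aE //.
  by rewrite [RHS]pt_swap.
- have [mu mum muE] := branch1_chord hO bm bm' rb rb'.
  case/negP: Uu; have : t * U = t * (V * mu).
    rewrite mulrA; rewrite -aE -aE' in muE.
    have -> : t * U = a - (a - t * U) by ring.
    by rewrite muE; ring.
  by move/(mulfI t0)->; apply: (mM hO) => //; apply: (iota_O hO).
Qed.

Lemma dF_swap x y al be : dF iota F e1 e2 x y al be = dF iota F e2 e1 y x be al.
Proof.
by apply: eq_bigr => i _; rewrite lin_swap (mmap_lin_swap e1 e2).
Qed.

(** In the basis [e1], [e2] the gradients are close to x (0, 1) and y (1, 0), up to infinitesimal
    relative errors; proportionality would make y times a unit vanish. *)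
Lemma crossing_transverse q : cross q -> transverse_at FK Ft q.
Proof.
move=> cq; have [Fq Ftq _] := crossing_meets cq.
case: cq => x [s [y [r [[xm ym] sb rb qE [xE yE]]]]].
have [x0 y0] := crossing_neq0 sb.1 rb.1 xE yE.
pose A al be := \sum_i lin e1 e2 iota al be i * grad FK q 0 i.
pose B al be := \sum_i lin e1 e2 iota al be i * grad Ft q 0 i.
have AE al be : A al be = dF iota F e1 e2 x (x * s) al be.
  by rewrite /A grad_map; apply: eq_bigr => i _; rewrite qE mmap_pt.
have BE al be : B al be = dF iota F e2 e1 y (y * r) be al.
  rewrite -dF_swap /B grad_translate; apply: eq_bigr => i _; congr (_ * _).
  by apply: mmap_eq => // k; rewrite qE pt_shift xE yE.
have [O0 O1] := (O0 hO, O1 hO).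
have [a1 a1m A01] := dF_branch1 hO fr1 xm x0 sb O0 O1.
have [a2 a2m A10] := dF_branch1 hO fr1 xm x0 sb O1 O0.
have [b1 b1m B10] := dF_branch1 hO fr2 ym y0 rb O0 O1.
have [b2 b2m B01] := dF_branch1 hO fr2 ym y0 rb O1 O0.
have {}A01 := etrans (AE 0 1) A01; have {}A10 := etrans (AE 1 0) A10.
have {}B10 := etrans (BE 1 0) B10; have {}B01 := etrans (BE 0 1) B01.
rewrite add0r in A10; rewrite add0r in B01.
have unit1 c : c \in m -> 1 + c \notin m.
  by move=> cm; apply: (unitDm hO) => //; apply: (one_notin_m hO).
have nz z c : z != 0 -> c \in m -> z * (1 + c) != 0.
  by move=> z0 cm; rewrite mulf_neq0 //; case: (notin_m hO (unit1 _ cm)).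
split; first by split.
- apply: contra_neq (nz x a1 x0 a1m) => g0; rewrite -A01 /A g0 big1 // => i _.
  by rewrite mxE mulr0.
- apply: contra_neq (nz y b1 y0 b1m) => g0; rewrite -B10 /B g0 big1 // => i _.
  by rewrite mxE mulr0.
case=> k _ tE.
have gE i : grad Ft q 0 i = k * grad FK q 0 i.
  have tg G : (tangent_at G q : 'rV[K]_(2 + 1)) 0 (lshift 1 i) = grad G q 0 i.
    exact: row_mxEl.
  by apply: etrans (esym (tg Ft)) _; rewrite tE mxE; congr (_ * _); apply: tg.
have BA al be : B al be = k * A al be.
  rewrite /A mulr_sumr; transitivity (\sum_i lin e1 e2 iota al be i * (k * grad FK q 0 i)).
    by apply: eq_bigr => i _; congr (_ * _).
  by apply: eq_bigr => i _; rewrite mulrCA.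
have e1' := BA 1 0; have e2' := BA 0 1; rewrite B10 A10 in e1'; rewrite B01 A01 in e2'.
have : y * ((1 + b1) * (1 + a1) - a2 * b2) = 0.
  transitivity (y * (1 + b1) * (1 + a1) - a2 * (y * b2)); first by ring.
  by rewrite e1' e2'; ring.
have : (1 + b1) * (1 + a1) - a2 * b2 \notin m.
  apply: (unitDm hO); first by apply: (unitM hO); apply: unit1.
  by apply: (mN hO); apply: (mMr hO) => //; apply: m_O.
case/(notin_m hO) => w0 _ /eqP; rewrite mulf_eq0 (negbTE w0) orbF.
by rewrite (negbTE y0).
Qed.

Lemma crossing_on_branch (M : model L) (hM : nonsingular_model F M)
    (psi : 'I_(amb M).+1 -> {mpoly L[3]})
    (psi_on : forall p, proj_closure F p -> eval_row psi p != 0 ->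
      mpoint (M := M) (eval_row psi p) /\ mmap_to (M := M) (eval_row psi p) p)
    (zeta z : 'rV[L]_(amb M).+1) q :
  branch_over iota O psi e1 e2 C1 zeta -> peq zeta z -> cross q ->
  lies_on_branch iota O z (affine_pt q).
Proof.
move=> hz zz [x [s [y [r [[xm ym] sb rb -> [xE yE]]]]]].
have [x0 _] := crossing_neq0 sb.1 rb.1 xE yE.
have [xZ sp _ mp] := branch_over_lift hO hM psi_on fr1 hz xm x0 sb.
by eexists; split; [exact: xZ|exact: specialises_peqr zz sp|exact: mp].
Qed.
End Crossing.


(** * Matching the branches with the given tangents *)

Lemma row3_peq (R : fieldType) (a b u v : R) :
  row3 a b 0 != 0 -> (u != 0) || (v != 0) -> a * u + b * v = 0 ->
  peq (row3 a b 0) (row3 v (- u) 0).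
Proof.
move=> ab uv e; apply: minor_peq => // [|i j].
  case/orP: uv => h; [apply: (neq0_row (i := 1))|apply: (neq0_row (i := 0))];
  by rewrite mxE ?oppr_eq0.
have e' : a * - u = b * v by apply/eqP; rewrite -subr_eq0 mulrN -opprD e oppr0.
by rewrite !mxE; case: (ord3P i) => ->; case: (ord3P j) => ->;
  rewrite /= ?mulr0 ?mul0r // ?e' // mulrC.
Qed.

Section Labelled.
Variables (L K : closedFieldType) (iota : {rmorphism L -> K}) (O : {pred K}).
Hypothesis hO : specialisation_ring iota O.
Local Notation m := (max_ideal O).
Variables (F : {mpoly L[2]}) (Firr : irreducible_mpoly F).
Variables (M : model L) (hM : nonsingular_model F M).
Variable psi : 'I_(amb M).+1 -> {mpoly L[3]}.
Hypothesis psi_on : forall p, proj_closure F p -> eval_row psi p != 0 ->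
  mpoint (M := M) (eval_row psi p) /\ mmap_to (M := M) (eval_row psi p) p.
Hypothesis psi_inv : forall (x : 'rV[L]_(amb M).+1) p, mpoint (M := M) x -> mmap_to x p ->
  eval_row psi p != 0 -> peq (eval_row psi p) x.
Variable dpsi : nat.
Hypothesis psi_homog : form_family psi dpsi.
Variables (e1 e2 : 'I_2 -> L) (C1 C2 : {mpoly L[3]}).
Hypothesis D0 : e1 0 * e2 1 - e1 1 * e2 0 != 0.
Hypothesis fr1 : node_frame F e1 e2 C1.
Hypothesis fr2 : node_frame F e2 e1 C2.
Variables (zeta1 zeta2 z1 z2 : 'rV[L]_(amb M).+1).
Hypothesis hzeta1 : branch_over iota O psi e1 e2 C1 zeta1.
Hypothesis hzeta2 : branch_over iota O psi e2 e1 C2 zeta2.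
Hypothesis n12 : ~ peq zeta1 zeta2.

(** Stated for a given matching of frames with [z1] and [z2], so that it can be used again with the
    frames exchanged. As each tangent contains its basis vector, the direction (u, v) has both
    coordinates nonzero. *)
Lemma labelled_intersections (a b c d u v : L) (t : K) :
  branch_at (affine_pt (0 : 'rV[L]_2)) z1 -> branch_at (affine_pt (0 : 'rV[L]_2)) z2 ->
  touches iota O F (affine_pt (0 : 'rV[L]_2)) z1 (row3 a b 0) ->
  touches iota O F (affine_pt (0 : 'rV[L]_2)) z2 (row3 c d 0) ->
  peq zeta1 z1 -> peq zeta2 z2 -> (u != 0) || (v != 0) ->
  ~ peq (row3 a b 0) (row3 v (- u) 0) -> ~ peq (row3 c d 0) (row3 v (- u) 0) ->
  t \in m -> t != 0 ->
  let FK := map_mpoly iota F in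
  let Ft := translate FK (t * iota u) (t * iota v) in
  exists q1 q2 : 'rV[K]_2,
    [/\ q1 != q2,
        forall q : 'rV[K]_2,
          [/\ FK.@[q 0] = 0, Ft.@[q 0] = 0 & forall i, q 0 i \in m]
          <-> q = q1 \/ q = q2,
        lies_on_branch iota O z1 (affine_pt q1) /\
        lies_on_branch iota O z2 (affine_pt q2)
      & transverse_at FK Ft q1 /\ transverse_at FK Ft q2].
Proof.
move=> bz1 bz2 t1 t2 zz1 zz2 uv n1 n2 tm t0 FK Ft.
have D0' := det_swap D0.
have n21 : ~ peq zeta2 zeta1 by move/peq_sym.
have tan1 := touch_tangent hO Firr hM psi_on psi_inv psi_homog D0 fr1 fr2 hzeta1 hzeta2 bz1 t1 n12 zz1.
have tan2 := touch_tangent hO Firr hM psi_on psi_inv psi_homog D0' fr2 fr1 hzeta2 hzeta1 bz2 t2 n21 zz2.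
rewrite !mxE /= in tan1 tan2.
pose w i := if i == 0 :> 'I_2 then u else v.
have [u' [v' wE]] : exists u' v', lin e1 e2 idfun u' v' =1 w.
  by exists (coord1 e1 e2 idfun w), (coord2 e1 e2 idfun w); apply: (coordK D0 idfun).
have uE : u = e1 0 * u' + e2 0 * v' by have := wE 0.
have vE : v = e1 1 * u' + e2 1 * v' by have := wE 1.
have v'0 : v' != 0.
  apply/eqP => z0; apply: n1; apply: row3_peq => //; first by case: t1.
  by rewrite uE vE z0 !mulr0 !addr0 !mulrA -mulrDl tan1 mul0r.
have u'0 : u' != 0.
  apply/eqP => z0; apply: n2; apply: row3_peq => //; first by case: t2.
  by rewrite uE vE z0 !mulr0 !add0r !mulrA -mulrDl tan2 mul0r.
have FtE : Ft = translate FK (t * iota (e1 0 * u' + e2 0 * v'))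
    (t * iota (e1 1 * u' + e2 1 * v')) by rewrite /Ft uE vE.
have FtE' : Ft = translate FK (t * iota (e2 0 * v' + e1 0 * u'))
    (t * iota (e2 1 * v' + e1 1 * u')) by rewrite FtE addrC [e1 1 * _ + _]addrC.
have [q1 c1] := crossing_exists hO Firr D0 fr1 fr2 tm t0 u'0 v'0.
have [q2 c2] := crossing_exists hO Firr D0' fr2 fr1 tm t0 v'0 u'0.
exists q1, q2; split.
- apply/eqP => e; rewrite -e in c2.
  exact: (crossing_disjoint hO D0 t0 u'0 v'0 c1 c2).
- move=> q; split=> [[]|[->|->]].
  + rewrite FtE => Fq Fq' qm.
    have [cq|cq] := crossing_complete hO D0 fr1 fr2 tm t0 u'0 v'0 Fq Fq' qm.
      by left; apply: (crossing_uniq hO cq c1).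
    by right; apply: (crossing_uniq hO cq c2).
  + by rewrite FtE; apply: (crossing_meets hO fr1 fr2 c1).
  + by rewrite FtE'; apply: (crossing_meets hO fr2 fr1 c2).
- split.
    exact: (crossing_on_branch hO fr1 t0 u'0 v'0 hM psi_on hzeta1 zz1 c1).
  exact: (crossing_on_branch hO fr2 t0 v'0 u'0 hM psi_on hzeta2 zz2 c2).
- split.
    by rewrite FtE; apply: (crossing_transverse hO fr1 fr2 t0 u'0 v'0 c1).
  by rewrite FtE'; apply: (crossing_transverse hO fr2 fr1 t0 v'0 u'0 c2).
Qed.
End Labelled.

Theorem theorem1p13
  (L K : closedFieldType) (iota : {rmorphism L -> K}) (O : {pred K})
  (hchar : 2%N \notin [pchar L])
  (htr : infinite_trdeg iota)
  (hO : specialisation_ring iota O)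
  (F : {mpoly L[2]})
  (hirr : irreducible_mpoly F)
  (hodp : ordinary_double_point F)
  (M : model L) (hM : nonsingular_model F M)
  (z1 z2 : 'rV[L]_(amb M).+1)
  (hz1 : branch_at (affine_pt (0 : 'rV[L]_2)) z1)
  (hz2 : branch_at (affine_pt (0 : 'rV[L]_2)) z2)
  (hz12 : ~ peq z1 z2)
  (a b c d : L)
  (hl1 : branch_tangent iota O F (affine_pt (0 : 'rV[L]_2)) z1 (row3 a b 0))
  (hl2 : branch_tangent iota O F (affine_pt (0 : 'rV[L]_2)) z2 (row3 c d 0))
  (u v : L)
  (huv : (u != 0) || (v != 0))
  (huv1 : ~ peq (row3 a b 0) (row3 v (- u) 0))
  (huv2 : ~ peq (row3 c d 0) (row3 v (- u) 0))
  (t : K)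
  (ht0 : t \in max_ideal O)
  (htgen : ~ algebraicOver iota t) :
  let FK := map_mpoly iota F in
  let Ft := translate FK (t * iota u) (t * iota v) in
  exists q1 q2 : 'rV[K]_2,
    [/\ q1 != q2,
        forall q : 'rV[K]_2,
          [/\ FK.@[q 0] = 0, Ft.@[q 0] = 0 & forall i, q 0 i \in max_ideal O]
          <-> q = q1 \/ q = q2,
        lies_on_branch iota O z1 (affine_pt q1) /\
        lies_on_branch iota O z2 (affine_pt q2)
      & transverse_at FK Ft q1 /\ transverse_at FK Ft q2].
Proof.
have t0 : t != 0 by apply/eqP => t0; apply: htgen; rewrite t0; apply: algebraic0.
have [psi [[dpsi hd] psin psi_on psi_inv]] := nm_birational hM.
have [e1 [e2 [C1 [C2 [D0 fr1 fr2]]]]] := node_frames hodp.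
have D0' := det_swap D0.
have [zeta1 hzeta1] := branch_over_exists hO hirr hd fr1 D0 psin.
have [zeta2 hzeta2] := branch_over_exists hO hirr hd fr2 D0' psin.
have [t1 _] := hl1; have [t2 _] := hl2.
have near1 := touch_center hO hirr hM psi_on psi_inv hd D0 fr1 fr2 hzeta1 hzeta2 hz1 t1.
have near2 := touch_center hO hirr hM psi_on psi_inv hd D0 fr1 fr2 hzeta1 hzeta2 hz2 t2.
have same z : peq z z1 -> peq z z2 -> False.
  by move=> h h'; apply: hz12; apply: peq_trans (peq_sym h) h'.
(* Both [z1] and [z2] are among the limits, so equal limits would identify [z1] with [z2]. *)
have n12 : ~ peq zeta1 zeta2.
  move=> h; case: near1 => h1; case: near2 => h2; try exact: same h1 h2.
  - by apply: same h1 (peq_trans h h2).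
  - by apply: same (peq_trans h h1) h2.
case: near1 => h1; case: near2 => h2; try by case: (same _ h1 h2).
- exact: (labelled_intersections hO hirr hM psi_on psi_inv hd D0 fr1 fr2 hzeta1 hzeta2
    n12 hz1 hz2 t1 t2 h1 h2 huv huv1 huv2 ht0 t0).
(* The remaining matching pairs [z1] with the branch along [e2]; exchanging the frames reduces it to
   the previous one. *)
have n21 : ~ peq zeta2 zeta1 by move/peq_sym.
exact: (labelled_intersections hO hirr hM psi_on psi_inv hd D0' fr2 fr1 hzeta2 hzeta1
    n21 hz1 hz2 t1 t2 h1 h2 huv huv1 huv2 ht0 t0).
Qed.
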